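(* Let $N$ be a $4$-dimensional Riemannian space form of constant sectional curvature $L_0$. There exist surfaces in $N$ (conformal immersions $F:M\to N$ of Riemann surfaces $M$) with $K\equiv L_0$ and $R^{\perp}\equiv 0$ satisfying both of the following: (a) the second fundamental form of $F$ satisfies the linearly dependent condition, i.e. there is a function $\theta$ of $(u,v)$ with $\cos\theta\,(\alpha_1,\alpha_2,\alpha_3)+\sin\theta\,(\beta_1,\beta_2,\beta_3)=(0,0,0)$; (b) there do not exist any parallel normal vector fields of $F$.
   Context: All objects are smooth. $h$ is the metric of $N$, $\nabla$ its Levi-Civita connection. $K$ is the curvature of the metric $g$ induced on $M$ by $F$; $R^{\perp}$ is the curvature tensor of the normal connection $\nabla^{\perp}$ of $F$. In local isothermal coordinates $(u,v)$ of $M$, $g=e^{2\lambda}(du^2+dv^2)$; $T_1=dF(\partial_u)$, $T_2=dF(\partial_v)$; $N_1,N_2$ are normal vector fields of $F$ with $h(N_1,N_1)=h(N_2,N_2)=e^{2\lambda}$, $h(N_1,N_2)=0$. The real functions $\alpha_k,\beta_k$ ($k=1,2,3$) are defined by: the normal components of $\nabla_{T_1}T_1$, $\nabla_{T_1}T_2$, $\nabla_{T_2}T_2$ are $\alpha_1N_1+\beta_1N_2$, $\alpha_2N_1+\beta_2N_2$, $\alpha_3N_1+\beta_3N_2$ respectively. A parallel normal vector field is a nowhere zero normal vector field $\xi$ of $F$ with $\nabla\xi=0$ for the Levi-Civita connection $\nabla$ of $N$. *)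

(* Defs.v *)
From HB Require Import structures.
From mathcomp Require Import all_boot all_order all_algebra.
From mathcomp Require Import all_classical all_reals all_analysis.
Set Implicit Arguments.
Unset Strict Implicit.
Unset Printing Implicit Defensive.
Import Order.TTheory GRing.Theory Num.Theory.
Import numFieldNormedType.Exports.
Local Open Scope classical_set_scope.
Local Open Scope ring_scope.

Section Calculus.
Context {R : realType} {n : nat} {W : normedModType R}.

Definition pd (i : 'I_n) (f : 'rV[R]_n -> W) (x : 'rV[R]_n) : W :=
  'D_(delta_mx 0 i) f x.

(* Only meant for open [U]. *)
Fixpoint Ck (k : nat) (U : set 'rV[R]_n) (f : 'rV[R]_n -> W) : Prop :=
  match k with
  | 0%N => forall x, U x -> {for x, continuous f}
  | k'.+1 => (forall x, U x -> differentiable f x) /\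
             (forall i, Ck k' U (pd i f))
  end.

Definition smooth_on (U : set 'rV[R]_n) (f : 'rV[R]_n -> W) : Prop :=
  forall k, Ck k U f.

End Calculus.

(* [cinv] is only meaningful on [cimg]; vectors are rows. *)
Record chart (R : realType) (n : nat) (X : topologicalType) := Chart {
  cdom : set X;
  cmap : X -> 'rV[R]_n;
  cinv : 'rV[R]_n -> X }.

Section Charts.
Context {R : realType} {n : nat} {X : topologicalType}.
Implicit Types c d : chart R n X.

Definition cimg c : set 'rV[R]_n := cmap c @` cdom c.

Definition is_chart c : Prop :=
  [/\ open (cdom c), open (cimg c),
      forall p, cdom c p -> cinv c (cmap c p) = p,
      forall p, cdom c p -> {for p, continuous (cmap c)}
    & forall x, cimg c x -> {for x, continuous (cinv c)}].

Definition overlap c d : set 'rV[R]_n := cmap c @` (cdom c `&` cdom d).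

Definition trans c d : 'rV[R]_n -> 'rV[R]_n := cmap d \o cinv c.

End Charts.

Record manifold (R : realType) (n : nat) := Manifold {
  mcarrier :> topologicalType;
  atlas : set (chart R n mcarrier);
  manifold_hausdorff : hausdorff_space mcarrier;
  manifold_second_countable : @second_countable mcarrier;
  atlas_chart : forall c, atlas c -> is_chart c;
  atlas_cover : forall p : mcarrier, exists2 c, atlas c & cdom c p;
  atlas_smooth : forall c d, atlas c -> atlas d ->
    smooth_on (overlap c d) (trans c d) }.

Definition ip {R : realType} {n : nat} (A : 'M[R]_n) (v w : 'rV[R]_n) : R :=
  (v *m A *m w^T) 0 0.

(* A metric is given by its coefficient matrices in the charts of the atlas,
   as functions of the coordinates. *)
Record riem_metric (R : realType) (n : nat) (N : manifold R n) := RiemMetric {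
  coef :> chart R n N -> 'rV[R]_n -> 'M[R]_n;
  coef_smooth : forall c, atlas c -> forall i j,
    smooth_on (cimg c) (fun x => coef c x i j : R);
  coef_sym : forall c x, atlas c -> cimg c x -> (coef c x)^T = coef c x;
  coef_pos : forall c x v, atlas c -> cimg c x -> v != 0 ->
    0 < ip (coef c x) v v;
  coef_compat : forall c d x v w, atlas c -> atlas d -> overlap c d x ->
    ip (coef c x) v w =
    ip (coef d (trans c d x)) ('D_v (trans c d) x) ('D_w (trans c d) x) }.

Section LocalRiemannian.
Context {R : realType} {n : nat}.
Variable G : 'rV[R]_n -> 'M[R]_n.

(* Gamma^k_{ij} *)
Definition christoffel (k i j : 'I_n) (x : 'rV[R]_n) : R :=
  2^-1 * \sum_(l < n) invmx (G x) k l *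
    (pd i (fun y => G y j l : R) x + pd j (fun y => G y i l : R) x
     - pd l (fun y => G y i j : R) x).

(* The component along d_l of
   R(d_i, d_j) d_k = nabla_i nabla_j d_k - nabla_j nabla_i d_k. *)
Definition riem (l k i j : 'I_n) (x : 'rV[R]_n) : R :=
  (pd i (christoffel l j k) x : R) - (pd j (christoffel l i k) x : R)
  + \sum_(m < n) (christoffel l i m x * christoffel m j k x
                  - christoffel l j m x * christoffel m i k x).

Definition curv (x X Y Z : 'rV[R]_n) : 'rV[R]_n :=
  \row_l \sum_(i < n) \sum_(j < n) \sum_(k < n)
     X 0 i * Y 0 j * Z 0 k * riem l k i j x.

Definition sectional (x X Y : 'rV[R]_n) : R :=
  ip (G x) (curv x X Y Y) X /
  (ip (G x) X X * ip (G x) Y Y - ip (G x) X Y ^+ 2).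

End LocalRiemannian.

Definition constant_curvature (R : realType) (n : nat) (N : manifold R n)
    (h : riem_metric N) (L0 : R) : Prop :=
  forall (c : chart R n N) (x X Y : 'rV[R]_n), atlas c -> cimg c x ->
    row_free (col_mx X Y) -> sectional (h c) x X Y = L0.

(* Connected, and with holomorphic transition maps for the complex
   coordinate u + i v, where (u, v) are the coordinates of index 0 and 1. *)
Definition riemann_surface (R : realType) (M : manifold R 2) : Prop :=
  [/\ [set: M] !=set0, connected [set: M]
    & forall (c d : chart R 2 M) x, atlas c -> atlas d -> overlap c d x ->
        (pd 0 (trans c d) x 0 0 = pd 1 (trans c d) x 0 1) /\
        (pd 1 (trans c d) x 0 0 = - pd 0 (trans c d) x 0 1)].

(* A surface in coordinates: [f] is the map, [G] the metric of the target. *)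
Section LocalSurface.
Context {R : realType} {n : nat}.
Variables (G : 'rV[R]_n -> 'M[R]_n) (f : 'rV[R]_2 -> 'rV[R]_n).

Definition tvec (i : 'I_2) (q : 'rV[R]_2) : 'rV[R]_n := pd i f q.

Definition fprod (q : 'rV[R]_2) (v w : 'rV[R]_n) : R := ip (G (f q)) v w.

Definition induced (q : 'rV[R]_2) : 'M[R]_2 :=
  \matrix_(i, j) fprod q (tvec i q) (tvec j q).

(* nabla_{T_i} xi, for a vector field xi along f *)
Definition cov (i : 'I_2) (xi : 'rV[R]_2 -> 'rV[R]_n) (q : 'rV[R]_2)
    : 'rV[R]_n :=
  pd i xi q + \row_k \sum_(a < n) \sum_(b < n)
    christoffel G k a b (f q) * tvec i q 0 a * xi q 0 b.

Definition normal (q : 'rV[R]_2) (w : 'rV[R]_n) : Prop :=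
  forall i, fprod q (tvec i q) w = 0.

Definition nor (q : 'rV[R]_2) (w : 'rV[R]_n) : 'rV[R]_n :=
  w - \sum_(i < 2) \sum_(j < 2)
        (invmx (induced q) i j * fprod q (tvec j q) w) *: tvec i q.

Definition ncov (i : 'I_2) (xi : 'rV[R]_2 -> 'rV[R]_n) (q : 'rV[R]_2)
    : 'rV[R]_n := nor q (cov i xi q).

(* R^perp(d_u, d_v) xi; there is no bracket term since [d_u, d_v] = 0. *)
Definition ncurv (xi : 'rV[R]_2 -> 'rV[R]_n) (q : 'rV[R]_2) : 'rV[R]_n :=
  ncov 0 (ncov 1 xi) q - ncov 1 (ncov 0 xi) q.

(* g = e^{2 lam} (du^2 + dv^2) *)
Definition isothermal (V : set 'rV[R]_2) (lam : 'rV[R]_2 -> R) : Prop :=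
  forall q, V q -> induced q = (expR (2 * lam q))%:M.

Definition normal_field (V : set 'rV[R]_2) (xi : 'rV[R]_2 -> 'rV[R]_n) : Prop :=
  smooth_on V xi /\ forall q, V q -> normal q (xi q).

Definition normal_frame (V : set 'rV[R]_2) (lam : 'rV[R]_2 -> R)
    (N1 N2 : 'rV[R]_2 -> 'rV[R]_n) : Prop :=
  [/\ normal_field V N1, normal_field V N2
    & forall q, V q ->
      [/\ fprod q (N1 q) (N1 q) = expR (2 * lam q),
          fprod q (N2 q) (N2 q) = expR (2 * lam q)
        & fprod q (N1 q) (N2 q) = 0]].

(* al = (alpha_1, alpha_2, alpha_3) and be = (beta_1, beta_2, beta_3) *)
Definition second_form (V : set 'rV[R]_2) (N1 N2 : 'rV[R]_2 -> 'rV[R]_n)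
    (al be : 'rV[R]_2 -> 'rV[R]_3) : Prop :=
  forall q, V q ->
    [/\ nor q (cov 0 (tvec 0) q) = al q 0 0 *: N1 q + be q 0 0 *: N2 q,
        nor q (cov 0 (tvec 1) q) = al q 0 1 *: N1 q + be q 0 1 *: N2 q
      & nor q (cov 1 (tvec 1) q) = al q 0 2 *: N1 q + be q 0 2 *: N2 q].

Definition linearly_dependent_on (V : set 'rV[R]_2) : Prop :=
  exists (lam : 'rV[R]_2 -> R) (N1 N2 : 'rV[R]_2 -> 'rV[R]_n)
         (al be : 'rV[R]_2 -> 'rV[R]_3) (theta : 'rV[R]_2 -> R),
    [/\ isothermal V lam, normal_frame V lam N1 N2, second_form V N1 N2 al be,
        smooth_on V (theta : 'rV[R]_2 -> R)
      & forall q, V q ->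
          cos (theta q) *: al q + sin (theta q) *: be q = 0].

End LocalSurface.

Section Surface.
Context {R : realType} {n : nat} {M : manifold R 2} {N : manifold R n}.
Variables (h : riem_metric N) (F : M -> N).
Implicit Types (phi : chart R 2 M) (c : chart R n N).

Definition locdom phi c : set 'rV[R]_2 :=
  cmap phi @` (cdom phi `&` F @^-1` (cdom c)).

Definition loc phi c : 'rV[R]_2 -> 'rV[R]_n := cmap c \o F \o cinv phi.

Definition conformal_immersion : Prop :=
  continuous F /\
  forall phi c, atlas phi -> atlas c ->
    smooth_on (locdom phi c) (loc phi c) /\
    exists lam : 'rV[R]_2 -> R,
      isothermal (h c) (loc phi c) (locdom phi c) lam.

(* K = L0 identically: the sectional curvature of the tangent plane *)
Definition induced_curvature_is (L0 : R) : Prop :=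
  forall phi c q, atlas phi -> atlas c -> locdom phi c q ->
    sectional (induced (h c) (loc phi c)) q (delta_mx 0 0) (delta_mx 0 1) = L0.

Definition normal_flat : Prop :=
  forall phi c (V : set 'rV[R]_2) (xi : 'rV[R]_2 -> 'rV[R]_n),
    atlas phi -> atlas c -> open V -> V `<=` locdom phi c ->
    normal_field (h c) (loc phi c) V xi ->
    forall q, V q -> ncurv (h c) (loc phi c) xi q = 0.

(* The condition does not depend on the isothermal coordinates or on the
   frame (N1, N2), which exists only locally: a rotation of the frame, or a
   change of its orientation, only shifts theta or changes its sign. *)
Definition linearly_dependent : Prop :=
  forall phi c q, atlas phi -> atlas c -> locdom phi c q ->
    exists V : set 'rV[R]_2,
      [/\ open V, V q, V `<=` locdom phi c
        & linearly_dependent_on (h c) (loc phi c) V].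

(* A vector field along F on M, given by its components in the charts of N. *)
Definition field_along (xi : chart R n N -> M -> 'rV[R]_n) : Prop :=
  forall c d p, atlas c -> atlas d -> cdom c (F p) -> cdom d (F p) ->
    xi d p = 'D_(xi c p) (trans c d) (cmap c (F p)).

Definition parallel_normal_field (xi : chart R n N -> M -> 'rV[R]_n) : Prop :=
  field_along xi /\
  forall phi c, atlas phi -> atlas c ->
    normal_field (h c) (loc phi c) (locdom phi c) (xi c \o cinv phi) /\
    forall q, locdom phi c q ->
      xi c (cinv phi q) != 0 /\
      forall i, cov (h c) (loc phi c) i (xi c \o cinv phi) q = 0.

End Surface.

(* Main.v *)
Require Import Defs.
From HB Require Import structures.
From mathcomp Require Import all_boot all_order all_algebra.
From mathcomp Require Import all_classical all_reals all_analysis.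
From mathcomp Require Import ring lra.
Import Defs.
Import Order.TTheory GRing.Theory Num.Theory.
Import numFieldNormedType.Exports.
Set Implicit Arguments.
Unset Strict Implicit.
Unset Printing Implicit Defensive.
Local Open Scope classical_set_scope.
Local Open Scope ring_scope.

(** The surface is obtained by integrating the equations of a moving frame. Let
    [E 0], ..., [E 3] be orthonormal vector fields along the surface, the first
    two tangent to it, let [p] and [m] be functions of [v] alone, and require

    - the coordinate fields to be [p *: E 0] and [p *: E 1];
    - every [E a] to be parallel in the direction of [v];
    - in the direction of [u], the covariant derivatives
      [E0' = - m E1 + E2], [E1' = m E0], [E2' = - E0 + E3], [E3' = - E2];
    - [dp/dv = p m] and [dm/dv = - L0 p ^ 2].

    For [L0 = 0], [p = 1], [m = 0] this is the cylinder over a curve of curvature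
    and torsion 1. In general the [v]-lines are geodesics, and all the claims can
    be read off from the equations.

    - The metric is [p ^ 2 (du ^ 2 + dv ^ 2)], whose curvature
      [- (ln p)'' / p ^ 2 = - m' / p ^ 2] is [L0] ([adapted_sectional]).
    - The second fundamental form is [p du ^ 2] times [E 2]. With [N1 = p E2] and
      [N2 = p E3] the vector [be] vanishes, and [theta = pi / 2] will do
      ([adapted_linearly_dependent]).
    - The normal connection rotates [E 2] and [E 3] at speed one in the direction
      of [u] and not at all in that of [v], so it is flat ([adapted_ncurv]).
    - A parallel normal field is orthogonal to [E 0], hence to the normal part
      [E 2] of [E0'], hence to the normal part [E 3] of [E2']; it is zero
      ([adapted_no_parallel]).

    The system is integrable because the curvature of the ambient metric is
    constant. It is a total differential system for the position, the frame and
    the pair [(p, m)], given by two vector fields [frame_u] and [frame_v] on the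
    space of these data. At orthonormal frames the two commute because
    [R(E0, E1) Ea = L0 (<E1, Ea> E0 - <E0, Ea> E1)] ([frame_field_comm]), which
    holds because the sectional curvatures determine the curvature tensor, by
    polarization ([constant_curvature_tensor]). Since the commutation fails for frames that are
    not orthonormal, the local Frobenius theorem [frobenius] is proved relative to
    a set that solutions do not leave, and [orthonormal_invariant] shows that
    orthonormal frames form such a set. Its proof solves the system along rays
    from the origin ([picard]) and estimates how the end point depends on the ray.

    The frame is constructed in a single chart of the ambient manifold, while the
    properties of the surface refer to all charts. The transformation law of the
    Christoffel symbols ([chr_transform]) carries the equations of the frame from
    one chart to another ([adapted_pushforward]), so that each property is proved
    once, from the equations. *)

(** * Directional derivatives *)

Section DerivativeFacts.
Context {R : realType}.
Implicit Types (V W : normedModType R).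

(** Remainder estimates produce differentials in this form. *)
Lemma differentiable_epsP V W (f : V -> W) (L : {linear V -> W}) x :
  continuous L ->
  (forall e, 0 < e -> \forall y \near x, `|f y - f x - L (y - x)| <= e * `|y - x|) ->
  differentiable f x /\ ('d f x : V -> W) = L.
Proof.
move=> cL H.
have E : f \o shift x = cst (f x) + L +o_ 0 id.
  apply/eqaddoP => e e0.
  have := H e e0; rewrite (near_shift 0 x) => H'.
  apply: filterS H' => y /=; rewrite subr0 /= => h.
  have -> : (f \o shift x - (cst (f x) + L)) y = f (y + x) - f x - L (y + x - x).
    by rewrite !fctE /= addrK opprD addrA.
  by rewrite /= [X in _ * `|X|](_ : _ = y + x - x) // addrK.
have dL : ('d f x : V -> W) = L by exact: diff_unique.
by split=> //; apply/diff_locallyP; rewrite dL.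
Qed.

Lemma differentiable_eps V W (f : V -> W) x e :
  differentiable f x -> 0 < e ->
  \forall y \near x, `|f y - f x - 'd f x (y - x)| <= e * `|y - x|.
Proof.
move=> df e0.
have /eqaddoP /(_ e e0) := diff_locally df.
rewrite (near_shift 0 x); apply: filterS => y /=; rewrite subr0 /=.
rewrite !fctE /= addrK opprD addrA //.
Qed.

Lemma near_eq_differentiable V W (f g : V -> W) x :
  (\near x, f x = g x) -> differentiable f x -> differentiable g x.
Proof.
move=> fg df.
have [] // := @differentiable_epsP V W g ('d f x) x _ _.
  exact: diff_continuous.
have fgx := nbhs_singleton fg.
move=> e e0; have := differentiable_eps df e0; move: fg; apply: filterS2 => y <-.
by rewrite -fgx.
Qed.

Lemma derive_comp V W (U : normedModType R) (f : U -> V) (g : V -> W) x v :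
  differentiable f x -> differentiable g (f x) ->
  'D_v (g \o f) x = 'D_('D_v f x) g (f x).
Proof.
move=> df dg; rewrite !deriveE //; last exact: differentiable_comp.
by rewrite diff_comp.
Qed.

Lemma derive_addv V W (f : V -> W) x v w : differentiable f x ->
  'D_(v + w) f x = 'D_v f x + 'D_w f x.
Proof. by move=> df; rewrite !deriveE // linearD. Qed.

Lemma derive_scalev V W (f : V -> W) x a v : differentiable f x ->
  'D_(a *: v) f x = a *: 'D_v f x.
Proof. by move=> df; rewrite !deriveE // linearZ. Qed.

Lemma derive_pd n W (f : 'rV[R]_n -> W) x v : differentiable f x ->
  'D_v f x = \sum_i v 0 i *: pd i f x.
Proof.
move=> df; rewrite /pd deriveE // {1}[v]row_sum_delta linear_sum.
by apply: eq_bigr => i _; rewrite linearZ deriveE.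
Qed.

Lemma differentiable_bigsum V W n (f : 'I_n -> V -> W) x :
  (forall i, differentiable (f i) x) ->
  differentiable (fun y => \sum_(i < n) f i y) x.
Proof.
move=> H; have -> : (fun y => \sum_(i < n) f i y) = \sum_(i < n) f i.
  by apply/funext => y; rewrite fct_sumE.
exact: differentiable_sum.
Qed.

Lemma derive_bigsum V W n (f : 'I_n -> V -> W) x v :
  (forall i, differentiable (f i) x) ->
  'D_v (fun y => \sum_(i < n) f i y) x = \sum_(i < n) 'D_v (f i) x.
Proof.
move=> H; have -> : (fun y => \sum_(i < n) f i y) = \sum_(i < n) f i.
  by apply/funext => y; rewrite fct_sumE.
by rewrite derive_sum // => i; exact: diff_derivable.
Qed.

Lemma derive_prod V (f g : V -> R) x v : differentiable f x -> differentiable g x ->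
  'D_v (fun y => f y * g y) x = f x * 'D_v g x + g x * 'D_v f x.
Proof.
by move=> df dg; rewrite deriveM //; exact: diff_derivable.
Qed.

Lemma differentiable_mxP V m n (f : V -> 'M[R]_(m, n)) x :
  differentiable f x <-> forall i j, differentiable (fun y => f y i j : R) x.
Proof.
split=> [df i j|H].
  exact: (differentiable_comp df (differentiable_coord _ i j)).
have -> : f = fun y => \sum_i \sum_j f y i j *: (delta_mx i j : 'M[R]_(m, n)).
  by apply/funext => y; rewrite {1}[f y]matrix_sum_delta.
apply: differentiable_bigsum => i; apply: differentiable_bigsum => j.
exact: differentiableZl.
Qed.

Lemma derive_mx_coord V m n (f : V -> 'M[R]_(m, n)) x v i j :
  differentiable f x -> 'D_v f x i j = 'D_v (fun y => f y i j : R) x.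
Proof. by move=> df; rewrite derive_mx ?mxE//; exact: diff_derivable. Qed.

Lemma derive_line V W (f : V -> W) x v (t : R) : differentiable f (x + t *: v) ->
  is_derive t 1 (fun s => f (x + s *: v)) ('D_v f (x + t *: v)).
Proof.
move=> df.
have dl : is_diff t (fun s : R => x + s *: v) (fun s => s *: v).
  by apply: (@is_diff_eq _ _ _ _ (0 + (fun s => s *: v))); rewrite add0r.
have [dl1 dl2] := dl.
have dc : differentiable (fun s : R => f (x + s *: v)) t.
  exact: (@differentiable_comp _ _ _ _ (fun s : R => x + s *: v) f).
apply: DeriveDef; first exact: diff_derivable.
rewrite (@derive_comp _ _ _ (fun s : R => x + s *: v) f)//.
congr ('D_ _ f _).
by rewrite deriveE // dl2 scale1r.
Qed.

End DerivativeFacts.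

(** * Maps of class C^k *)

Section SmoothClosure.
Context {R : realType} {n : nat}.
Implicit Types (U : set 'rV[R]_n).

Lemma Ck_sub (W : normedModType R) k U U' (f : 'rV[R]_n -> W) :
  U' `<=` U -> Ck k U f -> Ck k U' f.
Proof.
move=> UU'; elim: k f => [|k IH] f /=; first by move=> H x /UU'; exact: H.
by move=> [H1 H2]; split=> [x /UU'|i]; [exact: H1|exact/IH].
Qed.

Lemma Ck_pred (W : normedModType R) k U (f : 'rV[R]_n -> W) :
  Ck k.+1 U f -> Ck k U f.
Proof.
elim: k f => [|k IH] f /=.
  by move=> [H _] x /H; exact: differentiable_continuous.
by move=> [H1 H2]; split=> // i; exact/IH/H2.
Qed.

Lemma pd_near (W : normedModType R) (f g : 'rV[R]_n -> W) x i :
  (\near x, f x = g x) -> pd i f x = pd i g x.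
Proof. exact: near_eq_derive. Qed.

Lemma Ck_eq (W : normedModType R) k U (f g : 'rV[R]_n -> W) : open U ->
  (forall x, U x -> f x = g x) -> Ck k U f -> Ck k U g.
Proof.
move=> oU; elim: k f g => [|k IH] f g fg /=.
  move=> H x Ux; have fgx : \near x, f x = g x.
    by near=> y; apply: fg; near: y; exact: open_nbhs_nbhs.
  have Hf : f @ x --> g x by rewrite -(fg x Ux); exact: H.
  by apply: cvg_trans Hf; apply: (@near_eq_cvg _ _ (nbhs x)); apply: filterS fgx => y ->.
have fgx x : U x -> \near x, f x = g x.
  by move=> Ux; near=> y; apply: fg; near: y; exact: open_nbhs_nbhs.
move=> [H1 H2]; split=> [x Ux|i].
  exact: near_eq_differentiable (fgx x Ux) (H1 x Ux).
by apply: IH (H2 i) => x Ux; exact: pd_near (fgx x Ux).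
Unshelve. all: by end_near. Qed.

Lemma Ck_cst (W : normedModType R) k U (c : W) : Ck k U (fun=> c).
Proof.
elim: k c => [|k IH] c /=; first by move=> x _; exact: cst_continuous.
split=> [x _|i]; first exact: differentiable_cst.
have -> : pd i (fun=> c) = fun=> 0 :> W by apply/funext => x; rewrite /pd derive_cst.
exact: IH.
Qed.

Lemma Ck_add (W : normedModType R) k U (f g : 'rV[R]_n -> W) : open U ->
  Ck k U f -> Ck k U g -> Ck k U (fun x => f x + g x).
Proof.
move=> oU; elim: k f g => [|k IH] f g /=.
  by move=> H1 H2 x Ux; apply: continuousD; [exact: H1|exact: H2].
move=> [H1 H1'] [H2 H2']; split=> [x Ux|i].
  by apply: differentiableD; auto.
apply: Ck_eq (IH _ _ (H1' i) (H2' i)) => // x Ux.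
by rewrite /pd deriveD //; apply: diff_derivable; auto.
Qed.

Lemma Ck_mul k U (f g : 'rV[R]_n -> R) : open U ->
  Ck k U f -> Ck k U g -> Ck k U (fun x => f x * g x).
Proof.
move=> oU; elim: k f g => [|k IH] f g.
  by move=> H1 H2 x Ux; apply: continuousM; [exact: H1|exact: H2].
move=> Cf Cg; have fk := Ck_pred Cf; have gk := Ck_pred Cg.
move: Cf Cg => [H1 H1'] [H2 H2']; split=> [x Ux|i].
  by apply: differentiableM; auto.
apply: Ck_eq (Ck_add oU (IH _ _ fk (H2' i)) (IH _ _ gk (H1' i))) => // x Ux.
by rewrite /pd derive_prod //; auto.
Qed.

Lemma Ck_big (W : normedModType R) k U (op : W -> W -> W) (idx : W) (I : Type) (r : seq I)
    (P : pred I) (f : I -> 'rV[R]_n -> W) :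
  (forall g h, Ck k U g -> Ck k U h -> Ck k U (fun x => op (g x) (h x))) ->
  (forall i, Ck k U (f i)) -> Ck k U (fun x => \big[op/idx]_(i <- r | P i) f i x).
Proof.
move=> Cop H; elim: r => [|i r IH].
  have -> : (fun x => \big[op/idx]_(i <- [::] | P i) f i x) = fun=> idx.
    by apply/funext => x; rewrite big_nil.
  exact: Ck_cst.
have -> : (fun x => \big[op/idx]_(j <- i :: r | P j) f j x) = fun x =>
    if P i then op (f i x) (\big[op/idx]_(j <- r | P j) f j x)
    else \big[op/idx]_(j <- r | P j) f j x by apply/funext => x; rewrite big_cons.
by case: (P i) => //; exact: Cop.
Qed.

Lemma Ck_sum (W : normedModType R) k U (I : Type) (r : seq I) (P : pred I)
    (f : I -> 'rV[R]_n -> W) : open U ->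
  (forall i, Ck k U (f i)) -> Ck k U (fun x => \sum_(i <- r | P i) f i x).
Proof. by move=> oU; apply: Ck_big => g h; exact: Ck_add. Qed.

Lemma Ck_prod k U (I : Type) (r : seq I) (P : pred I) (f : I -> 'rV[R]_n -> R) : open U ->
  (forall i, Ck k U (f i)) -> Ck k U (fun x => \prod_(i <- r | P i) f i x).
Proof. by move=> oU; apply: Ck_big => g h; exact: Ck_mul. Qed.

Lemma Ck_inv k U (f : 'rV[R]_n -> R) : open U -> (forall x, U x -> f x != 0) ->
  Ck k U f -> Ck k U (fun x => (f x)^-1).
Proof.
move=> oU f0; elim: k => [|k IH].
  by move=> H x Ux; apply: continuousV; auto.
move=> Cf; have /IH gk := Ck_pred Cf; case: Cf => [H1 H2].
split=> [x Ux|i].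
  by apply: differentiableV; auto.
have C : Ck k U (fun x => -1 * ((f x)^-1 * (f x)^-1) * pd i f x).
  exact: Ck_mul oU (Ck_mul oU (Ck_cst _ _ _) (Ck_mul oU gk gk)) (H2 i).
apply: Ck_eq C => // x Ux.
rewrite /pd deriveV ?f0 //; last exact/diff_derivable/H1.
by rewrite expr2 invfM mulN1r.
Qed.

Lemma Ck_mxP k U p m (f : 'rV[R]_n -> 'M[R]_(p, m)) : open U ->
  Ck k U f <-> forall i j, Ck k U (fun x => f x i j : R).
Proof.
move=> oU; split.
  elim: k f => [|k IH] f /=.
    move=> H i j x Ux.
    apply: (@continuous_comp _ _ _ f (fun M : 'M[R]_(p, m) => M i j)).
      exact: H.
    exact: coord_continuous.
  move=> [H1 H2] i j; split=> [x Ux|l]; first by have /differentiable_mxP := H1 x Ux.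
  apply: Ck_eq (IH _ (H2 l) i j) => // x Ux.
  by rewrite /pd derive_mx_coord //; exact: H1.
move=> H.
have -> : f = fun y => \sum_i \sum_j f y i j *: (delta_mx i j : 'M[R]_(p, m)).
  by apply/funext => y; rewrite {1}[f y]matrix_sum_delta.
have Z (g : 'rV[R]_n -> R) (M : 'M[R]_(p, m)) : Ck k U g -> Ck k U (fun x => g x *: M).
  elim: (k) g => [|l IH] g /=.
    by move=> Cg x Ux; apply: (@cvgZr_tmp _ _ _ (nbhs x)); exact: (Cg x Ux).
  move=> [H1 H2]; split=> [x Ux|i]; first exact/differentiableZl/H1.
  apply: Ck_eq (IH _ (H2 i)) => // x Ux.
  have dx := H1 x Ux; rewrite /pd !deriveE //; last exact: differentiableZl.
  by rewrite diffZl.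
by apply: Ck_sum => // i; apply: Ck_sum => // j; exact: Z.
Qed.

Lemma Ck_coord k U (i : 'I_n) : Ck k U (fun x : 'rV[R]_n => x 0 i : R).
Proof.
case: k => [|k] /=; first by move=> x _; exact: coord_continuous.
split=> [x _|j]; first exact: differentiable_coord.
have -> : pd j (fun x : 'rV[R]_n => x 0 i : R) = fun=> (delta_mx 0 j : 'rV[R]_n) 0 i.
  apply/funext => x; rewrite /pd -(@derive_mx_coord _ _ 1 n id) //.
  by rewrite derive_id.
exact: Ck_cst.
Qed.

Lemma Ck_det k U m (A : 'rV[R]_n -> 'M[R]_m) : open U ->
  (forall i j, Ck k U (fun x => A x i j : R)) -> Ck k U (fun x => \det (A x)).
Proof.
move=> oU H; apply: Ck_sum => // s; apply: Ck_mul => //; first exact: Ck_cst.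
exact: Ck_prod.
Qed.

Lemma Ck_invmx k U m (A : 'rV[R]_n -> 'M[R]_m) : open U ->
  (forall x, U x -> A x \in unitmx) ->
  (forall i j, Ck k U (fun x => A x i j : R)) ->
  forall i j, Ck k U (fun x => invmx (A x) i j : R).
Proof.
move=> oU uA H i j.
have C : Ck k U (fun x => (\det (A x))^-1 * cofactor (A x) j i).
  apply: Ck_mul => //.
    apply: Ck_inv => //; last exact: Ck_det.
    by move=> x /uA; rewrite unitmxE unitfE.
  apply: Ck_mul => //; first exact: Ck_cst.
  by apply: Ck_det => // a b; apply: Ck_eq (H (lift j a) (lift i b)) => // x _; rewrite !mxE.
by apply: Ck_eq C => // x /uA ux; rewrite /invmx ux !mxE.
Qed.

End SmoothClosure.

Section SmoothComposition.
Context {R : realType} {n m : nat}.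

Lemma pd_comp (W : normedModType R) (f : 'rV[R]_n -> 'rV[R]_m) (g : 'rV[R]_m -> W)
    (x : 'rV[R]_n) (i : 'I_n) :
  differentiable f x -> differentiable g (f x) ->
  pd i (g \o f) x = \sum_j pd i f x 0 j *: pd j g (f x).
Proof. by move=> df dg; rewrite /pd derive_comp // derive_pd. Qed.

Lemma Ck_comp k (U : set 'rV[R]_n) (V : set 'rV[R]_m) (f : 'rV[R]_n -> 'rV[R]_m)
    (g : 'rV[R]_m -> R) : open U -> (forall x, U x -> V (f x)) ->
  Ck k U f -> Ck k V g -> Ck k U (g \o f).
Proof.
move=> oU UV; elim: k g => [|k IH] g.
  move=> Cf Cg x Ux; apply: continuous_comp; first exact: Cf.
  by apply: Cg; exact: UV.
move=> Cf Cg; have fk := Ck_pred Cf.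
move: Cf Cg => [f1 f2] [g1 g2]; split=> [x Ux|i].
  by apply: differentiable_comp; auto.
have C : Ck k U (fun x => \sum_j pd i f x 0 j * (pd j g \o f) x).
  apply: Ck_sum => // j; apply: Ck_mul => //; last exact: (IH _ fk (g2 j)).
  by have /(Ck_mxP _ _ oU)/(_ 0 j) := f2 i.
apply: Ck_eq C => // x Ux; rewrite pd_comp //; auto.
Qed.

Lemma smooth_comp p (U : set 'rV[R]_n) (V : set 'rV[R]_m) (f : 'rV[R]_n -> 'rV[R]_m)
    (g : 'rV[R]_m -> 'rV[R]_p) : open U -> open V -> (forall x, U x -> V (f x)) ->
  smooth_on U f -> smooth_on V g -> smooth_on U (g \o f).
Proof.
move=> oU oV UV sf sg k; apply/Ck_mxP => // i j.
by apply: (@Ck_comp k U V f (fun y => g y i j)) => //; have /(Ck_mxP _ _ oV) := sg k.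
Qed.

End SmoothComposition.

(** * Symmetry of second derivatives *)

Section Schwarz.
Context {R : realType} {V : normedModType R}.

Lemma differentiable_along (f : V -> R) (x v w : V) e :
  differentiable f x -> 0 < e ->
  exists2 d : R, 0 < d & forall s t, `|s| <= d -> `|t| <= d ->
    `|f (x + s *: v + t *: w) - f x - (s * 'D_v f x + t * 'D_w f x)|
      <= e * (`|s| + `|t|).
Proof.
move=> df e0; pose C := `|v| + `|w| + 1.
have C0 : 0 < C by rewrite /C; have := normr_ge0 v; have := normr_ge0 w; lra.
have eC : 0 < e / C by rewrite divr_gt0.
have /nbhs_ballP[d /= d0 H] := differentiable_eps df eC.
exists (d / (4 * C)); first by rewrite divr_gt0 // mulr_gt0.
move=> s t hs ht.
have est : `|s *: v + t *: w| <= (`|s| + `|t|) * C.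
  apply: (le_trans (ler_normD _ _)); rewrite !normrZ mulrDl.
  by apply: lerD; apply: ler_wpM2l => //; rewrite /C;
     have := normr_ge0 v; have := normr_ge0 w; lra.
have dC : d / (4 * C) * C = d / 4 by field; rewrite gt_eqF.
have /H : ball x d (x + s *: v + t *: w).
  rewrite -ball_normE /= -addrA opprD addrA subrr sub0r normrN.
  apply: (le_lt_trans est); apply: (@le_lt_trans _ _ (d / 2)); last by lra.
  by have := ler_wpM2r (ltW C0) hs; have := ler_wpM2r (ltW C0) ht; rewrite dC; lra.
have -> : x + s *: v + t *: w - x = s *: v + t *: w.
  by rewrite -[x + _ + _]addrA [LHS]addrAC subrr add0r.
rewrite linearD !linearZ /= !deriveE // => /le_trans; apply.
rewrite -mulrA; apply: ler_wpM2l (ltW e0) _ _ _.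
by rewrite mulrC ler_pdivrMr.
Qed.

(** The mean value theorem for [s |-> f (x + s *: v + t *: w) - f (x + s *: v)]
    leaves a difference of two values of ['D_v f], and differentiability of
    ['D_v f] at [x] alone is enough to evaluate it. *)
Lemma second_difference (f : V -> R) (x v w : V) e :
  (\forall y \near x, differentiable f y) -> differentiable (fun y => 'D_v f y) x ->
  0 < e -> exists2 d : R, 0 < d & forall t, 0 < t -> t < d ->
    `|f (x + t *: v + t *: w) - f (x + t *: v) - f (x + t *: w) + f x
      - t ^+ 2 * 'D_w (fun y => 'D_v f y) x| <= e * t ^+ 2.
Proof.
move=> /nbhs_ballP[r /= r0 df] dA e0; pose C := `|v| + `|w| + 1.
have C0 : 0 < C by rewrite /C; have := normr_ge0 v; have := normr_ge0 w; lra.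
have e3 : 0 < e / 3 by lra.
have [d d0 H] := differentiable_along v w dA e3.
have rC : 0 < r / C by rewrite divr_gt0.
exists (Num.min d (r / C)); first by rewrite lt_min d0.
move=> t t0; rewrite lt_min => /andP[td trC].
have inball s u : 0 <= s <= t -> 0 <= u <= t -> differentiable f (x + s *: v + u *: w).
  move=> /andP[s0 st] /andP[u0 ut]; apply: df.
  rewrite -ball_normE /= -addrA opprD addrA subrr sub0r normrN.
  apply: (le_lt_trans (ler_normD _ _)); rewrite !normrZ !ger0_norm //.
  apply: (@le_lt_trans _ _ (t * C)); last by rewrite -ltr_pdivlMr.
  by rewrite /C !mulrDr mulr1; have := ler_wpM2r (normr_ge0 v) st;
     have := ler_wpM2r (normr_ge0 w) ut; lra.
pose phi s := f (x + s *: v + t *: w) - f (x + s *: v).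
pose dphi s := 'D_v f (x + s *: v + t *: w) - 'D_v f (x + s *: v).
have dphiE s : 0 <= s <= t -> is_derive s 1 phi (dphi s).
  move=> st; apply: is_deriveB.
    have -> : (fun s => f (x + s *: v + t *: w)) = fun s => f (x + t *: w + s *: v).
      by apply/funext => z; rewrite addrAC.
    have := @derive_line _ _ _ f (x + t *: w) v s; rewrite addrAC; apply.
    by apply: inball => //; rewrite ltW //=.
  apply: derive_line; have := inball s 0 st; rewrite scale0r addr0; apply.
  by rewrite lexx ltW.
have dphiI s : s \in `]0, t[ -> is_derive s 1 phi (dphi s).
  by move=> /itvP st; apply: dphiE; rewrite !st.
have cphi : {within `[0, t], continuous phi}.
  apply: continuous_in_subspaceT => s /set_mem /= /itvP st.
  have [h _] : is_derive s 1 phi (dphi s) by apply: dphiE; rewrite !st.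
  by apply: differentiable_continuous; apply/derivable1_diffP.
have [c /itvP ct E] := MVT t0 dphiI cphi.
rewrite /phi !scale0r !addr0 subr0 in E.
have c0 : 0 <= c by rewrite ct.
have ct' : c <= t by rewrite ct.
have cd := le_trans ct' (ltW td).
have := H c t; rewrite (ger0_norm c0) (ger0_norm (ltW t0)) => /(_ cd (ltW td)) h1.
have := H c 0; rewrite scale0r addr0 mul0r addr0 normr0 addr0 (ger0_norm c0).
move=> /(_ cd (ltW d0)) h2.
set D := 'D_w _ x; have hd : `|dphi c - t * D| <= e * t.
  have -> : dphi c - t * D =
    ('D_v f (x + c *: v + t *: w) - 'D_v f x - (c * 'D_v ('D_v f) x + t * D))
    - ('D_v f (x + c *: v) - 'D_v f x - c * 'D_v ('D_v f) x) by rewrite /dphi; ring.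
  apply: (le_trans (ler_normB _ _)); apply: (le_trans (lerD h1 h2)).
  have := ler_wpM2l (ltW e3) ct'; lra.
have -> : f (x + t *: v + t *: w) - f (x + t *: v) - f (x + t *: w) + f x - t ^+ 2 * D
   = (dphi c - t * D) * t.
  by rewrite mulrBl -[in RHS](E); ring.
rewrite normrM (ger0_norm (ltW t0)) expr2 mulrA; exact: ler_wpM2r (ltW t0) _ _ hd.
Qed.

(** Young's form of the symmetry of second derivatives: both iterated
    derivatives are limits of the same second difference quotient. *)
Lemma derive_swap (f : V -> R) (x v w : V) :
  (\forall y \near x, differentiable f y) ->
  differentiable (fun y => 'D_v f y) x -> differentiable (fun y => 'D_w f y) x ->
  'D_w (fun y => 'D_v f y) x = 'D_v (fun y => 'D_w f y) x.
Proof.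
move=> df dv dw; apply/eqP; rewrite -subr_eq0 -normr_le0.
apply/ler_addgt0Pr => e e0; rewrite add0r.
have e2 : 0 < e / 2 by lra.
have [d1 d10 H1] := second_difference w df dv e2.
have [d2 d20 H2] := second_difference v df dw e2.
pose t := Num.min d1 d2 / 2.
have m0 : 0 < Num.min d1 d2 by rewrite lt_min d10.
have t0 : 0 < t by rewrite divr_gt0.
have tm : t < Num.min d1 d2 by rewrite /t; lra.
move: (tm); rewrite lt_min => /andP[/(H1 t t0) h1 /(H2 t t0)].
set D1 := 'D_w _ _ in h1 *; set D2 := 'D_v _ _.
have -> : x + t *: w + t *: v = x + t *: v + t *: w by rewrite addrAC.
move=> h2.
have t2 : 0 < t ^+ 2 by rewrite exprn_gt0.
rewrite -(ler_pM2r t2) -{1}[t ^+ 2](gtr0_norm t2) -normrM.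
set A := f (x + t *: v + t *: w) in h1 h2.
have -> : (D1 - D2) * t ^+ 2 =
  (A - f (x + t *: w) - f (x + t *: v) + f x - t ^+ 2 * D2)
  - (A - f (x + t *: v) - f (x + t *: w) + f x - t ^+ 2 * D1) by ring.
apply: (le_trans (ler_normB _ _)); apply: (le_trans (lerD h2 h1)).
by rewrite -mulrDl -splitr.
Qed.

End Schwarz.

(** * Mean value estimates *)

Section MeanValue.
Context {R : realType}.

Lemma mx_norm_le m n (A : 'M[R]_(m, n)) (K : R) : 0 <= K ->
  (forall i j, `|A i j| <= K) -> `|A| <= K.
Proof.
move=> K0 H; rewrite [`|A|]mx_normrE; apply: bigmax_le => //= -[i j] _; exact: H.
Qed.

Lemma mx_norm_coord m n (A : 'M[R]_(m, n)) i j : `|A i j| <= `|A|.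
Proof. by rewrite [X in _ <= X]mx_normrE; apply: (le_bigmax _ (fun ij => `|A ij.1 ij.2|) (i, j)). Qed.

Lemma MVT_line (V : normedModType R) (f : V -> R) x v :
  (forall s : R, 0 <= s <= 1 -> differentiable f (x + s *: v)) ->
  exists2 c, 0 <= c <= 1 & f (x + v) - f x = 'D_v f (x + c *: v).
Proof.
move=> df.
have dI (s : R) : s \in `]0, 1[ -> is_derive s 1 (fun s : R => f (x + s *: v)) ('D_v f (x + s *: v)).
  by move=> /itvP st; apply: derive_line; apply: df; rewrite !st.
have cI : {within `[0, 1], continuous (fun s : R => f (x + s *: v))}.
  apply: continuous_in_subspaceT => s /set_mem /= /itvP st.
  have [h _] : is_derive s 1 (fun s : R => f (x + s *: v)) ('D_v f (x + s *: v)).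
    by apply: derive_line; apply: df; rewrite !st.
  by apply: differentiable_continuous; apply/derivable1_diffP.
have [c /itvP ct] := MVT (@ltr01 R) dI cI.
rewrite scale1r scale0r addr0 subr0 mulr1 => E; exists c => //.
by rewrite !ct.
Qed.

(** The norm of a matrix is the largest absolute value of its entries, so the
    scalar mean value theorem can be applied to each of them. *)
Lemma MVT_norm m n (f df : R -> 'M[R]_(m, n)) (a b K : R) : a <= b -> 0 <= K ->
  (forall t, a <= t <= b -> is_derive t 1 f (df t)) ->
  (forall t, a <= t <= b -> `|df t| <= K) ->
  `|f b - f a| <= K * (b - a).
Proof.
move=> ab K0 H HK; apply: mx_norm_le; first by rewrite mulr_ge0// subr_ge0.
move=> i j; rewrite !mxE.
have [->|nab] := eqVneq a b; first by rewrite !subrr mulr0 normr0.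
have {ab nab}ab : a < b by rewrite lt_neqAle nab.
have dij (t : R) : a <= t <= b -> is_derive t 1 (fun t => f t i j : R) (df t i j).
  move=> /H [d <-]; apply: DeriveDef.
    exact: (proj1 (derivable_mxP _ _ _) d).
  by rewrite derive_mx // mxE.
have dI (t : R) : t \in `]a, b[ -> is_derive t 1 (fun t => f t i j : R) (df t i j).
  by move=> /itvP tt; apply: dij; rewrite !tt.
have cI : {within `[a, b], continuous (fun t => f t i j : R)}.
  apply: continuous_in_subspaceT => s /set_mem /= /itvP st.
  have [h _] : is_derive s 1 (fun t => f t i j : R) (df s i j) by apply: dij; rewrite !st.
  by apply: differentiable_continuous; apply/derivable1_diffP.
have [c /itvP ct ->] := MVT ab dI cI.
rewrite normrM (gtr0_norm (_ : 0 < b - a)) ?subr_gt0 //.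
apply: ler_wpM2r; first by rewrite subr_ge0 ltW.
by apply: (le_trans (mx_norm_coord _ _ _)); apply: HK; rewrite !ct.
Qed.

Lemma ball_convex (V : normedModType R) (x0 x y : V) r s : ball x0 r x -> ball x0 r y ->
  0 <= s <= 1 -> ball x0 r (x + s *: (y - x)).
Proof.
rewrite -ball_normE /= => hx hy /andP[s0 s1].
have -> : x0 - (x + s *: (y - x)) = (1 - s) *: (x0 - x) + s *: (x0 - y).
  rewrite scalerBl scale1r -addrA [- _ + _]addrC -scalerBr.
  have -> : x0 - y - (x0 - x) = - (y - x).
    by rewrite opprD opprK addrACA subrr add0r opprB addrC.
  by rewrite scalerN opprD addrA.
apply: (le_lt_trans (ler_normD _ _)); rewrite !normrZ !ger0_norm ?subr_ge0 //.
have [->|s0'] := eqVneq s 0; first by rewrite subr0 mul1r mul0r addr0.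
have {s0'}s0' : 0 < s by rewrite lt_neqAle eq_sym s0'.
have h1 : s * `|x0 - y| < s * r by rewrite ltr_pM2l.
have h2 : (1 - s) * `|x0 - x| <= (1 - s) * r by apply: ler_wpM2l (ltW hx); rewrite subr_ge0.
lra.
Qed.

End MeanValue.

(** * Uniform second-order expansions *)

Section SecondOrder.
Context {R : realType}.

(** The regularity on which [frobenius] relies. It is stable under sums, products
    and composition with the projections of a state to its blocks, so that for the
    moving frame equations it comes down to the Christoffel symbols. *)
Definition quad_approx {V : normedModType R} (D : set V) (f : V -> R) :=
  exists K : R, forall x, D x ->
    [/\ differentiable f x, `|f x| <= K, forall v, `|'D_v f x| <= K * `|v|
      & forall y, D y -> `|f y - f x - 'D_(y - x) f x| <= K * `|y - x| ^+ 2].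

Lemma ball_sub (V : normedModType R) (x0 : V) (r r' : R) :
  r <= r' -> ball x0 r `<=` ball x0 r'.
Proof. by move=> h x; exact: le_ball. Qed.

Lemma le_sum_term (I : finType) (F : I -> R) i : (forall j, 0 <= F j) -> F i <= \sum_j F j.
Proof.
by move=> F0; rewrite (bigD1 i) //= lerDl; apply: sumr_ge0.
Qed.

Lemma common_radius (I : finType) (P : I -> R -> Prop) :
  (forall i r r', 0 < r' -> r' <= r -> P i r -> P i r') ->
  (forall i, exists2 r, 0 < r & P i r) -> exists2 r, 0 < r & forall i, P i r.
Proof.
move=> mono H; have /choice[f Hf] i : exists r, 0 < r /\ P i r.
  by have [r r0 Pr] := H i; exists r.
have r0 : 0 < \big[Num.min/1]_i f i by apply: lt_bigmin => // i _; case: (Hf i).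
exists (\big[Num.min/1]_i f i) => // i; apply: mono (proj2 (Hf i)) => //.
exact: bigmin_le.
Qed.

Lemma continuous_ball_bound n (I : finType) (F : I -> 'rV[R]_n -> R) x0 :
  (forall i, {for x0, continuous (F i)}) -> exists2 K, 0 <= K &
    exists2 r, 0 < r & forall i x, ball x0 r x -> `|F i x| <= K.
Proof.
move=> cF; have [i r r' _ rr' h x|i|r r0 Hr] :=
  @common_radius I (fun i r => forall x, ball x0 r x -> `|F i x| <= `|F i x0| + 1).
- by move=> /(ball_sub rr'); exact: h.
- have /nbhs_ballP[r r0 H] : nbhs x0 [set x | `|F i x| <= `|F i x0| + 1].
    have /cvgrPdist_le /(_ 1 ltr01) := cF i; apply: filterS => x /= h.
    by have := ler_normB (F i x0) (F i x0 - F i x); rewrite subKr; lra.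
  by exists r.
have F0 i : 0 <= `|F i x0| + 1 by rewrite addr_ge0.
exists (\sum_i (`|F i x0| + 1)); first exact: sumr_ge0.
exists r => // i x /Hr /le_trans; apply; exact: (@le_sum_term _ (fun i => `|F i x0| + 1)).
Qed.

Lemma derive_bound n (f : 'rV[R]_n -> R) x K : differentiable f x -> 0 <= K ->
  (forall i, `|pd i f x| <= K) -> forall v, `|'D_v f x| <= (n%:R * K) * `|v|.
Proof.
move=> df K0 H v; rewrite derive_pd //; apply: (le_trans (ler_norm_sum _ _ _)).
have -> : n%:R * K * `|v| = \sum_(i < n) K * `|v|.
  by rewrite sumr_const card_ord -mulrA mulr_natl.
apply: ler_sum => i _; rewrite normrM mulrC; apply: ler_pM => //.
exact: mx_norm_coord.
Qed.

Lemma lipschitz_ball n (f : 'rV[R]_n -> R) x0 r K : 0 <= K ->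
  (forall x, ball x0 r x -> differentiable f x /\ forall i, `|pd i f x| <= K) ->
  forall x y, ball x0 r x -> ball x0 r y -> `|f y - f x| <= (n%:R * K) * `|y - x|.
Proof.
move=> K0 H x y bx by_.
have [s s01|c c01] := @MVT_line R _ f x (y - x).
  by have [] := H _ (ball_convex bx by_ s01).
rewrite [x + (y - x)]addrC subrK => ->.
by have [d h] := H _ (ball_convex bx by_ c01); apply: derive_bound.
Qed.

(** The increment of [f] is a derivative at an intermediate point, and on a
    smaller ball the partial derivatives are Lipschitz because the second ones are
    bounded. *)
Lemma quad_approx_C2 n (U : set 'rV[R]_n) (f : 'rV[R]_n -> R) x0 :
  open U -> U x0 -> Ck 2 U f ->
  exists2 r, 0 < r & ball x0 r `<=` U /\ quad_approx (ball x0 r) f.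
Proof.
move=> oU Ux0 Cf.
have /nbhs_ballP[r0 /= r00 H0] : nbhs x0 U by exact: open_nbhs_nbhs.
have Cf1 := Ck_pred Cf; have Cf0 := Ck_pred Cf1.
have [Kf Kf0 [r1 r10 Bf]] := @continuous_ball_bound n unit (fun=> f) x0 (fun=> Cf0 _ Ux0).
case: Cf1 => df cf1; case: Cf => _ Cf2.
have [K1 K10 [r2 r20 H1]] := continuous_ball_bound (fun i => cf1 i _ Ux0).
have [[i j]|K2 K20 [r3 r30 H2]] :=
  @continuous_ball_bound n ('I_n * 'I_n)%type (fun ij => pd ij.2 (pd ij.1 f)) x0.
  by have [_ h] := Cf2 i; exact: (h j _ Ux0).
pose r := Num.min (Num.min r0 r1) (Num.min r2 r3).
have rr : 0 < r by rewrite !lt_min r00 r10 r20.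
have B0 x : ball x0 r x -> U x.
  by move=> h; apply: H0; apply: ball_sub h; rewrite !ge_min lexx.
have B1 i x : ball x0 r x -> `|pd i f x| <= K1.
  by move=> h; apply: H1; apply: ball_sub h; rewrite !ge_min lexx !orbT.
have B2 i j x : ball x0 r x -> `|pd j (pd i f) x| <= K2.
  by move=> h; apply: (H2 (i, j)); apply: ball_sub h; rewrite !ge_min lexx !orbT.
exists r => //; split => //.
pose K := Kf + n%:R * K1 + n%:R * (n%:R * K2).
have nK1 : 0 <= n%:R * K1 by rewrite mulr_ge0.
have nK2 : 0 <= n%:R * (n%:R * K2) by rewrite !mulr_ge0.
exists K => x bx; have dx := df _ (B0 _ bx); split => //.
- apply: (@le_trans _ _ Kf); last by rewrite /K; lra.
  by apply: (Bf tt); apply: ball_sub bx; rewrite !ge_min lexx !orbT.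
- move=> v; have h i := B1 i _ bx; apply: (le_trans (derive_bound dx K10 h v)).
  by apply: ler_wpM2r => //; rewrite /K; lra.
move=> y by_.
have [s s01|c c01] := @MVT_line R _ f x (y - x).
  exact/df/B0/ball_convex.
have bz := ball_convex bx by_ c01; set z := x + c *: (y - x) in bz *.
rewrite [x + (y - x)]addrC subrK => ->.
have dz := df _ (B0 _ bz).
rewrite !derive_pd // -sumrB; apply: (le_trans (ler_norm_sum _ _ _)).
apply: (@le_trans _ _ (\sum_(i < n) (n%:R * K2) * `|y - x| ^+ 2)); last first.
  rewrite sumr_const card_ord -[_ *+ n]mulr_natl mulrA.
  have d2 : 0 <= `|y - x| ^+ 2 by rewrite exprn_ge0.
  by apply: (ler_wpM2r d2); rewrite /K; lra.
apply: ler_sum => i _; rewrite -scalerBr normrM expr2 mulrA mulrC.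
apply: ler_pM => //; last exact: mx_norm_coord.
have lip : `|pd i f z - pd i f x| <= n%:R * K2 * `|z - x|.
  apply: (lipschitz_ball K20 _ bx bz) => w bw; split; last by move=> j; exact: B2.
  by have [h _] := Cf2 i; apply: h; exact: B0.
apply: (le_trans lip); apply: ler_wpM2l; first by rewrite mulr_ge0.
have -> : z - x = c *: (y - x) by rewrite /z addrAC subrr add0r.
by rewrite normrZ; case/andP: c01 => c0 c1; rewrite ger0_norm // ler_piMl.
Qed.

Section Closure.
Context {V : normedModType R} (D : set V).
Implicit Types f g : V -> R.

Lemma quad_approx_sub (D' : set V) f : D' `<=` D -> quad_approx D f -> quad_approx D' f.
Proof.
move=> DD [K H]; exists K => x /DD /H [h1 h2 h3 h4]; split => // y /DD; exact: h4.
Qed.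

Lemma quad_approx_cst (c : R) : quad_approx D (fun=> c).
Proof.
exists `|c| => x _; split => //.
  by move=> v; rewrite derive_cst normr0 mulr_ge0.
by move=> y _; rewrite derive_cst subr0 subrr normr0 mulr_ge0 ?exprn_ge0.
Qed.

Lemma quad_approxD f g : quad_approx D f -> quad_approx D g ->
  quad_approx D (fun x => f x + g x).
Proof.
move=> [K HK] [L HL]; exists (K + L) => x Dx.
have [df f0 f1 f2] := HK _ Dx; have [dg g0 g1 g2] := HL _ Dx.
have E v : 'D_v (fun x => f x + g x) x = 'D_v f x + 'D_v g x.
  by rewrite deriveD //; exact: diff_derivable.
split; first exact: differentiableD.
- by apply: (le_trans (ler_normD _ _)); exact: lerD.
- move=> v; rewrite E mulrDl; apply: (le_trans (ler_normD _ _)); exact: lerD.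
move=> y Dy; rewrite E mulrDl.
have -> : f y + g y - (f x + g x) - ('D_(y - x) f x + 'D_(y - x) g x) =
  (f y - f x - 'D_(y - x) f x) + (g y - g x - 'D_(y - x) g x) by ring.
by apply: (le_trans (ler_normD _ _)); apply: lerD; auto.
Qed.

(** The remainder of a product has a term cubic in the distance, which the
    boundedness of [D] makes quadratic. *)
Lemma quad_approxM f g : (exists B, forall x, D x -> `|x| <= B) ->
  quad_approx D f -> quad_approx D g -> quad_approx D (fun x => f x * g x).
Proof.
move=> [B HB] [K HK] [L HL].
pose K' := `|K|; pose L' := `|L|.
have K0 : 0 <= K' := normr_ge0 _.
have L0 : 0 <= L' := normr_ge0 _.
have KK : K <= K' := ler_norm _.
have LL : L <= L' := ler_norm _.
exists (2 * (K' * L') + K' * L' + K' * L' * (2 * `|B|)) => x Dx.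
have [df f0 f1 f2] := HK _ Dx; have [dg g0 g1 g2] := HL _ Dx.
have KL0 : 0 <= K' * L' by rewrite mulr_ge0.
have KLB0 : 0 <= K' * L' * (2 * `|B|) by rewrite mulr_ge0 // mulr_ge0.
have E v : 'D_v (fun x => f x * g x) x = f x * 'D_v g x + g x * 'D_v f x.
  by rewrite derive_prod.
have f0' := le_trans f0 KK; have g0' := le_trans g0 LL.
have f1' v : `|'D_v f x| <= K' * `|v|.
  by apply: (le_trans (f1 v)); exact: ler_wpM2r.
have g1' v : `|'D_v g x| <= L' * `|v|.
  by apply: (le_trans (g1 v)); exact: ler_wpM2r.
split; first exact: differentiableM.
- rewrite normrM; apply: (@le_trans _ _ (K' * L')); first exact: ler_pM.
  lra.
- move=> v; rewrite E; apply: (le_trans (ler_normD _ _)).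
  apply: (@le_trans _ _ (2 * (K' * L') * `|v|)); last by apply: ler_wpM2r => //; lra.
  have h1 : `|f x * 'D_v g x| <= K' * (L' * `|v|) by rewrite normrM; exact: ler_pM.
  have h2 : `|g x * 'D_v f x| <= L' * (K' * `|v|) by rewrite normrM; exact: ler_pM.
  by lra.
move=> y Dy; rewrite E; set d := `|y - x|.
have d0 : 0 <= d := normr_ge0 _.
have dB : d <= 2 * `|B|.
  have := ler_normB y x; have := HB _ Dx; have := HB _ Dy; have := ler_norm B.
  by rewrite -/d; lra.
have [_ _ _ g2y] := HL _ Dx.
have fy : `|f y| <= K' by have [_ h _ _] := HK _ Dy; exact: le_trans h KK.
have gy : `|g y| <= L' by have [_ h _ _] := HL _ Dy; exact: le_trans h LL.
set a := f y - f x - 'D_(y - x) f x. set b := g y - g x - 'D_(y - x) g x.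
have ha : `|a| <= K' * d ^+ 2.
  by apply: (le_trans (f2 _ Dy)); apply: ler_wpM2r => //; rewrite exprn_ge0.
have hb : `|b| <= L' * d ^+ 2.
  by apply: (le_trans (g2 _ Dy)); apply: ler_wpM2r => //; rewrite exprn_ge0.
have -> : f y * g y - f x * g x - (f x * 'D_(y - x) g x + g x * 'D_(y - x) f x) =
  a * g y + f x * b + 'D_(y - x) f x * ('D_(y - x) g x + b) by rewrite /a /b; ring.
have hgd : `|'D_(y - x) g x + b| <= L' * d + L' * d ^+ 2.
  by apply: (le_trans (ler_normD _ _)); apply: lerD => //; exact: g1'.
have t1 : `|a * g y| <= (K' * d ^+ 2) * L' by rewrite normrM; exact: ler_pM.
have t2 : `|f x * b| <= K' * (L' * d ^+ 2) by rewrite normrM; exact: ler_pM.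
have t3 : `|'D_(y - x) f x * ('D_(y - x) g x + b)| <= (K' * d) * (L' * d + L' * d ^+ 2).
  by rewrite normrM; apply: ler_pM => //; exact: f1'.
apply: (le_trans (ler_normD _ _)); apply: (le_trans (lerD (ler_normD _ _) (lexx _))).
apply: (le_trans (lerD (lerD t1 t2) t3)).
have t4 : K' * L' * d ^+ 2 * d <= K' * L' * d ^+ 2 * (2 * `|B|).
  by apply: ler_wpM2l dB; rewrite mulr_ge0 // exprn_ge0.
have -> : K' * d ^+ 2 * L' + K' * (L' * d ^+ 2) + K' * d * (L' * d + L' * d ^+ 2) =
  (2 * (K' * L') + K' * L') * d ^+ 2 + K' * L' * d ^+ 2 * d by ring.
by rewrite [leRHS]mulrDl lerD2l [leRHS](_ : _ = K' * L' * d ^+ 2 * (2 * `|B|)) //; ring.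
Qed.

(** Meant for the projection [L] of a state to one of its blocks, which does not
    increase the norm. *)
Lemma quad_approx_comp (W : normedModType R) (D' : set W) (L : {linear V -> W}) (f : W -> R) :
  (forall v, `|L v| <= `|v|) -> continuous L -> (forall x, D x -> D' (L x)) ->
  quad_approx D' f -> quad_approx D (fun x => f (L x)).
Proof.
move=> L1 cL LD [K H]; exists `|K| => x Dx.
have [df f0 f1 f2] := H _ (LD _ Dx); have KK := ler_norm K.
have dL : differentiable L x by exact: linear_differentiable.
have E v : 'D_v (fun x => f (L x)) x = 'D_(L v) f (L x).
  rewrite (derive_comp (f := L)) //; congr ('D_ _ f _).
  by rewrite deriveE // diff_lin.
split.
- exact: (differentiable_comp dL df).
- exact: le_trans f0 KK.
- move=> v; rewrite E; apply: (le_trans (f1 _)).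
  apply: (@le_trans _ _ (`|K| * `|L v|)); first exact: ler_wpM2r.
  exact: ler_wpM2l.
move=> y Dy; rewrite E linearB; apply: (le_trans (f2 _ (LD _ Dy))).
rewrite -linearB; apply: (@le_trans _ _ (`|K| * `|L (y - x)| ^+ 2)).
  by apply: ler_wpM2r => //; rewrite exprn_ge0.
by apply: ler_wpM2l => //; rewrite lerXn2r ?nnegrE.
Qed.

End Closure.

Lemma quad_approx_coord m n (D : set 'M[R]_(m, n)) i j :
  (exists B, forall x, D x -> `|x| <= B) -> quad_approx D (fun x => x i j).
Proof.
move=> [B HB]; exists (`|B| + 1) => x Dx.
have d : differentiable (fun x : 'M[R]_(m, n) => x i j : R) x by exact: differentiable_coord.
have E v : 'D_v (fun x : 'M[R]_(m, n) => x i j : R) x = v i j.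
  by rewrite -(@derive_mx_coord _ _ _ _ id) // derive_id.
have B0 := normr_ge0 B.
split => //.
- apply: (le_trans (mx_norm_coord _ _ _)); apply: (le_trans (HB _ Dx)).
  by have := ler_norm B; lra.
- move=> v; rewrite E; apply: (le_trans (mx_norm_coord _ _ _)).
  by apply: ler_peMl => //; lra.
by move=> y _; rewrite E !mxE subrr normr0 mulr_ge0 ?exprn_ge0 // addr_ge0.
Qed.

End SecondOrder.

(** * Ordinary differential equations *)

Section Picard.
Context {R : realType}.

(** The primitive that vanishes at [0], on the interval [-3 <= t <= 3]: starting
    the integral to the left of that interval keeps all its points interior. *)
Definition primitive (f : R -> R) (t : R) : R :=
  \int[lebesgue_measure]_(s in `[-4, t]) f s -
  \int[lebesgue_measure]_(s in `[-4, 0]) f s.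

Lemma is_derive_primitive (f : R -> R) (t : R) : continuous f -> -3 <= t <= 3 ->
  is_derive t 1 (primitive f) (f t).
Proof.
move=> cf /andP[t1 t2].
have t4 : t < 4 by lra.
have If : lebesgue_measure.-integrable [set` Interval (BLeft (-4)) (BRight 4)] (EFin \o f).
  by apply: continuous_compact_integrable; [exact: segment_compact|exact: continuous_subspaceT].
have [|dF F'] := @continuous_FTC1 R f (BLeft (-4)) t 4 t4 If _ (cf t).
  by rewrite lte_fin; lra.
have d0 : is_derive t 1 (fun t => \int[lebesgue_measure]_(s in `[-4, t]) f s) (f t).
  by apply: DeriveDef; [exact: dF|rewrite -derive1E; exact: F'].
rewrite -[f t]subr0; exact: is_deriveB.
Qed.

Lemma primitive0 f : primitive f 0 = 0.
Proof. exact: subrr. Qed.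

Definition mx_primitive m n (f : R -> 'M[R]_(m, n)) (t : R) : 'M[R]_(m, n) :=
  \matrix_(i, j) primitive (fun s => f s i j) t.

Lemma is_derive_mxP m n (f : R -> 'M[R]_(m, n)) (t : R) (df : 'M[R]_(m, n)) :
  (forall i j, is_derive t 1 (fun s => f s i j : R) (df i j)) -> is_derive t 1 f df.
Proof.
move=> H; have d : derivable f t 1.
  by apply/derivable_mxP => i j; case: (H i j).
apply: DeriveDef => //; rewrite derive_mx //; apply/matrixP => i j; rewrite mxE.
by case: (H i j).
Qed.

Lemma is_derive_mx_primitive m n (f : R -> 'M[R]_(m, n)) (t : R) : continuous f ->
  -3 <= t <= 3 -> is_derive t 1 (mx_primitive f) (f t).
Proof.
move=> cf t3; apply: is_derive_mxP => i j.
have -> : (fun s => mx_primitive f s i j) = primitive (fun s => f s i j).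
  by apply/funext => s; rewrite mxE.
apply: (@is_derive_primitive (fun s => f s i j)) => // s.
apply: (@continuous_comp _ _ _ f (fun M : 'M[R]_(m, n) => M i j)); first exact: cf.
exact: coord_continuous.
Qed.

Lemma mx_primitive0 m n (f : R -> 'M[R]_(m, n)) : mx_primitive f 0 = 0.
Proof. by apply/matrixP => i j; rewrite !mxE primitive0. Qed.

Lemma MVT_norm_sym m n (f df : R -> 'M[R]_(m, n)) (c K s t : R) : 0 <= K ->
  (forall u : R, -c <= u <= c -> is_derive u 1 f (df u)) ->
  (forall u : R, -c <= u <= c -> `|df u| <= K) ->
  -c <= s <= c -> -c <= t <= c -> `|f s - f t| <= K * `|s - t|.
Proof.
move=> K0 H HK /andP[s1 s2] /andP[t1 t2].
have [st|/ltW st] := leP s t.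
  rewrite distrC [`|s - t|]distrC (ger0_norm (_ : 0 <= t - s)) ?subr_ge0 //.
  by apply: (MVT_norm st K0 (df := df)) => u /andP[u1 u2]; [apply: H|apply: HK]; lra.
rewrite (ger0_norm (_ : 0 <= s - t)) ?subr_ge0 //.
by apply: (MVT_norm st K0 (df := df)) => u /andP[u1 u2]; [apply: H|apply: HK]; lra.
Qed.

Lemma lipschitz_continuous (V W : normedModType R) (f : V -> W) K :
  (forall x y, `|f x - f y| <= K * `|x - y|) -> continuous f.
Proof.
move=> H x; apply/cvgrPdist_le => e e0.
have K1 : 0 < `|K| + 1 by rewrite ltr_pwDr.
have : \forall y \near x, `|x - y| <= e / (`|K| + 1).
  by apply: cvgr_dist_le; [exact: cvg_id|rewrite divr_gt0].
apply: filterS => y; rewrite ler_pdivlMr // => h.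
apply: (le_trans (H _ _)); apply: le_trans h; rewrite mulrC; apply: ler_wpM2l => //.
by have := ler_norm K; lra.
Qed.

(** Clamping is 1-Lipschitz, so composing with it extends a Lipschitz map from an
    interval, or from a cube, without changing its constant. *)
Definition clamp (r x : R) : R := Num.max (- r) (Num.min x r).

Lemma clamp_itv (r x : R) : 0 <= r -> - r <= clamp r x <= r.
Proof. by move=> r0; rewrite /clamp le_max lexx /= ge_max ge_min lexx orbT andbT; lra. Qed.

Lemma clamp_id (r x : R) : - r <= x <= r -> clamp r x = x.
Proof. by move=> /andP[h1 h2]; rewrite /clamp (min_l h2) (max_r h1). Qed.

Lemma clamp_lip (r x y : R) : `|clamp r x - clamp r y| <= `|x - y|.
Proof.
rewrite /clamp; wlog xy : x y / x <= y.
  by move=> H; have [/H//|/ltW /H] := leP x y; rewrite distrC [leRHS]distrC.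
rewrite distrC [leRHS]distrC !ger0_norm ?subr_ge0 // /Num.min /Num.max.
  by case: (ltP x r) => hx; case: (ltP y r) => hy;
     do ![case: ifPn; rewrite -?leNgt => ?]; lra.
by case: (ltP x r) => hx; case: (ltP y r) => hy;
   do ![case: ifPn; rewrite -?leNgt => ?]; lra.
Qed.

Lemma geometric_small (K e : R) : 0 <= K -> 0 < e -> exists k, K * 2^-1 ^+ k < e.
Proof.
move=> K0 e0; pose k := Num.bound (K / e); exists k.
have h : K / e < 2 ^+ k.
  apply: (@lt_trans _ _ k%:R); first by apply: archi_boundP; rewrite divr_ge0 // ltW.
  by rewrite -natrX ltr_nat ltn_expl.
by rewrite exprVn ltr_pdivrMr ?exprn_gt0 // mulrC -ltr_pdivrMr.
Qed.

Lemma geometric_le0 (x K : R) : 0 <= K -> (forall k, x <= K * 2^-1 ^+ k) -> x <= 0.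
Proof.
move=> K0 H; apply/ler_addgt0Pr => e e0; rewrite add0r.
by have [k /ltW hk] := geometric_small K0 e0; exact: le_trans (H k) hk.
Qed.

Lemma geometric_limit m n (u : nat -> 'M[R]_(m, n)) (C : R) : 0 <= C ->
  (forall k, `|u k.+1 - u k| <= C * 2^-1 ^+ k) ->
  exists l, forall k, `|u k - l| <= 2 * C * 2^-1 ^+ k.
Proof.
move=> C0 H.
have S k p : `|u k - u (k + p)%N| <= 2 * C * 2^-1 ^+ k - 2 * C * 2^-1 ^+ (k + p).
  elim: p => [|p IH]; first by rewrite addn0 !subrr normr0.
  have -> : u k - u (k + p.+1)%N = (u k - u (k + p)%N) - (u (k + p).+1 - u (k + p)%N).
    by rewrite addnS opprB addrA subrK.
  apply: (le_trans (ler_normB _ _)); apply: (le_trans (lerD IH (H _))).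
  by rewrite addnS exprS; lra.
have cu : cvgn u.
  apply/cauchy_cvgP/cauchy_exP => e e0.
  have C20 : 0 <= 2 * C by rewrite mulr_ge0.
  have [k hk] := geometric_small C20 e0; exists (u k).
  suff : \forall p \near \oo, ball (u k) e (u p) by [].
  near=> p; have /subnKC <- : (k <= p)%N by near: p; exact: nbhs_infty_ge.
  rewrite -ball_normE /=; apply: (le_lt_trans (S _ _)); apply: le_lt_trans hk.
  by rewrite gerBl // mulr_ge0 ?exprn_ge0.
exists (limn u) => k.
have c1 : (fun p => `|u k - u p|) @ \oo --> `|u k - limn u|.
  apply: cvg_norm; apply: cvgB => //; exact: cvg_cst.
rewrite -(cvg_lim _ c1) //; apply: limr_le; first by apply/cvg_ex; eexists; exact: c1.
near=> p; have /subnKC <- : (k <= p)%N by near: p; exact: nbhs_infty_ge.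
apply: (le_trans (S _ _)); rewrite gerBl //.
by rewrite mulr_ge0 ?mulr_ge0 ?exprn_ge0.
Unshelve. all: by end_near. Qed.

(** Successive approximation: on times clamped to [-2 <= t <= 2] the integral
    operator halves distances, as [G] is 1/4-Lipschitz. The bound [C] on [G] makes
    all iterates, and so their limit, [C]-Lipschitz functions on the whole line. *)
Lemma picard m n (G : 'M[R]_(m, n) -> 'M[R]_(m, n)) (C : R) Y0 : 0 <= C ->
  (forall X Y, `|G X - G Y| <= 4^-1 * `|X - Y|) -> (forall X, `|G X| <= C) ->
  exists X : R -> 'M[R]_(m, n), X 0 = Y0 /\
    forall t : R, -2 < t < 2 -> is_derive t 1 X (G (X t)).
Proof.
move=> C0 LG BG.
have cG : continuous G by exact: lipschitz_continuous LG.
pose T (X : R -> 'M[R]_(m, n)) t := Y0 + mx_primitive (G \o X) (clamp 2 t).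
have c2 (t : R) : -2 <= clamp (2:R) t <= 2 by exact: clamp_itv.
have c3 (t : R) : -2 <= t <= 2 -> -3 <= t <= (3:R) by lra.
have c0 : -2 <= (0 : R) <= 2 by apply/andP; split; lra.
have cGX (X : R -> 'M[R]_(m, n)) : continuous X -> continuous (G \o X).
  by move=> cX t; apply: (@continuous_comp _ _ _ X G); [exact: cX|exact: cG].
have lipT (X : R -> 'M[R]_(m, n)) : continuous X -> forall s t, `|T X s - T X t| <= C * `|s - t|.
  move=> cX s t; rewrite /T [Y0 + _]addrC addrKA.
  apply: (@le_trans _ _ (C * `|clamp 2 s - clamp 2 t|)).
    apply: (@MVT_norm_sym _ _ _ (G \o X) 2) => // u u2; last exact: BG.
    by apply: is_derive_mx_primitive; [exact: cGX|exact: c3].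
  by apply: ler_wpM2l => //; exact: clamp_lip.
have cT (X : R -> 'M[R]_(m, n)) : continuous X -> continuous (T X).
  by move=> /lipT h; exact: lipschitz_continuous h.
have ctr (X X' : R -> 'M[R]_(m, n)) (K : R) : continuous X -> continuous X' -> 0 <= K ->
    (forall t, `|X t - X' t| <= K) -> forall t, `|T X t - T X' t| <= K / 2.
  move=> cX cX' K0 H t; rewrite /T [Y0 + _]addrC addrKA.
  pose f s := mx_primitive (G \o X) s - mx_primitive (G \o X') s.
  have f0 : f 0 = 0 by rewrite /f !mx_primitive0 subrr.
  rewrite -/(f (clamp 2 t)) -[f _]subr0 -f0.
  apply: (@le_trans _ _ (4^-1 * K * `|clamp 2 t - 0|)).
    apply: (@MVT_norm_sym _ _ f (fun s => G (X s) - G (X' s)) 2) => //.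
    - by rewrite mulr_ge0.
    - by move=> u u2; apply: is_deriveB; apply: is_derive_mx_primitive; auto.
    - move=> u _; apply: (le_trans (LG _ _)); exact: ler_wpM2l.
  have h : `|clamp 2 t| <= 2 by rewrite ler_norml.
  rewrite subr0; have := ler_wpM2l (_ : 0 <= 4^-1 * K) h; rewrite mulr_ge0 // => /(_ isT); lra.
pose u k := iter k T (fun=> Y0).
have cu k : continuous (u k).
  by elim: k => [|k IH] /=; [move=> ?; exact: cvg_cst|exact: cT].
have du k t : `|u k.+1 t - u k t| <= (2 * C) * 2^-1 ^+ k.
  elim: k t => [|k IH] t.
    rewrite expr0 mulr1 /= /T [Y0 + _]addrC addrK.
    rewrite -[mx_primitive _ _]subr0 -[X in _ - X](mx_primitive0 (G \o (fun=> Y0))).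
    apply: (@le_trans _ _ (C * `|clamp 2 t - 0|)).
      apply: (@MVT_norm_sym _ _ _ (G \o (fun=> Y0)) 2) => //.
      - by move=> v v2; apply: is_derive_mx_primitive; [exact: (cGX _ (cu 0%N))|exact: c3].
      - by move=> v _; exact: BG.
    have h : `|clamp 2 t| <= 2 by rewrite ler_norml.
    by rewrite subr0 mulrC; exact: ler_wpM2r.
  have := ctr _ _ _ (cu k.+1) (cu k) _ IH t.
  rewrite exprS mulrCA [2^-1 * _]mulrC; apply.
  by rewrite mulr_ge0 ?mulr_ge0 ?exprn_ge0.
have /choice[X HX] t : exists l, forall k, `|u k t - l| <= 2 * (2 * C) * 2^-1 ^+ k.
  by apply: geometric_limit; [rewrite mulr_ge0|].
have lipu k s t : `|u k s - u k t| <= C * `|s - t|.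
  by case: k => [|k]; [rewrite subrr normr0 mulr_ge0|exact: lipT (cu k) s t].
have lipX s t : `|X s - X t| <= C * `|s - t|.
  rewrite -subr_le0; apply: (@geometric_le0 _ (8 * C)); first by rewrite mulr_ge0.
  move=> k; have h1 := HX s k; have h2 := HX t k; have h3 := lipu k s t.
  have -> : X s - X t = (u k s - u k t) - (u k s - X s) + (u k t - X t).
    by apply/matrixP => i j; rewrite !mxE; ring.
  have h4 := ler_normD ((u k s - u k t) - (u k s - X s)) (u k t - X t).
  have h5 := ler_normB (u k s - u k t) (u k s - X s).
  lra.
have cX : continuous X by exact: lipschitz_continuous lipX.
have fixX t : X t = T X t.
  apply/eqP; rewrite -subr_eq0 -normr_le0; apply: (@geometric_le0 _ (4 * C)).
    by rewrite mulr_ge0.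
  move=> k; have h1 := HX t k.+1; rewrite exprS in h1.
  have K0 : 0 <= 2 * (2 * C) * 2^-1 ^+ k by rewrite mulr_ge0 ?mulr_ge0 ?exprn_ge0.
  have h2 : `|u k.+1 t - T X t| <= _ := ctr _ _ _ (cu k) cX K0 (fun t => HX t k) t.
  have -> : X t - T X t = (u k.+1 t - T X t) - (u k.+1 t - X t).
    by apply/matrixP => i j; rewrite !mxE; ring.
  have h3 := ler_normB (u k.+1 t - T X t) (u k.+1 t - X t); lra.
exists X; split; first by rewrite fixX /T clamp_id ?mx_primitive0 ?addr0.
move=> t /andP[t1 t2].
have H : is_derive t 1 (fun s => Y0 + mx_primitive (G \o X) s) (G (X t)).
  rewrite -[G (X t)]add0r; apply: is_deriveD; apply: is_derive_mx_primitive; first exact: cGX.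
  by lra.
apply: near_eq_is_derive H.
near=> s; rewrite fixX /T clamp_id //; apply/andP; split.
  by apply: ltW; near: s; exact: lt_nbhsr.
by apply: ltW; near: s; exact: lt_nbhsl.
Unshelve. all: by end_near. Qed.

End Picard.

(** * Total differential systems *)

Section LinearCombination.
Context {R : realType} {p : nat} {W : normedModType R}.

(** The form that the differential takes for a map with partial derivatives
    [B i]. *)
Definition lincomb (B : 'I_p -> W) (w : 'rV[R]_p) : W := \sum_i w 0 i *: B i.

Lemma lincomb_is_linear B : linear (lincomb B).
Proof.
move=> a u v; rewrite /lincomb scaler_sumr -big_split /=; apply: eq_bigr => i _.
by rewrite !mxE scalerDl scalerA.
Qed.

HB.instance Definition _ B := GRing.isLinear.Build R 'rV[R]_p W *:%R (lincomb B) (lincomb_is_linear B).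

Lemma lincomb_bound B K w : 0 <= K -> (forall i, `|B i| <= K) ->
  `|lincomb B w| <= p%:R * K * `|w|.
Proof.
move=> K0 H; apply: (le_trans (ler_norm_sum _ _ _)).
have -> : p%:R * K * `|w| = \sum_(i < p) K * `|w|.
  by rewrite sumr_const card_ord -mulrA mulr_natl.
apply: ler_sum => i _; rewrite normrZ mulrC; apply: ler_pM => //.
exact: mx_norm_coord.
Qed.

Lemma lincomb_continuous B : continuous (lincomb B).
Proof.
pose K := \sum_i `|B i|.
have K0 : 0 <= K by apply: sumr_ge0.
apply: (@lipschitz_continuous _ _ _ _ (p%:R * K)) => x y; rewrite -linearB.
by apply: lincomb_bound => // i; apply: (@le_sum_term _ _ (fun i => `|B i|)).
Qed.

Lemma lincomb_delta B i : lincomb B (delta_mx 0 i) = B i.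
Proof.
rewrite /lincomb (bigD1 i) //= mxE !eqxx scale1r big1 ?addr0 // => j ji.
by rewrite mxE eqxx (negbTE ji) scale0r.
Qed.

End LinearCombination.

Section Frobenius.
Context {R : realType} {p m n : nat}.
Local Notation V := 'M[R]_(m, n).
Variables (Y0 : V) (r : R) (A : 'I_p -> V -> V) (S : set V).
Hypothesis r0 : 0 < r.
Let D := ball Y0 r.

(** Retraction onto a cube around [Y0]: composed with it, a map that is Lipschitz
    on [D] becomes globally Lipschitz, as [picard] asks. *)
Definition retract (Y : V) : V :=
  \matrix_(i, j) (Y0 i j + clamp (r / 2) (Y i j - Y0 i j)).

Lemma retract_in Y : D (retract Y).
Proof.
rewrite /D -ball_normE /=; have rr : r / 2 < r by move: r0; lra.
have r2 : 0 <= r / 2 by move: r0; lra.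
apply: le_lt_trans rr.
apply: mx_norm_le => // i j; rewrite !mxE opprD addrA subrr sub0r normrN.
by rewrite ler_norml clamp_itv.
Qed.

Lemma retract_lip X Y : `|retract X - retract Y| <= `|X - Y|.
Proof.
apply: mx_norm_le => // i j; rewrite !mxE addrAC opprD addrA subrr add0r addrC.
apply: (le_trans (clamp_lip _ _ _)).
have -> : X i j - Y0 i j - (Y i j - Y0 i j) = (X - Y) i j by rewrite !mxE; ring.
exact: mx_norm_coord.
Qed.

Lemma retract_id Y : `|Y - Y0| <= r / 2 -> retract Y = Y.
Proof.
move=> h; apply/matrixP => i j; rewrite mxE clamp_id; first by rewrite addrC subrK.
have := le_trans (mx_norm_coord (Y - Y0) i j) h.
by rewrite !mxE ler_norml.
Qed.

(** The equation satisfied by [t |-> Y (t *: q)] when [pd i Y = A i Y]. *)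
Definition ray_field (q : 'rV[R]_p) (Y : V) : V := lincomb (A ^~ Y) q.
Definition ray_dfield (q : 'rV[R]_p) (Y v : V) : V := lincomb (fun i => 'D_v (A i) Y) q.

Hypothesis qA : forall i a b, quad_approx D (fun Y => A i Y a b).

Lemma field_bounds : exists2 K : R, 0 <= K & forall i X, D X ->
  [/\ differentiable (A i) X, `|A i X| <= K, forall v, `|'D_v (A i) X| <= K * `|v|
    & forall Y, D Y -> `|A i Y - A i X - 'D_(Y - X) (A i) X| <= K * `|Y - X| ^+ 2].
Proof.
have /choice[Kf HK] (x : 'I_p * 'I_m * 'I_n) : exists K : R, forall X, D X ->
    [/\ differentiable (fun Y => A x.1.1 Y x.1.2 x.2 : R) X, `|A x.1.1 X x.1.2 x.2| <= K,
     forall v, `|'D_v (fun Y => A x.1.1 Y x.1.2 x.2 : R) X| <= K * `|v|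
    & forall Y, D Y -> `|A x.1.1 Y x.1.2 x.2 - A x.1.1 X x.1.2 x.2
        - 'D_(Y - X) (fun Y => A x.1.1 Y x.1.2 x.2 : R) X| <= K * `|Y - X| ^+ 2].
  exact: qA.
pose K := \sum_x `|Kf x|.
have K0 : 0 <= K by apply: sumr_ge0.
have KK x : Kf x <= K.
  apply: (le_trans (ler_norm _)); rewrite /K (bigD1 x) //= lerDl; exact: sumr_ge0.
exists K => // i X DX.
have dA : differentiable (A i) X.
  by apply/differentiable_mxP => a b; case: (HK (i, a, b) X DX).
split=> //.
- apply: mx_norm_le => // a b; case: (HK (i, a, b) X DX) => _ h _ _.
  exact: le_trans h (KK _).
- move=> v; apply: mx_norm_le => [|a b]; first by rewrite mulr_ge0.
  rewrite derive_mx_coord //; case: (HK (i, a, b) X DX) => _ _ h _.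
  by apply: (le_trans (h v)); apply: ler_wpM2r.
move=> Y DY; apply: mx_norm_le => [|a b]; first by rewrite mulr_ge0 ?exprn_ge0.
rewrite !mxE derive_mx_coord //; case: (HK (i, a, b) X DX) => _ _ _ h.
by apply: (le_trans (h Y DY)); apply: ler_wpM2r; rewrite ?exprn_ge0.
Qed.

(* Commutation is required on [S] only, which the next hypothesis says that
   solutions along rays do not leave. *)
Hypothesis commA : forall i j X, D X -> S X ->
  'D_(A i X) (A j) X = 'D_(A j X) (A i) X.

Hypothesis inv : forall (q : 'rV[R]_p) (X : R -> V), X 0 = Y0 ->
  (forall t : R, 0 <= t <= 1 -> D (X t) /\ is_derive t 1 X (ray_field q (X t))) ->
  forall t : R, 0 <= t <= 1 -> S (X t).

Lemma fieldDl q q' Y : ray_field (q + q') Y = ray_field q Y + ray_field q' Y.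
Proof. exact: linearD. Qed.

Lemma dfieldDl q q' Y v : ray_dfield (q + q') Y v = ray_dfield q Y v + ray_dfield q' Y v.
Proof. exact: linearD. Qed.

Lemma dfieldZ q X (a : R) v : (forall i, differentiable (A i) X) ->
  ray_dfield q X (a *: v) = a *: ray_dfield q X v.
Proof.
move=> d; rewrite /ray_dfield /lincomb scaler_sumr; apply: eq_bigr => i _.
by rewrite derive_scalev // !scalerA mulrC.
Qed.

Lemma dfield_comm q w X : D X -> S X -> (forall i, differentiable (A i) X) ->
  ray_dfield w X (ray_field q X) = ray_dfield q X (ray_field w X).
Proof.
move=> DX SX d; have E (a b : 'rV[R]_p) : ray_dfield b X (ray_field a X) =
    \sum_i \sum_j (b 0 i * a 0 j) *: 'D_(A j X) (A i) X.
  apply: eq_bigr => i _; rewrite deriveE // /ray_field /lincomb linear_sum scaler_sumr.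
  by apply: eq_bigr => j _; rewrite linearZ scalerA deriveE.
rewrite !E exchange_big; apply: eq_bigr => i _; apply: eq_bigr => j _.
by rewrite mulrC commA.
Qed.

Lemma is_derive_curve (f : V -> V) (X : R -> V) (t : R) dX : is_derive t 1 X dX ->
  differentiable f (X t) -> is_derive t 1 (f \o X) ('D_dX f (X t)).
Proof.
move=> [d dE] df; have dX' : differentiable X t by apply/derivable1_diffP.
apply: DeriveDef; first by apply: diff_derivable; exact: differentiable_comp.
by rewrite (@derive_comp _ _ _ _ X f _ _ dX' df) dE.
Qed.

Lemma is_derive_field w (X : R -> V) (t : R) dX : is_derive t 1 X dX ->
  (forall i, differentiable (A i) (X t)) ->
  is_derive t 1 (fun s => ray_field w (X s)) (ray_dfield w (X t) dX).
Proof.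
move=> H d; rewrite /ray_field /lincomb.
have -> : (fun s => \sum_i w 0 i *: A i (X s)) = \sum_i (w 0 i \*: (A i \o X)).
  by apply/funext => s; rewrite fct_sumE.
by apply: is_derive_sum => i; apply: is_deriveZ; exact: is_derive_curve.
Qed.

Lemma is_derive_id_scale (g : R -> V) (t : R) dg : is_derive t 1 g dg ->
  is_derive t 1 (fun s => s *: g s) (g t + t *: dg).
Proof.
move=> [d dE]; apply: is_derive_mxP => i j.
have -> : (fun s => (s *: g s) i j) = id * (fun s => g s i j).
  by apply/funext => s; rewrite !mxE.
have gij : is_derive t 1 (fun s => g s i j : R) (dg i j).
  apply: DeriveDef; first exact: (proj1 (derivable_mxP _ _ _) d).
  by rewrite -dE derive_mx // mxE.
have := is_deriveM (is_derive_id t 1) gij; rewrite /GRing.scale /= mulr1 => H.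
by rewrite !mxE addrC.
Qed.

(** In [frobenius] the three terms are a Lipschitz term, a Taylor remainder and a
    term quadratic in the displacement of the ray. *)
Lemma defect_split (a b c d e f : V) (t : R) :
  a - (c + (d + t *: e)) = (a - b) + (b - (c + d) - t *: (e + f)) + t *: f.
Proof. by apply/matrixP => i j; rewrite !mxE; ring. Qed.

(** Local Frobenius theorem for the total differential system
    [pd i Y = A i Y]: solve it along every ray; the commutation relation says
    that moving the end point [q] of the ray by [w] displaces the solution at
    time [t] by [t *: ray_field w], up to an error quadratic in [w]. *)
Theorem frobenius : exists2 rho : R, 0 < rho & exists Y : 'rV[R]_p -> V,
  Y 0 = Y0 /\ forall q, `|q| < rho ->
    [/\ D (Y q), S (Y q), differentiable Y q & forall i, pd i Y q = A i (Y q)].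
Proof.
have rr := r0.
have [K K0 HK] := field_bounds.
pose B := p%:R * K * (1 + 2 * r) + 1.
have pK : 0 <= p%:R * K by rewrite mulr_ge0.
have pKr : 0 <= p%:R * K * r by rewrite mulr_ge0 // ltW.
have BpK : p%:R * K <= B by rewrite /B; lra.
have B0 : 0 < B by rewrite /B; lra.
have dA i X : D X -> differentiable (A i) X by move=> DX; case: (HK i X DX).
have fB q X : D X -> `|ray_field q X| <= B * `|q|.
  move=> DX; apply: (le_trans (@lincomb_bound _ _ _ _ K _ K0 _)).
    by move=> i; case: (HK i X DX).
  exact: ler_wpM2r.
have dfB q X v : D X -> `|ray_dfield q X v| <= B * `|q| * `|v|.
  move=> DX; apply: (le_trans (@lincomb_bound _ _ _ _ (K * `|v|) _ _ _)).
  - by rewrite mulr_ge0.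
  - by move=> i; case: (HK i X DX).
  rewrite mulrA mulrAC; apply: ler_wpM2r => //; exact: ler_wpM2r.
have frem q X Y : D X -> D Y ->
    `|ray_field q Y - ray_field q X - ray_dfield q X (Y - X)| <= p%:R * K * `|q| * `|Y - X| ^+ 2.
  move=> DX DY; rewrite /ray_field /ray_dfield /lincomb -!sumrB.
  have -> : \sum_i (q 0 i *: A i Y - q 0 i *: A i X - q 0 i *: 'D_(Y - X) (A i) X) =
      lincomb (fun i => A i Y - A i X - 'D_(Y - X) (A i) X) q.
    by apply: eq_bigr => i _; rewrite !scalerBr.
  apply: (le_trans (@lincomb_bound _ _ _ _ (K * `|Y - X| ^+ 2) _ _ _)).
  - by rewrite mulr_ge0 // exprn_ge0.
  - by move=> i; case: (HK i X DX) => _ _ _; apply.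
  by rewrite mulrA mulrAC.
have flip q X Y : D X -> D Y -> `|ray_field q Y - ray_field q X| <= B * `|q| * `|Y - X|.
  move=> DX DY; have h1 := frem q X Y DX DY.
  have h2 : `|ray_dfield q X (Y - X)| <= p%:R * K * `|q| * `|Y - X|.
    apply: (le_trans (@lincomb_bound _ _ _ _ (K * `|Y - X|) _ _ _)).
    - by rewrite mulr_ge0.
    - by move=> i; case: (HK i X DX).
    by rewrite mulrA mulrAC.
  have XY : `|Y - X| <= 2 * r.
    move: DX DY; rewrite /D -ball_normE /= => hX hY.
    have -> : Y - X = (Y0 - X) - (Y0 - Y) by apply/matrixP => i j; rewrite !mxE; ring.
    by have := ler_normB (Y0 - X) (Y0 - Y); lra.
  have h3 := ler_normD (ray_field q Y - ray_field q X - ray_dfield q X (Y - X)) (ray_dfield q X (Y - X)).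
  rewrite subrK in h3; apply: (le_trans h3); apply: (le_trans (lerD h1 h2)).
  have c0 : 0 <= p%:R * K * `|q| * `|Y - X| by rewrite !mulr_ge0.
  have := ler_wpM2l c0 XY.
  have c1 : 0 <= `|q| * `|Y - X| by rewrite mulr_ge0.
  rewrite /B; lra.
(* For [`|q| < rho] the field along the ray is 1/8-Lipschitz and moves [Y0] by at
   most [r / 8] up to time 1. *)
pose rho := Num.min 1 r / (8 * B).
have m0 : 0 < Num.min 1 r by rewrite lt_min ltr01.
have rho0 : 0 < rho by rewrite divr_gt0 // mulr_gt0.
have rhoB (q : 'rV[R]_p) : `|q| < rho -> B * `|q| <= 8^-1 /\ B * `|q| <= r / 8.
  rewrite /rho ltr_pdivlMr ?mulr_gt0 // => h.
  have : `|q| * (8 * B) < 1 by apply: (lt_le_trans h); rewrite ge_min lexx.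
  have : `|q| * (8 * B) < r by apply: (lt_le_trans h); rewrite ge_min lexx orbT.
  by split; lra.
have curve (q : 'rV[R]_p) : exists X : R -> V, `|q| < rho -> X 0 = Y0 /\
    forall t : R, 0 <= t <= 1 -> `|X t - Y0| <= r / 8 /\ is_derive t 1 X (ray_field q (X t)).
  have [qr|qr] := boolP (`|q| < rho); last by exists (fun=> Y0).
  have [q1 q2] := rhoB _ qr.
  have Bq0 : 0 <= B * `|q| by rewrite mulr_ge0 // ltW.
  have [||X [X0 dX]] := @picard R m n (fun Y => ray_field q (retract Y)) (B * `|q|) Y0 Bq0.
  - move=> X Y; have h := flip q _ _ (retract_in Y) (retract_in X).
    apply: (le_trans h).
    apply: (@le_trans _ _ (B * `|q| * `|X - Y|)).
      apply: ler_wpM2l => //; exact: retract_lip.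
    by apply: ler_wpM2r => //; lra.
  - by move=> X; apply: fB; exact: retract_in.
  exists X => _; split=> // t /andP[t0 t1].
  have XY : `|X t - Y0| <= r / 8.
    rewrite -X0; apply: (@le_trans _ _ (B * `|q| * (t - 0))).
      apply: (MVT_norm t0 Bq0 (df := fun t => ray_field q (retract (X t)))).
        by move=> s /andP[s0 s1]; apply: dX; lra.
      by move=> s _; apply: fB; exact: retract_in.
    by have := ler_wpM2l Bq0 t1; lra.
  split=> //; have := dX t; rewrite retract_id; last by lra.
  by apply; lra.
have /choice[X HX] := curve.
pose Y q := X q 1.
have inD Z : `|Z - Y0| < r -> D Z by rewrite /D -ball_normE /= distrC.
have XD q t : `|q| < rho -> 0 <= t <= 1 -> D (X q t).
  by move=> /HX[_ h] /h[XY _]; apply: inD; apply: le_lt_trans XY _; lra.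
have XS q t : `|q| < rho -> 0 <= t <= 1 -> S (X q t).
  move=> qr; have [X0 h] := HX q qr; apply: (inv (q := q) X0) => s s01.
  by split; [exact: XD|have [] := h s s01].
have I1 : 0 <= (1 : R) <= 1 by rewrite ler01 lexx.
pose C := 2 * (2 * B ^+ 2 + B ^+ 3).
have key q q' : `|q| < rho -> `|q'| < rho ->
    `|Y q' - Y q - ray_field (q' - q) (Y q)| <= C * `|q' - q| ^+ 2.
  move=> qr qr'; set w := q' - q.
  have [X0 dX] := HX q qr; have [X0' dX'] := HX q' qr'.
  have [q1 q2] := rhoB _ qr; have [q1' q2'] := rhoB _ qr'.
  have Bw : B * `|w| <= r / 4.
    by have := ler_wpM2l (ltW B0) (ler_normB q' q); rewrite -/w; lra.
  (* [Z] is the solution along the ray through [q'] to first order in [w]; [dl] is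
     the derivative of the error. *)
  pose Z t := X q t + t *: ray_field w (X q t).
  have ZX t : Z t - X q t = t *: ray_field w (X q t) by rewrite /Z addrAC subrr add0r.
  have ZXn t : 0 <= t <= 1 -> `|Z t - X q t| <= B * `|w|.
    move=> t01; rewrite ZX normrZ; case/andP: (t01) => t0 t1; rewrite ger0_norm //.
    apply: (@le_trans _ _ (1 * `|ray_field w (X q t)|)); first exact: ler_wpM2r.
    by rewrite mul1r; apply: fB; exact: XD.
  have ZD t : 0 <= t <= 1 -> D (Z t).
    move=> t01; apply: inD; have [XY _] := dX t t01.
    have -> : Z t - Y0 = (Z t - X q t) + (X q t - Y0) by rewrite addrA subrK.
    by have := ler_normD (Z t - X q t) (X q t - Y0); have := ZXn t t01; lra.
  pose dl t := ray_field q' (X q' t) - (ray_field q (X q t) +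
     (ray_field w (X q t) + t *: ray_dfield w (X q t) (ray_field q (X q t)))).
  have ddl (t : R) : 0 <= t <= 1 -> is_derive t 1 (fun t => X q' t - Z t) (dl t).
    move=> t01; have [_ h] := dX t t01; have [_ h'] := dX' t t01.
    apply: is_deriveB; apply: is_deriveD; apply: is_derive_id_scale.
    by apply: is_derive_field => // i; apply: dA; exact: XD.
  have bdl (t : R) : 0 <= t <= 1 ->
      `|dl t| <= 2^-1 * `|X q' t - Z t| + C / 2 * `|w| ^+ 2.
    move=> t01; have DX := XD q t qr t01; have DX' := XD q' t qr' t01; have DZ := ZD t t01.
    have q'E : q' = q + w by rewrite /w addrC subrK.
    pose a := ray_field q' (X q' t) - ray_field q' (Z t).
    pose b := ray_field q' (Z t) - ray_field q' (X q t) - ray_dfield q' (X q t) (Z t - X q t).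
    pose c := t *: ray_dfield w (X q t) (ray_field w (X q t)).
    have -> : dl t = a + b + c.
      have dX1 i : differentiable (A i) (X q t) by exact: dA.
      have e1 : ray_field q' (X q t) = ray_field q (X q t) + ray_field w (X q t).
        by rewrite -fieldDl -q'E.
      have e2 v : ray_dfield q' (X q t) v = ray_dfield q (X q t) v + ray_dfield w (X q t) v.
        by rewrite -dfieldDl -q'E.
      have e3 := dfield_comm q w DX (XS q t qr t01) dX1.
      rewrite /a /b /c /dl ZX e1 (dfieldZ _ _ _ dX1) e2 -e3.
      exact: defect_split.
    have ha : `|a| <= 2^-1 * `|X q' t - Z t|.
      by apply: (le_trans (flip _ _ _ DZ DX')); apply: ler_wpM2r => //; lra.
    have ZXn2 : `|Z t - X q t| ^+ 2 <= (B * `|w|) ^+ 2.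
      by rewrite lerXn2r ?nnegrE ?mulr_ge0 ?ZXn // ltW.
    have hb : `|b| <= B ^+ 2 * `|w| ^+ 2.
      apply: (le_trans (frem _ _ _ DX DZ)); apply: (@le_trans _ _ (1 * (B * `|w|) ^+ 2)).
        apply: ler_pM => //; rewrite ?mulr_ge0 ?exprn_ge0 //.
        by have := ler_wpM2r (normr_ge0 q') BpK; lra.
      by rewrite mul1r exprMn.
    have hc : `|c| <= B ^+ 2 * `|w| ^+ 2.
      rewrite /c normrZ; case/andP: (t01) => t0 t1; rewrite ger0_norm //.
      apply: (@le_trans _ _ (1 * (B * `|w| * (B * `|w|)))); last by rewrite mul1r; lra.
      apply: ler_pM => //; apply: (le_trans (dfB _ _ _ DX)).
      by apply: ler_wpM2l; [rewrite mulr_ge0 // ltW|exact: fB].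
    have hw : 0 <= B ^+ 3 * `|w| ^+ 2 by rewrite mulr_ge0 ?exprn_ge0 // ltW.
    have := ler_normD (a + b) c; have := ler_normD a b.
    by rewrite /C; lra.
  pose g t := `|X q' t - Z t|.
  have cg : {within `[0, 1], continuous g}.
    apply: continuous_in_subspaceT => s /set_mem /=; rewrite in_itv /= => s01.
    have [h _] := ddl s s01.
    have cs : {for s, continuous (fun t => X q' t - Z t)}.
      by apply: differentiable_continuous; apply/derivable1_diffP.
    exact: (continuous_comp cs (@norm_continuous _ _ _)).
  have [c] := EVT_max (@ler01 R) cg; rewrite in_itv /= => c01 Hc.
  have gmax t : 0 <= t <= 1 -> g t <= g c by move=> h; apply: Hc; rewrite in_itv.
  have g0 : X q' 0 - Z 0 = 0 by rewrite /Z scale0r addr0 X0 X0' subrr.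
  (* Bounding the largest error by half of itself, plus a term of order [w ^ 2],
     stands in for the Gronwall inequality. *)
  have gc : g c <= 2^-1 * g c + C / 2 * `|w| ^+ 2.
    have M0 : 0 <= 2^-1 * g c + C / 2 * `|w| ^+ 2.
      by apply: addr_ge0; rewrite ?mulr_ge0 ?invr_ge0 ?normr_ge0 ?addr_ge0 ?mulr_ge0 ?exprn_ge0 // ltW.
    case/andP: (c01) => cc0 cc1.
    rewrite {1}/g -[X q' c - Z c]subr0 -g0.
    apply: (@le_trans _ _ ((2^-1 * g c + C / 2 * `|w| ^+ 2) * (c - 0))).
      apply: (MVT_norm cc0 M0 (f := fun t => X q' t - Z t) (df := dl)) => t /andP[t0 tc].
        by apply: ddl; rewrite t0 (le_trans tc).
      have t01 : 0 <= t <= 1 by rewrite t0 (le_trans tc).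
      apply: (le_trans (bdl t t01)); rewrite lerD2r; apply: ler_wpM2l; first by rewrite invr_ge0.
      exact: gmax.
    by rewrite subr0 ler_piMr.
  have -> : Y q' - Y q - ray_field w (Y q) = X q' 1 - Z 1.
    by rewrite /Y /Z scale1r opprD addrA.
  by have := gmax 1 I1; rewrite /g; move: gc; rewrite /g; lra.
have z0 : `|(0 : 'rV[R]_p)| < rho by rewrite normr0.
exists rho => //; exists Y; split.
  have [X0 dX] := HX 0 z0; rewrite /Y; apply/eqP; rewrite -subr_eq0 -normr_le0.
  rewrite -X0; apply: (@le_trans _ _ (0 * (1 - 0))); last by rewrite mul0r.
  apply: (MVT_norm ler01 (lexx 0) (df := fun t => ray_field 0 (X 0 t))).
    by move=> t /dX [].
  by move=> t _; rewrite /ray_field linear0 normr0.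
move=> q qr; have DY : D (Y q) by exact: XD.
suff [dY YE] : differentiable Y q /\ ('d Y q : 'rV[R]_p -> V) = lincomb (A ^~ (Y q)).
  split=> //; first exact: XS.
  by move=> i; rewrite /pd deriveE // YE lincomb_delta.
apply: differentiable_epsP; first exact: lincomb_continuous.
move=> e e0.
have C0 : 0 < C by rewrite /C mulr_gt0 // addr_gt0 // ?mulr_gt0 // exprn_gt0.
have near1 : \forall q' \near q, `|q'| < rho.
  have : 0 < rho - `|q| by rewrite subr_gt0.
  move=> /(@cvgr_dist_lt _ _ _ (nbhs q) _ id q cvg_id); apply: filterS => q' h.
  by have := ler_normB q (q - q'); rewrite subKr; lra.
have near2 : \forall q' \near q, `|q - q'| < e / C.
  by apply: (@cvgr_dist_lt _ _ _ (nbhs q) _ id q cvg_id); rewrite divr_gt0.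
move: near1 near2; apply: filterS2 => q' h1 h2.
apply: (le_trans (key q q' qr h1)); rewrite expr2 mulrA; apply: ler_wpM2r => //.
by rewrite mulrC -ler_pdivlMr // distrC ltW.
Qed.

End Frobenius.

(** * Inner products *)

#[local] Opaque derive.

(* Scalar identities are closed by [ring] or [lra] only once the inner products
   in them have been turned into variables: comparing two of them by conversion
   is costly. *)
Ltac gen_ip := repeat match goal with
  | |- context [ip ?A ?v ?w] => generalize (ip A v w); intro
  end.

Section InnerProduct.
Context {R : realType} {n : nat}.
Implicit Types (A : 'M[R]_n) (u v w : 'rV[R]_n).

Lemma ip_mulmx A v w : ip A v w = (v *m A *m w^T) 0 0.
Proof. by []. Qed.

Lemma ipE A v w : ip A v w = \sum_a \sum_b v 0 a * A a b * w 0 b.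
Proof.
rewrite /ip mxE exchange_big; apply: eq_bigr => b _; rewrite !mxE mulr_suml.
by apply: eq_bigr.
Qed.

Lemma mul_ip m (E F : 'M[R]_(m, n)) A a b :
  (E *m A *m F^T) a b = ip A (row a E) (row b F).
Proof.
rewrite ip_mulmx tr_row -row_mul [LHS]mxE [RHS]mxE; apply: eq_bigr => k _.
by rewrite [row _ _ _ _]mxE [col _ _ _ _]mxE.
Qed.

Lemma ipDl A u v w : ip A (u + v) w = ip A u w + ip A v w.
Proof. by rewrite /ip !mulmxDl mxE. Qed.

Lemma ipZl A (c : R) v w : ip A (c *: v) w = c * ip A v w.
Proof. by rewrite /ip -!scalemxAl mxE. Qed.

Lemma ipDr A u v w : ip A u (v + w) = ip A u v + ip A u w.
Proof. by rewrite /ip linearD /= mulmxDr mxE. Qed.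

Lemma ipZr A (c : R) v w : ip A v (c *: w) = c * ip A v w.
Proof. by rewrite /ip linearZ /= -scalemxAr mxE. Qed.

Lemma ipNl A v w : ip A (- v) w = - ip A v w.
Proof. by rewrite -scaleN1r ipZl mulN1r. Qed.

Lemma ipNr A v w : ip A v (- w) = - ip A v w.
Proof. by rewrite -scaleN1r ipZr mulN1r. Qed.

Lemma ipDBl A u v w (z : 'rV[R]_n) : ip A (u + v - w) z = ip A u z + ip A v z - ip A w z.
Proof. by rewrite !ipDl ipNl. Qed.

Lemma ip0l A w : ip A 0 w = 0.
Proof. by rewrite -(scale0r 0) ipZl mul0r. Qed.

Lemma ip0r A w : ip A w 0 = 0.
Proof. by rewrite -(scale0r 0) ipZr mul0r. Qed.

Lemma ipC A v w : A^T = A -> ip A v w = ip A w v.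
Proof.
move=> sA; rewrite /ip.
have -> : v *m A *m w^T = (w *m A *m v^T)^T by rewrite !trmx_mul trmxK sA mulmxA.
by rewrite mxE.
Qed.

Lemma derive_ip (V : normedModType R) (A : V -> 'M[R]_n) (a b : V -> 'rV[R]_n) x z :
  differentiable A x -> differentiable a x -> differentiable b x ->
  'D_z (fun y => ip (A y) (a y) (b y)) x =
  ip ('D_z A x) (a x) (b x) + ip (A x) ('D_z a x) (b x) + ip (A x) (a x) ('D_z b x).
Proof.
move=> dA da db.
have cA i j : differentiable (fun y => A y i j : R) x by have /differentiable_mxP := dA.
have ca i : differentiable (fun y => a y 0 i : R) x by have /differentiable_mxP := da.
have cb i : differentiable (fun y => b y 0 i : R) x by have /differentiable_mxP := db.
have -> : (fun y => ip (A y) (a y) (b y)) =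
    fun y => \sum_i \sum_j a y 0 i * A y i j * b y 0 j.
  by apply/funext => y; rewrite ipE.
have dd i j : differentiable (fun y => a y 0 i * A y i j * b y 0 j) x.
  by apply: differentiableM => //; exact: differentiableM.
rewrite derive_bigsum => [|i]; last exact: differentiable_bigsum.
rewrite !ipE -!big_split; apply: eq_bigr => i _ /=; rewrite derive_bigsum //.
rewrite -!big_split; apply: eq_bigr => j _ /=.
rewrite derive_prod //; last exact: differentiableM.
rewrite derive_prod // !derive_mx_coord //; ring.
Qed.

Lemma differentiable_ip (V : normedModType R) (A : V -> 'M[R]_n) (a b : V -> 'rV[R]_n) x :
  differentiable A x -> differentiable a x -> differentiable b x ->
  differentiable (fun y => ip (A y) (a y) (b y)) x.
Proof.
move=> dA da db.
have cA i j : differentiable (fun y => A y i j : R) x by have /differentiable_mxP := dA.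
have ca i : differentiable (fun y => a y 0 i : R) x by have /differentiable_mxP := da.
have cb i : differentiable (fun y => b y 0 i : R) x by have /differentiable_mxP := db.
have -> : (fun y => ip (A y) (a y) (b y)) =
    fun y => \sum_i \sum_j a y 0 i * A y i j * b y 0 j.
  by apply/funext => y; rewrite ipE.
apply: differentiable_bigsum => i; apply: differentiable_bigsum => j.
by apply: differentiableM => //; exact: differentiableM.
Qed.

Lemma Ck_ip m k (U : set 'rV[R]_m) (A : 'rV[R]_m -> 'M[R]_n) (a b : 'rV[R]_m -> 'rV[R]_n) :
  open U -> (forall i j, Ck k U (fun y => A y i j : R)) -> Ck k U a -> Ck k U b ->
  Ck k U (fun y => ip (A y) (a y) (b y)).
Proof.
move=> oU cA /(Ck_mxP _ _ oU) ca /(Ck_mxP _ _ oU) cb.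
have -> : (fun y => ip (A y) (a y) (b y)) =
    fun y => \sum_i \sum_j a y 0 i * A y i j * b y 0 j.
  by apply/funext => y; rewrite ipE.
by apply: Ck_sum => // i; apply: Ck_sum => // j; apply: Ck_mul => //; exact: Ck_mul.
Qed.

End InnerProduct.

#[local] Opaque ip.

Definition spd {R : realType} {n : nat} (A : 'M[R]_n) : Prop :=
  A^T = A /\ forall v, v != 0 -> 0 < ip A v v.

Section PositiveDefinite.
Context {R : realType} {n : nat} (A : 'M[R]_n).
Hypothesis spdA : spd A.
Implicit Types u v w : 'rV[R]_n.

Lemma spd_sym v w : ip A v w = ip A w v.
Proof. by case: spdA => /ipC. Qed.

Lemma spd_nondeg v : (forall w, ip A v w = 0) -> v = 0.
Proof.
move=> H; apply/eqP/negPn/negP => v0; have [_ /(_ v v0)] := spdA.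
by rewrite H ltxx.
Qed.

Lemma spd_unit : A \in unitmx.
Proof.
rewrite -row_free_unit; apply: inj_row_free => v vA.
by apply: spd_nondeg => w; rewrite ip_mulmx vA mul0mx mxE.
Qed.

(** Strict Cauchy-Schwarz: up to the factor [ip A w w], the Gram determinant is
    the squared length of the component of [v] orthogonal to [w]. *)
Lemma spd_gram_pos v w : w != 0 -> (forall c, v != c *: w) ->
  0 < ip A v v * ip A w w - ip A v w ^+ 2.
Proof.
move=> w0 vw; have [_ pA] := spdA; have ww := pA _ w0.
have z0 : v - (ip A v w / ip A w w) *: w != 0 by rewrite subr_eq0.
have := pA _ z0; rewrite !(ipDl, ipDr, ipNl, ipNr, ipZl, ipZr) (spd_sym w v).
move=> /(mulr_gt0 ww); congr (0 < _); field; exact: lt0r_neq0.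
Qed.

End PositiveDefinite.

(** * The Levi-Civita connection *)

Section LeviCivita.
Context {R : realType} {n : nat}.
Variables (U : set 'rV[R]_n) (G : 'rV[R]_n -> 'M[R]_n).
Hypothesis oU : open U.
Hypothesis spdG : forall x, U x -> spd (G x).
Hypothesis smoothG : forall i j, smooth_on U (fun x => G x i j : R).
Implicit Types (x v w z X Y Z W : 'rV[R]_n).

(** The connection as a bilinear map: [cov] is by definition a derivative plus
    [chr], and most of its properties can be stated without indices. *)
Definition chr x v w : 'rV[R]_n :=
  \row_k \sum_a \sum_b christoffel G k a b x * v 0 a * w 0 b.

Lemma near_open x (P : set 'rV[R]_n) : (forall y, U y -> P y) -> U x -> \forall y \near x, P y.
Proof. by move=> H Ux; apply: filterS H _; exact: open_nbhs_nbhs. Qed.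

Lemma metric_differentiable x : U x -> differentiable G x.
Proof. by move=> Ux; apply/differentiable_mxP => i j; have [h _] := smoothG i j 1%N; exact: h. Qed.

Lemma metric_pd_sym x l i j : U x -> pd l (fun y => G y i j : R) x = pd l (fun y => G y j i : R) x.
Proof.
move=> Ux; apply: pd_near; apply: near_open Ux => y /spdG[sG _].
by rewrite -{1}sG mxE.
Qed.

Lemma derive_metric_sym x z v w : U x -> ip ('D_z G x) v w = ip ('D_z G x) w v.
Proof.
move=> Ux; apply: ipC; apply/matrixP => i j; rewrite mxE.
have dG := metric_differentiable Ux; rewrite !derive_mx_coord //.
apply: near_eq_derive; apply: near_open Ux => y /spdG[sG _].
by rewrite -{1}sG mxE.
Qed.

Lemma ip_derive_metric x z v w : U x ->
  ip ('D_z G x) v w = \sum_a \sum_b \sum_c z 0 c * v 0 a * w 0 b * pd c (fun y => G y a b : R) x.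
Proof.
move=> Ux; have dG := metric_differentiable Ux.
rewrite ipE; apply: eq_bigr => a _; apply: eq_bigr => b _.
rewrite derive_mx_coord // derive_pd; last by have /differentiable_mxP := dG.
rewrite mulr_sumr mulr_suml; apply: eq_bigr => c _.
by rewrite mulrA (mulrC (v 0 a)) mulrAC.
Qed.

Lemma christoffelC k i j x : U x -> christoffel G k i j x = christoffel G k j i x.
Proof.
move=> Ux; rewrite /christoffel; congr (_ * _); apply: eq_bigr => l _; congr (_ * _).
by rewrite [pd i _ _ + _]addrC (metric_pd_sym l i j Ux).
Qed.

Lemma chrC x v w : U x -> chr x v w = chr x w v.
Proof.
move=> Ux; apply/rowP => k; rewrite !mxE exchange_big; apply: eq_bigr => a _.
apply: eq_bigr => b _; rewrite mulrAC (christoffelC k b a Ux) //.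
Qed.

Lemma chrDl x u v w : chr x (u + v) w = chr x u w + chr x v w.
Proof.
apply/rowP => k; rewrite !mxE -big_split; apply: eq_bigr => a _ /=.
by rewrite -big_split; apply: eq_bigr => b _ /=; rewrite !mxE; ring.
Qed.

Lemma chrZl x c v w : chr x (c *: v) w = c *: chr x v w.
Proof.
apply/rowP => k; rewrite !mxE mulr_sumr; apply: eq_bigr => a _ /=.
by rewrite mulr_sumr; apply: eq_bigr => b _ /=; rewrite !mxE; ring.
Qed.

Lemma chrDr x u v w : chr x u (v + w) = chr x u v + chr x u w.
Proof.
apply/rowP => k; rewrite !mxE -big_split; apply: eq_bigr => a _ /=.
by rewrite -big_split; apply: eq_bigr => b _ /=; rewrite !mxE; ring.
Qed.

Lemma chrZr x c v w : chr x v (c *: w) = c *: chr x v w.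
Proof.
apply/rowP => k; rewrite !mxE mulr_sumr; apply: eq_bigr => a _ /=.
by rewrite mulr_sumr; apply: eq_bigr => b _ /=; rewrite !mxE; ring.
Qed.

(** Pairing with the metric cancels its inverse in the Christoffel symbols. *)
Lemma koszul x z v w : U x -> ip (G x) (chr x z v) w =
  2^-1 * (ip ('D_z G x) v w + ip ('D_v G x) z w - ip ('D_w G x) z v).
Proof.
move=> Ux; have [sG _] := spdG Ux; have uG := spd_unit (spdG Ux).
pose c : 'rV[R]_n := \row_l \sum_a \sum_b z 0 a * v 0 b *
  (pd a (fun y => G y b l : R) x + pd b (fun y => G y a l : R) x - pd l (fun y => G y a b : R) x).
have -> : chr x z v = 2^-1 *: (c *m invmx (G x)).
  apply/rowP => k; rewrite !mxE mulr_sumr.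
  under eq_bigr => a _ do under eq_bigr => b _ do
    rewrite /christoffel mulr_sumr !mulr_suml.
  under eq_bigr => a _ do rewrite exchange_big.
  rewrite exchange_big; apply: eq_bigr => l _; rewrite mxE mulr_suml mulr_sumr.
  apply: eq_bigr => a _; rewrite mulr_suml mulr_sumr; apply: eq_bigr => b _.
  have -> : invmx (G x) k l = invmx (G x) l k.
    by rewrite -{1}sG -trmx_inv mxE.
  by ring.
rewrite ipZl; congr (_ * _).
rewrite ip_mulmx.
rewrite (mulmxKV uG).
rewrite mxE.
rewrite -> (ip_derive_metric z v w Ux).
rewrite -> (ip_derive_metric v z w Ux).
rewrite -> (ip_derive_metric w z v Ux).
have -> : \sum_a \sum_b \sum_c0 z 0 c0 * v 0 a * w 0 b * pd c0 (fun y => G y a b : R) x =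
    \sum_l \sum_a \sum_b z 0 a * v 0 b * w 0 l * pd a (fun y => G y b l : R) x.
  by rewrite exchange_big; apply: eq_bigr => l _; rewrite exchange_big.
have -> : \sum_a \sum_b \sum_c0 v 0 c0 * z 0 a * w 0 b * pd c0 (fun y => G y a b : R) x =
    \sum_l \sum_a \sum_b v 0 b * z 0 a * w 0 l * pd b (fun y => G y a l : R) x.
  by rewrite exchange_big.
have -> : \sum_a \sum_b \sum_c0 w 0 c0 * z 0 a * v 0 b * pd c0 (fun y => G y a b : R) x =
    \sum_l \sum_a \sum_b w 0 l * z 0 a * v 0 b * pd l (fun y => G y a b : R) x.
  by rewrite [RHS]exchange_big; apply: eq_bigr => a _; rewrite [RHS]exchange_big.
rewrite -big_split -sumrB; apply: eq_bigr => l _ /=; rewrite !mxE mulr_suml.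
rewrite -big_split -sumrB; apply: eq_bigr => a _ /=; rewrite mulr_suml.
by rewrite -big_split -sumrB; apply: eq_bigr => b _ /=; ring.
Qed.

(** In the Koszul formula, the part antisymmetric in the last two arguments
    cancels on adding the formula with these exchanged. *)
Lemma metric_compat x z v w : U x ->
  ip ('D_z G x) v w = ip (G x) (chr x z v) w + ip (G x) v (chr x z w).
Proof.
move=> Ux; rewrite (spd_sym (spdG Ux) v) !(koszul _ _ _ Ux).
rewrite -> (derive_metric_sym z w v Ux).
gen_ip.
by lra.
Qed.

Lemma smooth_christoffel k i j : smooth_on U (christoffel G k i j).
Proof.
move=> N; apply: Ck_mul => //; first exact: Ck_cst.
have Cpd a b c : Ck N U (pd c (fun y => G y a b : R)).
  by have [_ h] := smoothG a b N.+1; exact: h.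
apply: Ck_sum => // l; apply: Ck_mul => //.
  apply: Ck_invmx => // [x Ux|a b]; first exact/spd_unit/spdG.
  exact: smoothG.
apply: Ck_add => //; first exact: Ck_add.
have -> : (fun x => - pd l (fun y => G y i j : R) x) = fun x => (-1) * pd l (fun y => G y i j : R) x.
  by apply/funext => x; rewrite mulN1r.
by apply: Ck_mul => //; exact: Ck_cst.
Qed.

Lemma differentiable_christoffel k i j x : U x -> differentiable (christoffel G k i j) x.
Proof. by move=> Ux; have [h _] := smooth_christoffel k i j 1%N; exact: h. Qed.

Lemma differentiable_chr x v w : U x -> differentiable (fun y => chr y v w) x.
Proof.
move=> Ux; apply/differentiable_mxP => i k.
have -> : (fun y => chr y v w i k) =
    fun y => \sum_a \sum_b christoffel G k a b y * (v 0 a * w 0 b).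
  by apply/funext => y; rewrite mxE; do 2 (apply: eq_bigr => ? _); rewrite mulrA.
apply: differentiable_bigsum => a; apply: differentiable_bigsum => b.
apply: differentiableM => //; exact: differentiable_christoffel.
Qed.

Definition dchr x z v w : 'rV[R]_n := 'D_z (fun y => chr y v w) x.

Lemma dchrE x z v w k : U x -> dchr x z v w 0 k =
  \sum_a \sum_b 'D_z (christoffel G k a b) x * v 0 a * w 0 b.
Proof.
move=> Ux; rewrite /dchr derive_mx_coord; last exact: differentiable_chr.
have -> : (fun y => chr y v w 0 k : R) =
    fun y => \sum_a \sum_b christoffel G k a b y * (v 0 a * w 0 b).
  by apply/funext => y; rewrite mxE; do 2 (apply: eq_bigr => ? _); rewrite mulrA.
have dc a b := differentiable_christoffel k a b Ux.
have dd a b : differentiable (fun y => christoffel G k a b y * (v 0 a * w 0 b)) x.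
  exact: differentiableM.
rewrite derive_bigsum => [|a]; last exact: differentiable_bigsum.
apply: eq_bigr => a _; rewrite derive_bigsum //; apply: eq_bigr => b _.
by rewrite derive_prod // derive_cst mulr0 add0r mulrC mulrA.
Qed.

(** The curvature operator without indices, for vector fields with constant
    coefficients. *)
Definition Rm x X Y Z : 'rV[R]_n :=
  dchr x X Y Z - dchr x Y X Z + (chr x X (chr x Y Z) - chr x Y (chr x X Z)).

Lemma curvE x X Y Z : U x -> curv G x X Y Z = Rm x X Y Z.
Proof.
move=> Ux; apply/rowP => l; rewrite mxE.
have dc k a b := differentiable_christoffel k a b Ux.
have -> : Rm x X Y Z 0 l = dchr x X Y Z 0 l - dchr x Y X Z 0 l +
   (chr x X (chr x Y Z) 0 l - chr x Y (chr x X Z) 0 l) by rewrite !mxE.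
have E1 A B : dchr x A B Z 0 l = \sum_i \sum_j \sum_k
    A 0 i * B 0 j * Z 0 k * pd i (christoffel G l j k) x.
  rewrite dchrE //; under eq_bigr => a _ do under eq_bigr => b _ do
    rewrite derive_pd // !mulr_suml.
  under eq_bigr => a _ do rewrite exchange_big.
  rewrite exchange_big; apply: eq_bigr => i _; apply: eq_bigr => j _; apply: eq_bigr => k _.
  by rewrite /GRing.scale /=; ring.
have E2 A B : chr x A (chr x B Z) 0 l = \sum_i \sum_j \sum_k
    A 0 i * B 0 j * Z 0 k * \sum_m christoffel G l i m x * christoffel G m j k x.
  rewrite mxE; apply: eq_bigr => i _.
  under eq_bigr => m _ do rewrite mxE mulr_sumr.
  rewrite exchange_big; apply: eq_bigr => j _.
  under eq_bigr => m _ do rewrite mulr_sumr.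
  rewrite exchange_big; apply: eq_bigr => k _; rewrite mulr_sumr.
  by apply: eq_bigr => m _; ring.
rewrite !E1 !E2.
have sw (F : 'I_n -> 'I_n -> 'I_n -> R) :
   \sum_i \sum_j \sum_k F i j k = \sum_j \sum_i \sum_k F i j k by exact: exchange_big.
rewrite [X in _ = _ - X + _]sw [X in _ = _ + (_ - X)]sw.
rewrite -!sumrB -big_split; apply: eq_bigr => i _ /=.
rewrite -!sumrB -big_split; apply: eq_bigr => j _ /=.
rewrite -!sumrB -big_split; apply: eq_bigr => k _ /=.
rewrite /riem sumrB.
move: (pd i _ x) (pd j _ x) (\sum_(m < n) _) (\sum_(m < n) _) => a b c d.
by ring.
Qed.

Lemma Rm_antisym x X Y Z : Rm x Y X Z = - Rm x X Y Z.
Proof. by rewrite /Rm opprD !opprB. Qed.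

Lemma Rm_bianchi x X Y Z : U x -> Rm x X Y Z + Rm x Y Z X + Rm x Z X Y = 0.
Proof.
move=> Ux.
have dC A B C : dchr x A B C = dchr x A C B.
  by apply: near_eq_derive; apply: near_open Ux => y; exact: chrC.
rewrite /Rm (dC X Z Y) (dC Y X Z) (dC Z Y X) (chrC Y Z) // (chrC Z X) // (chrC X Y) //.
repeat match goal with |- context [dchr ?a ?b ?c ?d] => generalize (dchr a b c d); intro end.
repeat match goal with |- context [chr ?a ?b (chr ?d ?e ?f)] => generalize (chr a b (chr d e f)); intro end.
 by apply/rowP => i; rewrite !mxE; ring.
Qed.

(** The second derivatives of [ip (G y) Z W] in [y] commute; expanded with
    [metric_compat], their difference consists of the two curvature terms. *)
Lemma Rm_metric x X Y Z W : U x ->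
  ip (G x) (Rm x X Y Z) W = - ip (G x) Z (Rm x X Y W).
Proof.
move=> Ux; have dG := metric_differentiable Ux.
have sG := spdG Ux.
have cst (v : 'rV[R]_n) : differentiable (fun=> v : 'rV[R]_n) x by exact: differentiable_cst.
have DZW Y' y : U y -> 'D_Y' (fun y => ip (G y) Z W) y = ip ('D_Y' G y) Z W.
  move=> Uy; have dGy := metric_differentiable Uy.
  have dc (v : 'rV[R]_n) : differentiable (fun=> v : 'rV[R]_n) y by exact: differentiable_cst.
  apply: etrans (derive_ip Y' dGy (dc Z) (dc W)) _.
  by rewrite !derive_cst ip0l ip0r !addr0.
have dZW : \forall y \near x, differentiable (fun y => ip (G y) Z W) y.
  apply: near_open Ux => y Uy; apply: differentiable_ip; last 2 first.
  - exact: differentiable_cst.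
  - exact: differentiable_cst.
  exact: metric_differentiable.
pose H Y' y := ip (G y) (chr y Y' Z) W + ip (G y) Z (chr y Y' W).
have HE Y' : \near x, H Y' x = 'D_Y' (fun y => ip (G y) Z W) x.
  by apply: near_open Ux => y Uy; rewrite /H DZW // metric_compat.
have d1 Y' : differentiable (fun y => ip (G y) (chr y Y' Z) W) x.
  by apply: differentiable_ip => //; exact: differentiable_chr.
have d2 Y' : differentiable (fun y => ip (G y) Z (chr y Y' W)) x.
  by apply: differentiable_ip => //; exact: differentiable_chr.
have dH Y' : differentiable (H Y') x by exact: differentiableD.
have dDH Y' : differentiable (fun y => 'D_Y' (fun y => ip (G y) Z W) y) x.
  exact: near_eq_differentiable (HE Y') (dH Y').
have := derive_swap dZW (dDH X) (dDH Y).
rewrite -(near_eq_derive _ (HE X)) -(near_eq_derive _ (HE Y)).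
have DH X' Y' : 'D_X' (H Y') x =
   ip (G x) (dchr x X' Y' Z) W + ip (G x) Z (dchr x X' Y' W) +
   ip (G x) (chr x X' (chr x Y' Z)) W + ip (G x) Z (chr x X' (chr x Y' W)) +
   ip (G x) (chr x Y' Z) (chr x X' W) + ip (G x) (chr x X' Z) (chr x Y' W).
  have -> : 'D_X' (H Y') x = 'D_X' (fun y => ip (G y) (chr y Y' Z) W) x +
      'D_X' (fun y => ip (G y) Z (chr y Y' W)) x.
    by apply: deriveD; apply: diff_derivable.
  have e1 := derive_ip X' dG (differentiable_chr Y' Z Ux) (cst W).
  have e2 := derive_ip X' dG (cst Z) (differentiable_chr Y' W Ux).
  have c1 := metric_compat X' (chr x Y' Z) W Ux.
  have c2 := metric_compat X' Z (chr x Y' W) Ux.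
  rewrite !derive_cst ip0l addr0 in e2; rewrite !derive_cst ip0r addr0 in e1.
  apply: etrans (congr2 +%R e1 e2) _.
  rewrite -> c1; rewrite -> c2; rewrite /dchr; gen_ip; ring.
have e := DH X Y; have e' := DH Y X.
move=> E; have {}E := etrans (esym e') (etrans E e).
move: {e e' DH} E.
rewrite /Rm !(ipDl, ipDr, ipNl, ipNr); gen_ip; lra.
Qed.

Lemma dchrDz x z z' v w : U x -> dchr x (z + z') v w = dchr x z v w + dchr x z' v w.
Proof. by move=> Ux; apply: derive_addv; exact: differentiable_chr. Qed.

Lemma dchrZz x c z v w : U x -> dchr x (c *: z) v w = c *: dchr x z v w.
Proof. by move=> Ux; apply: derive_scalev; exact: differentiable_chr. Qed.

Lemma dchrDl x z v v' w : U x -> dchr x z (v + v') w = dchr x z v w + dchr x z v' w.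
Proof.
move=> Ux; apply/rowP => k; rewrite [RHS]mxE !dchrE // -big_split; apply: eq_bigr => a _ /=.
by rewrite -big_split; apply: eq_bigr => b _ /=; rewrite mxE mulrDr mulrDl.
Qed.

Lemma dchrZl x z c v w : U x -> dchr x z (c *: v) w = c *: dchr x z v w.
Proof.
move=> Ux; apply/rowP => k; rewrite [RHS]mxE !dchrE // mulr_sumr; apply: eq_bigr => a _ /=.
by rewrite mulr_sumr; apply: eq_bigr => b _ /=; rewrite mxE mulrCA !mulrA.
Qed.

Lemma dchrDr x z v w w' : U x -> dchr x z v (w + w') = dchr x z v w + dchr x z v w'.
Proof.
move=> Ux; apply/rowP => k; rewrite [RHS]mxE !dchrE // -big_split; apply: eq_bigr => a _ /=.
by rewrite -big_split; apply: eq_bigr => b _ /=; rewrite mxE mulrDr.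
Qed.

Ltac vector_identity :=
  repeat match goal with |- context [dchr ?a ?b ?c ?d] => generalize (dchr a b c d); intro end;
  repeat match goal with
    |- context [chr ?a ?b (chr ?d ?e ?f)] => generalize (chr a b (chr d e f)); intro end;
  apply/rowP => ?; rewrite !mxE; ring.

Lemma RmDl x X X' Y Z : U x -> Rm x (X + X') Y Z = Rm x X Y Z + Rm x X' Y Z.
Proof.
move=> Ux; rewrite /Rm (dchrDz _ _ _ _ Ux) (dchrDl _ _ _ _ Ux) !chrDl !chrDr.
vector_identity.
Qed.

Lemma RmZl x c X Y Z : U x -> Rm x (c *: X) Y Z = c *: Rm x X Y Z.
Proof.
by move=> Ux; rewrite /Rm (dchrZz _ _ _ _ Ux) (dchrZl _ _ _ _ Ux) !chrZl !chrZr -!scalerBr -scalerDr.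
Qed.

Lemma RmDr x X Y Z Z' : U x -> Rm x X Y (Z + Z') = Rm x X Y Z + Rm x X Y Z'.
Proof.
move=> Ux; rewrite /Rm !(dchrDr _ _ _ _ Ux) !chrDr; vector_identity.
Qed.

End LeviCivita.

(** * The curvature tensor of a space form *)

Section ConstantCurvature.

(** Polarizing [T a b b a = 0], the symmetries make [T] alternating in all its
    arguments, and the Bianchi sum is then three times [T]. *)
Lemma curvature_like_eq0 {R : realType} {V : zmodType} (T : V -> V -> V -> V -> R) :
  (forall a b c d, T b a c d = - T a b c d) ->
  (forall a b c d, T a b d c = - T a b c d) ->
  (forall a b c d, T a b c d + T b c a d + T c a b d = 0) ->
  (forall a a' b c d, T (a + a') b c d = T a b c d + T a' b c d) ->
  (forall a b c c' d, T a b (c + c') d = T a b c d + T a b c' d) ->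
  (forall a b, T a b b a = 0) -> forall a b c d, T a b c d = 0.
Proof.
move=> s12 s34 B D1 D3 S.
have pair a b c d : T a b c d = T c d a b.
  have := B a b c d; have := B b c d a; have := B c d a b; have := B d a b c.
  have := s12 a b c d; have := s12 a b d c; have := s34 a b c d.
  have := s12 b c a d; have := s12 b c d a; have := s34 b c a d.
  have := s12 c a b d; have := s12 c a d b; have := s34 c a b d.
  have := s12 c d a b; have := s12 c d b a; have := s34 c d a b.
  have := s12 a d b c; have := s12 a d c b; have := s34 a d b c; have := s34 d a b c.
  have := s12 b d a c; have := s12 b d c a; have := s34 b d a c; have := s34 d b a c.
  lra.
have D2 a b b' c d : T a (b + b') c d = T a b c d + T a b' c d.
  by rewrite s12 D1 opprD -!s12.
have D4 a b c d d' : T a b c (d + d') = T a b c d + T a b c d'.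
  by rewrite s34 D3 opprD -!s34.
have Z a b c : T a b c a = 0.
  have := S a (b + c); rewrite D2 !D3 !S.
  have := pair a c b a; have := s12 a b a c; have := s34 a b c a; lra.
have s14 a b c d : T d b c a = - T a b c d.
  by have := Z (a + d) b c; rewrite D1 !D4 !Z; lra.
have s13 a b c d : T c b a d = - T a b c d.
  by have := s14 c b a d; have := s14 a b c d; have := s34 d b a c; lra.
move=> a b c d; have := B a b c d.
have := s13 a b c d; have := s12 b c a d; have := s12 c a b d.
have := s13 b a c d; have := s12 a b c d; have := s13 c a b d; have := s13 a c b d.
have := s12 b c a d; lra.
Qed.

Context {R : realType} {n : nat}.
Variables (U : set 'rV[R]_n) (G : 'rV[R]_n -> 'M[R]_n).
Hypothesis oU : open U.
Hypothesis spdG : forall x, U x -> spd (G x).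
Hypothesis smoothG : forall i j, smooth_on U (fun x => G x i j : R).

(** The difference of the two sides has the symmetries of a curvature tensor, and
    the hypothesis says that its sectional curvatures vanish. *)
Lemma constant_curvature_tensor x (L0 : R) X Y Z : U x ->
  (forall X Y, row_free (col_mx X Y) -> sectional G x X Y = L0) ->
  Rm G x X Y Z = L0 *: (ip (G x) Y Z *: X - ip (G x) X Z *: Y).
Proof.
move=> Ux sec; have sG := spdG Ux; have symG := spd_sym sG.
have Rm0 X' Z' : Rm G x X' 0 Z' = 0.
  have e := RmZl oU spdG smoothG 0 0 X' Z' Ux; rewrite !scale0r in e.
  by rewrite Rm_antisym e oppr0.
have Rmself X' Z' : Rm G x X' X' Z' = 0.
  have /eqP := Rm_antisym G x X' X' Z'.
  by rewrite -addr_eq0 -mulr2n -scaler_nat scaler_eq0 pnatr_eq0 => /eqP.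
have gram X' Y' : ip (G x) (Rm G x X' Y' Y') X' =
    L0 * (ip (G x) X' X' * ip (G x) Y' Y' - ip (G x) X' Y' ^+ 2).
  have [->|Y0] := eqVneq Y' 0; first by rewrite Rm0 !ip0l !ip0r; ring.
  have [[c ->]|nc] := pselect (exists c, X' = c *: Y').
    by rewrite (RmZl oU spdG smoothG) // Rmself scaler0 ip0l !ipZl !ipZr; ring.
  have rf : row_free (col_mx X' Y').
    apply: inj_row_free => v; rewrite -[v]hsubmxK mul_row_col.
    rewrite [lsubmx v]mx11_scalar [rsubmx v]mx11_scalar !mul_scalar_mx.
    move: (lsubmx v 0 0) (rsubmx v 0 0) => a b E.
    have a0 : a = 0.
      apply/eqP/negPn/negP => a0; apply: nc; exists (- b / a).
      have /(congr1 (fun u => a^-1 *: u)) := E.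
      rewrite scalerDr !scalerA mulVf // scale1r scaler0 => /eqP; rewrite addr_eq0 => /eqP ->.
      by rewrite mulrC mulNr scaleNr.
    move: E; rewrite a0 scale0r add0r => /eqP; rewrite scaler_eq0 (negbTE Y0) orbF => /eqP ->.
    by rewrite raddf0 row_mx0.
  rewrite -(sec _ _ rf) /sectional (curvE oU spdG smoothG) // divfK //.
  apply: lt0r_neq0; apply: spd_gram_pos => // c; apply/negP => /eqP cE; apply: nc.
  by exists c.
suff H A B C D : ip (G x) (Rm G x A B C) D -
    L0 * (ip (G x) B C * ip (G x) A D - ip (G x) A C * ip (G x) B D) = 0.
  apply/eqP; rewrite -subr_eq0; apply/eqP; apply: (spd_nondeg sG) => W.
  rewrite (ipDl _ (Rm G x X Y Z)) ipNl ipZl (ipDl _ (_ *: X)) ipNl !ipZl.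
  by have := H X Y Z W; gen_ip => *; lra.
pose T A B C D := ip (G x) (Rm G x A B C) D -
    L0 * (ip (G x) B C * ip (G x) A D - ip (G x) A C * ip (G x) B D).
apply: (@curvature_like_eq0 R 'rV[R]_n T); rewrite /T.
- by move=> a b c d; rewrite Rm_antisym ipNl; gen_ip => *; ring.
- move=> a b c d; have e := Rm_metric oU spdG smoothG a b d c Ux.
  rewrite (symG d) in e; rewrite (symG b c) (symG a c).
  by move: e; gen_ip => *; lra.
- move=> a b c d; have e := Rm_bianchi oU spdG a b c Ux.
  have e' : ip (G x) (Rm G x a b c + Rm G x b c a + Rm G x c a b) d = 0 by rewrite e ip0l.
  rewrite (ipDl _ (_ + _)) (ipDl _ (Rm G x a b c)) in e'.
  by rewrite (symG c a) (symG c b) (symG b a); move: e'; gen_ip => *; lra.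
- move=> a a' b c d; rewrite (RmDl oU spdG smoothG) // (ipDl _ (Rm G x a b c)) !(ipDl _ a); gen_ip => *; ring.
- move=> a b c c' d; rewrite (RmDr oU spdG smoothG) // (ipDl _ (Rm G x a b c)) !(ipDr _ _ c); gen_ip => *; ring.
- by move=> a b; rewrite gram (symG b a); gen_ip => *; ring.
Qed.

End ConstantCurvature.

(** * Change of coordinates *)

(** The permutation argument behind the uniqueness of the Levi-Civita
    connection. *)
Lemma sym_antisym_eq0 {R : realType} {T : Type} (a : T -> T -> T -> R) :
  (forall x y z, a x y z = a y x z) -> (forall x y z, a x y z + a x z y = 0) ->
  forall x y z, a x y z = 0.
Proof.
move=> s anti x y z; have := anti x y z; have := anti z x y; have := anti y z x.
have := s x y z; have := s x z y; have := s y z x; lra.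
Qed.

Section ChangeOfCoordinates.
Context {R : realType} {n : nat}.

Lemma smooth_derive (m : nat) (U : set 'rV[R]_m) (f : 'rV[R]_m -> 'rV[R]_n) (v : 'rV[R]_m) :
  open U -> smooth_on U f -> smooth_on U (fun x => 'D_v f x).
Proof.
move=> oU sf N; apply/Ck_mxP => // i j.
have C : Ck N U (fun x => \sum_k v 0 k * pd k f x i j).
  apply: Ck_sum => // k; apply: Ck_mul => //; first exact: Ck_cst.
  have [_ h] := sf N.+1; exact: (proj1 (Ck_mxP _ _ oU) (h k)).
apply: Ck_eq C => // x Ux; rewrite derive_pd; last by have [h _] := sf 1%N; exact: h.
by rewrite summxE; apply: eq_bigr => k _; rewrite mxE.
Qed.

Lemma derive_swap_row (m : nat) (U : set 'rV[R]_m) (f : 'rV[R]_m -> 'rV[R]_n) (x v w : 'rV[R]_m) :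
  open U -> smooth_on U f -> U x ->
  'D_w (fun y => 'D_v f y) x = 'D_v (fun y => 'D_w f y) x.
Proof.
move=> oU sf Ux.
have df y : U y -> differentiable f y by have [h _] := sf 1%N; exact: h.
have dD v' : differentiable (fun y => 'D_v' f y) x.
  by have [h _] := smooth_derive v' oU sf 1%N; exact: h.
have nx (P : 'rV[R]_m -> Prop) : (forall y, U y -> P y) -> \forall y \near x, P y.
  by move=> H; apply: filterS H _; exact: open_nbhs_nbhs.
apply/matrixP => i k.
apply: etrans (derive_mx_coord w i k (dD v)) _; apply: esym.
apply: etrans (derive_mx_coord v i k (dD w)) _; apply: esym.
have E v' : \near x, ('D_v' f x i k : R) = 'D_v' (fun y => f y i k : R) x.
  by apply: nx => y Uy; rewrite derive_mx_coord //; exact: df.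
apply: etrans (near_eq_derive w (E v)) _; apply: esym.
apply: etrans (near_eq_derive v (E w)) _; apply: esym.
have dk v' : differentiable (fun y => 'D_v' (fun y => f y i k : R) y) x.
  by apply: near_eq_differentiable (E v') _; have /differentiable_mxP := dD v'.
apply: derive_swap => //; apply: nx => y Uy.
by have /differentiable_mxP := df y Uy.
Qed.

Implicit Types (x v w z : 'rV[R]_n).
Variables (U U' : set 'rV[R]_n) (G G' : 'rV[R]_n -> 'M[R]_n) (tau : 'rV[R]_n -> 'rV[R]_n).
Hypotheses (oU : open U) (oU' : open U').
Hypotheses (spdG : forall x, U x -> spd (G x)) (spdG' : forall x, U' x -> spd (G' x)).
Hypothesis smoothG : forall i j, smooth_on U (fun x => G x i j : R).
Hypothesis smoothG' : forall i j, smooth_on U' (fun x => G' x i j : R).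
Hypothesis smooth_tau : smooth_on U tau.
Hypothesis tauU : forall x, U x -> U' (tau x).
Hypothesis isom : forall x v w, U x ->
  ip (G x) v w = ip (G' (tau x)) ('D_v tau x) ('D_w tau x).
Hypothesis onto : forall x y, U x -> exists v, 'D_v tau x = y.

(** The defect of the transformation law, paired with a third vector, is
    symmetric in the first two arguments (both connections are torsion free)
    and antisymmetric in the last two (both preserve the metric), hence zero. *)
Lemma chr_transform x z v : U x ->
  chr G' (tau x) ('D_z tau x) ('D_v tau x) + 'D_z (fun y => 'D_v tau y) x =
  'D_(chr G x z v) tau x.
Proof.
move=> Ux; have U'x := tauU Ux.
have dt : differentiable tau x by have [h _] := smooth_tau 1%N; exact: h.
have dD w : differentiable (fun y => 'D_w tau y) x.
  by have [h _] := smooth_derive w oU smooth_tau 1%N; exact: h.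
pose S z v := chr G' (tau x) ('D_z tau x) ('D_v tau x) + 'D_z (fun y => 'D_v tau y) x
   - 'D_(chr G x z v) tau x.
pose a z v w := ip (G' (tau x)) (S z v) ('D_w tau x).
have symS z' v' : S z' v' = S v' z'.
  by rewrite /S (chrC oU' spdG' _ _ U'x) (chrC oU spdG v' z' Ux) (derive_swap_row z' v' oU smooth_tau Ux).
have sG' := spd_sym (spdG' U'x).
have dG := metric_differentiable smoothG Ux.
have dG' := metric_differentiable smoothG' U'x.
have dGt : differentiable (G' \o tau) x by exact: differentiable_comp.
have anti z' v' w' : a z' v' w' + a z' w' v' = 0.
  have e1 := metric_compat oU spdG smoothG z' v' w' Ux.
  have cst (u : 'rV[R]_n) : differentiable (fun=> u : 'rV[R]_n) x by exact: differentiable_cst.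
  have e2 := derive_ip z' dG (cst v') (cst w').
  have e3 := derive_ip z' dGt (dD v') (dD w').
  have e4 : 'D_z' (fun y => ip (G y) v' w') x =
     'D_z' (fun y => ip ((G' \o tau) y) ('D_v' tau y) ('D_w' tau y)) x.
    apply: near_eq_derive; apply: filterS (fun y Uy => isom v' w' Uy) _.
    exact: open_nbhs_nbhs.
  rewrite !derive_cst ip0l ip0r !addr0 in e2.
  have e5 : 'D_z' (G' \o tau) x = 'D_('D_z' tau x) G' (tau x) by exact: derive_comp.
  rewrite e5 in e3.
  have e6 := metric_compat oU' spdG' smoothG' ('D_z' tau x) ('D_v' tau x) ('D_w' tau x) U'x.
  have e7 := isom (chr G x z' v') w' Ux.
  have e8 := isom v' (chr G x z' w') Ux.
  have e := etrans (esym (etrans e2 e1)) (etrans e4 e3).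
  rewrite -> e6 in e; rewrite -> e7 in e; rewrite -> e8 in e.
  have f1 : a z' v' w' = _ := ipDBl _ _ _ _ _.
  have f2 : a z' w' v' = _ := ipDBl _ _ _ _ _.
  have s1 := sG' (chr G' (tau x) ('D_z' tau x) ('D_w' tau x)) ('D_v' tau x).
  have s2 := sG' ('D_z' (fun y => 'D_w' tau y) x) ('D_v' tau x).
  have s3 := sG' ('D_(chr G x z' w') tau x) ('D_v' tau x).
  rewrite -> s1 in f2; rewrite -> s2 in f2; rewrite -> s3 in f2.
  move: e f1 f2; rewrite /= => e f1 f2; rewrite -> f1; rewrite -> f2.
  clear - e; move: e; gen_ip => *; lra.
have a0 : forall u1 u2 u3, a u1 u2 u3 = 0.
  by apply: sym_antisym_eq0 anti => u1 u2 u3; rewrite /a symS.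
apply/eqP; rewrite -subr_eq0; apply/eqP; apply: (spd_nondeg (spdG' U'x)) => y.
by have [w <-] := onto y Ux; exact: a0.
Qed.

End ChangeOfCoordinates.

#[local] Opaque ip.

(** * Orthonormal bases and matrix calculus *)

Section OrthonormalFrame.
Context {R : realType}.

(** Gram-Schmidt: while [k < n], some nonzero vector is orthogonal to the rows
    found so far. *)
Lemma spd_orthonormal n (A : 'M[R]_n) k : spd A -> (k <= n)%N ->
  exists E : 'M[R]_(k, n), E *m A *m E^T = 1%:M.
Proof.
move=> sA; elim: k => [|k IH] kn.
  by exists 0; apply/matrixP => -[].
have [E HE] := IH (ltnW kn).
have kn0 : kermx (A *m E^T) != 0.
  rewrite -mxrank_eq0 mxrank_ker subn_eq0 -ltnNge.
  exact: leq_ltn_trans (rank_leq_col _) kn.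
have /rowV0Pn[v /sub_kermxP vE v0] := kn0.
have [symA /(_ v v0) pv] := sA.
have sv : Num.sqrt (ip A v v) != 0 by rewrite sqrtr_eq0 -ltNge.
pose w := (Num.sqrt (ip A v v))^-1 *: v.
have wE : w *m A *m E^T = 0 by rewrite /w -!scalemxAl -mulmxA vE scaler0.
have Ew : E *m A *m w^T = 0.
  have <- : (w *m A *m E^T)^T = E *m A *m w^T by rewrite !trmx_mul trmxK symA mulmxA.
  by rewrite wE trmx0.
have ww : w *m A *m w^T = 1%:M.
  rewrite [LHS]mx11_scalar; congr scalar_mx; rewrite -ip_mulmx ipZl ipZr mulrA -invfM.
  by rewrite -expr2 sqr_sqrtr ?ltW // mulVf // gt_eqF.
exists (col_mx w E : 'M[R]_(1 + k, n)).
suff : col_mx w E *m A *m (col_mx w E)^T = 1%:M :> 'M[R]_(1 + k) by [].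
by rewrite tr_col_mx mul_col_mx mul_col_row HE ww wE Ew -scalar_mx_block.
Qed.

End OrthonormalFrame.

Section MatrixDerivatives.
Context {R : realType} {V : normedModType R}.

Lemma derive_ext (W : normedModType R) (f g : V -> W) x v :
  f =1 g -> 'D_v f x = 'D_v g x.
Proof. by move=> /funext ->. Qed.

Lemma differentiable_col_mx m1 m2 n (f : V -> 'M[R]_(m1, n)) (g : V -> 'M[R]_(m2, n)) x :
  differentiable f x -> differentiable g x -> differentiable (fun y => col_mx (f y) (g y)) x.
Proof.
move=> /differentiable_mxP df /differentiable_mxP dg; apply/differentiable_mxP => i j.
case: (split_ordP i) => k ->.
  by apply: near_eq_differentiable (df k j); near=> y; rewrite col_mxEu.
by apply: near_eq_differentiable (dg k j); near=> y; rewrite col_mxEd.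
Unshelve. all: by end_near. Qed.

Lemma derive_col_mx m1 m2 n (f : V -> 'M[R]_(m1, n)) (g : V -> 'M[R]_(m2, n)) x v :
  differentiable f x -> differentiable g x ->
  'D_v (fun y => col_mx (f y) (g y)) x = col_mx ('D_v f x) ('D_v g x).
Proof.
move=> df dg; have dfg := differentiable_col_mx df dg; apply/matrixP => i j.
apply: etrans (derive_mx_coord v i j dfg) _; case: (split_ordP i) => k ->.
  rewrite col_mxEu; apply: esym; apply: etrans (derive_mx_coord v k j df) _.
  by apply: derive_ext => y; rewrite col_mxEu.
rewrite col_mxEd; apply: esym; apply: etrans (derive_mx_coord v k j dg) _.
by apply: derive_ext => y; rewrite col_mxEd.
Qed.

Lemma differentiable_row m n (f : V -> 'M[R]_(m, n)) x i :
  differentiable f x -> differentiable (fun y => row i (f y)) x.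
Proof.
move=> /differentiable_mxP df; apply/differentiable_mxP => a b.
by apply: near_eq_differentiable (df i b); near=> y; rewrite mxE.
Unshelve. all: by end_near. Qed.

Lemma derive_row m n (f : V -> 'M[R]_(m, n)) x v i : differentiable f x ->
  'D_v (fun y => row i (f y)) x = row i ('D_v f x).
Proof.
move=> df; have dr := differentiable_row i df; apply/matrixP => a b.
apply: etrans (derive_mx_coord v a b dr) _; rewrite mxE; apply: esym.
apply: etrans (derive_mx_coord v i b df) _.
by apply: derive_ext => y; rewrite mxE.
Qed.

Lemma differentiable_mulmx m n p (f : V -> 'M[R]_(m, n)) (g : V -> 'M[R]_(n, p)) x :
  differentiable f x -> differentiable g x -> differentiable (fun y => f y *m g y) x.
Proof.
move=> /differentiable_mxP df /differentiable_mxP dg; apply/differentiable_mxP => i j.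
have -> : (fun y => (f y *m g y) i j : R) = fun y => \sum_k f y i k * g y k j.
  by apply/funext => y; rewrite mxE.
by apply: differentiable_bigsum => k; exact: differentiableM.
Qed.

Lemma derive_mulmx m n p (f : V -> 'M[R]_(m, n)) (g : V -> 'M[R]_(n, p)) x v :
  differentiable f x -> differentiable g x ->
  'D_v (fun y => f y *m g y) x = 'D_v f x *m g x + f x *m 'D_v g x.
Proof.
move=> df dg; have dfg := differentiable_mulmx df dg.
have /differentiable_mxP cf := df; have /differentiable_mxP cg := dg.
apply/matrixP => i j; apply: etrans (derive_mx_coord v i j dfg) _.
have -> : (fun y => (f y *m g y) i j : R) = fun y => \sum_k f y i k * g y k j.
  by apply/funext => y; rewrite mxE.
rewrite derive_bigsum => [|k]; last exact: differentiableM.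
rewrite mxE !mxE -big_split; apply: eq_bigr => k _ /=; rewrite derive_prod //.
rewrite -(derive_mx_coord v i k df) -(derive_mx_coord v k j dg).
by rewrite addrC; congr (_ + _); exact: mulrC.
Qed.

Lemma differentiable_scalev (k : V -> R) m n (f : V -> 'M[R]_(m, n)) x :
  differentiable k x -> differentiable f x -> differentiable (fun y => k y *: f y) x.
Proof.
move=> dk /differentiable_mxP df; apply/differentiable_mxP => i j.
have -> : (fun y => (k y *: f y) i j : R) = fun y => k y * f y i j.
  by apply/funext => y; rewrite mxE.
exact: differentiableM.
Qed.

Lemma derive_scale (k : V -> R) m n (f : V -> 'M[R]_(m, n)) x v :
  differentiable k x -> differentiable f x ->
  'D_v (fun y => k y *: f y) x = 'D_v k x *: f x + k x *: 'D_v f x.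
Proof.
move=> dk df; have dkf := differentiable_scalev dk df.
have /differentiable_mxP cf := df.
apply/matrixP => i j; apply: etrans (derive_mx_coord v i j dkf) _.
have -> : (fun y => (k y *: f y) i j : R) = fun y => k y * f y i j.
  by apply/funext => y; rewrite mxE.
rewrite derive_prod // !mxE -(derive_mx_coord v i j df).
by rewrite addrC; congr (_ + _); exact: mulrC.
Qed.

Lemma derive_addf (W : normedModType R) (f g : V -> W) x v :
  differentiable f x -> differentiable g x ->
  'D_v (fun y => f y + g y) x = 'D_v f x + 'D_v g x.
Proof. by move=> df dg; rewrite deriveD //; exact: diff_derivable. Qed.

Lemma derive_oppf (W : normedModType R) (f : V -> W) x v :
  differentiable f x -> 'D_v (fun y => - f y) x = - 'D_v f x.
Proof. by move=> df; rewrite deriveN //; exact: diff_derivable. Qed.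

End MatrixDerivatives.

Section DeriveChr.
Context {R : realType} {n : nat} {V : normedModType R}.
Variables (U : set 'rV[R]_n) (G : 'rV[R]_n -> 'M[R]_n).
Hypothesis oU : open U.
Hypothesis spdG : forall x, U x -> spd (G x).
Hypothesis smoothG : forall i j, smooth_on U (fun x => G x i j : R).
Variables (f a b : V -> 'rV[R]_n) (x : V).
Hypotheses (Ufx : U (f x)) (df : differentiable f x) (da : differentiable a x)
  (db : differentiable b x).

Let dG k i j : differentiable (fun y => christoffel G k i j (f y)) x.
Proof.
apply: (@differentiable_comp _ _ _ _ f (christoffel G k i j)) => //.
exact: (differentiable_christoffel oU spdG smoothG).
Qed.
Let da' i : differentiable (fun y => a y 0 i : R) x.
Proof. by have /differentiable_mxP := da. Qed.
Let db' i : differentiable (fun y => b y 0 i : R) x.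
Proof. by have /differentiable_mxP := db. Qed.

Let dterm k i j : differentiable (fun y => christoffel G k i j (f y) * a y 0 i * b y 0 j) x.
Proof. by apply: differentiableM => //; exact: differentiableM. Qed.

Lemma differentiable_chr_along : differentiable (fun y => chr G (f y) (a y) (b y)) x.
Proof.
apply/differentiable_mxP => i k.
have -> : (fun y => chr G (f y) (a y) (b y) i k : R) =
    fun y => \sum_c \sum_d christoffel G k c d (f y) * a y 0 c * b y 0 d.
  by apply/funext => y; rewrite mxE.
by do 2 (apply: differentiable_bigsum => ?).
Qed.

Lemma derive_chr v : 'D_v (fun y => chr G (f y) (a y) (b y)) x =
  dchr G (f x) ('D_v f x) (a x) (b x) + chr G (f x) ('D_v a x) (b x)
  + chr G (f x) (a x) ('D_v b x).
Proof.
apply/rowP => k; apply: etrans (derive_mx_coord v 0 k differentiable_chr_along) _.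
have -> : (fun y => chr G (f y) (a y) (b y) 0 k : R) =
    fun y => \sum_c \sum_d christoffel G k c d (f y) * a y 0 c * b y 0 d.
  by apply/funext => y; rewrite mxE.
rewrite derive_bigsum => [|c]; last exact: differentiable_bigsum.
have -> : forall A B C : 'rV[R]_n, (A + B + C) 0 k = A 0 k + B 0 k + C 0 k.
  by move=> A B C; rewrite !mxE.
rewrite (dchrE oU spdG smoothG) // !mxE -!big_split; apply: eq_bigr => c _ /=.
rewrite derive_bigsum // -!big_split; apply: eq_bigr => d _ /=.
rewrite derive_prod //; last exact: differentiableM.
rewrite derive_prod //.
have -> : 'D_v (fun y => christoffel G k c d (f y)) x = 'D_('D_v f x) (christoffel G k c d) (f x).
  apply: derive_comp => //; exact: (differentiable_christoffel oU spdG smoothG).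
rewrite -(derive_mx_coord v 0 c da) -(derive_mx_coord v 0 d db).
move: ('D_v a x 0 c) ('D_v b x 0 d) ('D_ _ _ _) (christoffel _ _ _ _ _) => *.
by ring.
Qed.

End DeriveChr.

(** * The moving frame equations *)

Section FrameSystem.
Context {R : realType}.
Variable L0 : R.
(* A state stacks the position, the four frame vectors and the pair [(phi, mu)]
   of the conformal factor and its logarithmic derivative. *)
Local Notation state := 'M[R]_(1 + (4 + 1), 4).

(** Matrices of the derivative of the frame in the direction of [u]: [bend]
    rotates the tangent plane, at the speed [mu] imposed by the metric, and
    [twist] contributes curvature 1 and torsion 1. *)
Definition bend : 'M[R]_4 := delta_mx 1 0 - delta_mx 0 1.
Definition twist : 'M[R]_4 :=
  delta_mx 0 2%:R - delta_mx 2%:R 0 + (delta_mx 2%:R 3%:R - delta_mx 3%:R 2%:R).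
Definition conn (m : R) : 'M[R]_4 := twist + m *: bend.

Lemma conn_skew m : (conn m)^T = - conn m.
Proof.
have sb : bend^T = - bend by rewrite /bend linearB /= !trmx_delta opprB.
have st : twist^T = - twist by rewrite /twist linearD !linearB /= !trmx_delta opprD !opprB.
by rewrite /conn linearD linearZ /= sb st scalerN -opprD.
Qed.

Definition pos (Y : state) : 'rV[R]_4 := usubmx Y.
Definition frame (Y : state) : 'M[R]_4 := usubmx (dsubmx Y).
Definition scal (Y : state) : 'rV[R]_4 := dsubmx (dsubmx Y).
Definition phi (Y : state) : R := scal Y 0 0.
Definition mu (Y : state) : R := scal Y 0 1.

Variables (U : set 'rV[R]_4) (G : 'rV[R]_4 -> 'M[R]_4).

Definition chrM (x v : 'rV[R]_4) (E : 'M[R]_4) : 'M[R]_4 := \matrix_a chr G x v (row a E).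

(** The position has velocity [phi *: row 0 (frame Y)]; subtracting the
    connection term turns the prescribed covariant derivatives of the frame into
    ordinary ones. *)
Definition frame_u (Y : state) : state :=
  col_mx (phi Y *: row 0 (frame Y))
    (col_mx (conn (mu Y) *m frame Y - phi Y *: chrM (pos Y) (row 0 (frame Y)) (frame Y)) 0).

Definition frame_v (Y : state) : state :=
  col_mx (phi Y *: row 1 (frame Y))
    (col_mx (- (phi Y *: chrM (pos Y) (row 1 (frame Y)) (frame Y)))
       ((phi Y * mu Y) *: delta_mx 0 0 - (L0 * (phi Y * phi Y)) *: delta_mx 0 1)).

Definition frame_field (i : 'I_2) : state -> state := if i == 0 then frame_u else frame_v.

Section Closure.
Variables (T : Type) (P : (T -> R) -> Prop).
Hypothesis Pc : forall c, P (fun=> c).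
Hypothesis PD : forall f g, P f -> P g -> P (fun t => f t + g t).
Hypothesis PM : forall f g, P f -> P g -> P (fun t => f t * g t).
Variable y : T -> state.
Hypothesis Py : forall a b, P (fun t => y t a b).
Hypothesis PG : forall k i j, P (fun t => christoffel G k i j (pos (y t))).

Let Psum n (f : 'I_n -> T -> R) : (forall i, P (f i)) -> P (fun t => \sum_i f i t).
Proof.
elim: n f => [|n IH] f Pf.
  by rewrite (_ : (fun t => _) = fun=> 0) //; apply/funext => t; rewrite big_ord0.
rewrite (_ : (fun t => _) = fun t => f ord0 t + \sum_i f (lift ord0 i) t).
  by apply: PD => //; exact: IH.
by apply/funext => t; rewrite big_ord_recl.
Qed.

Definition entrywise m n (F : T -> 'M[R]_(m, n)) := forall a b, P (fun t => F t a b).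

Let Ppos : entrywise (fun t => pos (y t)).
Proof. by move=> a b; rewrite (_ : (fun t => _) = fun t => y t (lshift _ a) b) //; apply/funext => t; rewrite mxE. Qed.

Let Pframe : entrywise (fun t => frame (y t)).
Proof.
by move=> a b; rewrite (_ : (fun t => _) = fun t => y t (rshift _ (lshift _ a)) b) //; apply/funext => t; rewrite !mxE.
Qed.

Let Pscal b : P (fun t => scal (y t) 0 b).
Proof.
by rewrite (_ : (fun t => _) = fun t => y t (rshift _ (rshift _ 0)) b) //; apply/funext => t; rewrite !mxE.
Qed.

Let Pcol m1 m2 n (F : T -> 'M[R]_(m1, n)) (H : T -> 'M[R]_(m2, n)) :
  entrywise F -> entrywise H -> entrywise (fun t => col_mx (F t) (H t)).
Proof.
move=> PF PH a b; case: (split_ordP a) => k ->.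
  by rewrite (_ : (fun t => _) = fun t => F t k b) //; apply/funext => t; rewrite col_mxEu.
by rewrite (_ : (fun t => _) = fun t => H t k b) //; apply/funext => t; rewrite col_mxEd.
Qed.

Let Pcst m n (F : 'M[R]_(m, n)) : entrywise (fun=> F).
Proof. by move=> a b; exact: Pc. Qed.

Let Padd m n (F H : T -> 'M[R]_(m, n)) :
  entrywise F -> entrywise H -> entrywise (fun t => F t + H t).
Proof.
move=> PF PH a b; rewrite (_ : (fun t => _) = fun t => F t a b + H t a b); first exact: PD.
by apply/funext => t; rewrite mxE.
Qed.

Let Pscale m n (f : T -> R) (H : T -> 'M[R]_(m, n)) :
  P f -> entrywise H -> entrywise (fun t => f t *: H t).
Proof.
move=> PF PH a b; rewrite (_ : (fun t => _) = fun t => f t * H t a b); first exact: PM.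
by apply/funext => t; rewrite mxE.
Qed.

Let Popp m n (H : T -> 'M[R]_(m, n)) : entrywise H -> entrywise (fun t => - H t).
Proof.
move=> PH; rewrite (_ : (fun t => _) = fun t => (-1) *: H t).
  exact: (@Pscale _ _ (fun=> -1)).
by apply/funext => t; rewrite scaleN1r.
Qed.

Let Pmul m n p (F : T -> 'M[R]_(m, n)) (H : T -> 'M[R]_(n, p)) :
  entrywise F -> entrywise H -> entrywise (fun t => F t *m H t).
Proof.
move=> PF PH a b; rewrite (_ : (fun t => _) = fun t => \sum_k F t a k * H t k b).
  by apply: Psum => k; exact: PM.
by apply/funext => t; rewrite mxE.
Qed.

Let Prow m n (F : T -> 'M[R]_(m, n)) i : entrywise F -> entrywise (fun t => row i (F t)).
Proof.
move=> PF a b; rewrite (_ : (fun t => _) = fun t => F t i b) //.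
by apply/funext => t; rewrite mxE.
Qed.

Let PchrM i : entrywise (fun t => chrM (pos (y t)) (row i (frame (y t))) (frame (y t))).
Proof.
move=> a b; rewrite (_ : (fun t => _) = fun t => \sum_c \sum_d
    christoffel G b c d (pos (y t)) * frame (y t) i c * frame (y t) a d).
  by apply: Psum => c; apply: Psum => d; apply: PM => //; apply: PM.
by apply/funext => t; rewrite !mxE; do 2 (apply: eq_bigr => ? _); rewrite !mxE.
Qed.

(** The entries of the vector fields are polynomials in those of the state and in
    the Christoffel symbols. The two uses of [P] are the existence of uniform
    quadratic expansions and regularity of class C^k along a solution. *)
Lemma frame_field_entrywise i : entrywise (fun t => frame_field i (y t)).
Proof.
have Pphi : P (fun t => phi (y t)) := Pscal 0.
have Pmu : P (fun t => mu (y t)) := Pscal 1.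
rewrite /frame_field; case: ifP => _.
  apply: Pcol; first by apply: Pscale => //; exact: Prow.
  apply: Pcol; last exact: Pcst.
  apply: Padd; last by apply: Popp; exact: Pscale.
  apply: Pmul => //; apply: Padd; first exact: Pcst.
  by apply: Pscale => //; exact: Pcst.
apply: Pcol; first by apply: Pscale => //; exact: Prow.
apply: Pcol; first by apply: Popp; exact: Pscale.
apply: Padd; first by apply: Pscale; [exact: PM|exact: Pcst].
apply: Popp; apply: Pscale; last exact: Pcst.
by apply: PM; [exact: Pc|exact: PM].
Qed.

End Closure.

Hypothesis oU : open U.
Hypothesis spdG : forall x, U x -> spd (G x).
Hypothesis smoothG : forall i j, smooth_on U (fun x => G x i j : R).
Hypothesis curvG : forall x X Y Z, U x ->
  Rm G x X Y Z = L0 *: (ip (G x) Y Z *: X - ip (G x) X Z *: Y).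

Definition orthonormal_state (Y : state) : Prop :=
  frame Y *m G (pos Y) *m (frame Y)^T = 1%:M.

Lemma row_bend (E : 'M[R]_4) a : row a (bend *m E) = (a == 1)%:R *: row 0 E - (a == 0)%:R *: row 1 E.
Proof.
rewrite row_mul /bend linearB /= mulmxBl.
have h (i j : 'I_4) : row a (delta_mx i j) *m E = (a == i)%:R *: row j E.
  apply/rowP => b; rewrite !mxE (bigD1 j) //= big1 => [|k kj].
    by rewrite !mxE eqxx andbT addr0.
  by rewrite !mxE (negbTE kj) andbF mul0r.
by rewrite !h.
Qed.

Lemma conn_row1 m (E : 'M[R]_4) : row 1 (conn m *m E) = m *: row 0 E.
Proof.
rewrite /conn mulmxDl -scalemxAl linearD linearZ /= row_bend /=.
rewrite scale1r scale0r subr0.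
suff -> : row 1 (twist *m E) = 0 by rewrite add0r.
rewrite row_mul (_ : row 1 twist = 0) ?mul0mx //.
by apply/rowP => j; rewrite !mxE /=; ring.
Qed.

Lemma chr_sumr x v m (c : 'I_m -> R) (w : 'I_m -> 'rV[R]_4) :
  chr G x v (\sum_i c i *: w i) = \sum_i c i *: chr G x v (w i).
Proof.
elim: m c w => [|m IH] c w.
  by rewrite !big_ord0 -[X in chr G x v X](scale0r 0) chrZr scale0r.
by rewrite !big_ord_recl chrDr chrZr IH.
Qed.

Lemma row_mul_chrM (M : 'M[R]_4) x v E a :
  row a (M *m chrM x v E) = chr G x v (row a (M *m E)).
Proof.
rewrite !row_mul !mulmx_sum_row chr_sumr.
by apply: eq_bigr => i _; rewrite rowK.
Qed.

Lemma orthonormal_ip Y a b : orthonormal_state Y ->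
  ip (G (pos Y)) (row a (frame Y)) (row b (frame Y)) = (a == b)%:R.
Proof.
by move=> oY; have /matrixP/(_ a b) := oY; rewrite [in X in _ = X]mxE => <-; rewrite mul_ip.
Qed.

Lemma row_chrM x v E a : row a (chrM x v E) = chr G x v (row a E).
Proof. by rewrite rowK. Qed.

Section StateDerivatives.
Variables (Y W : state).

Section Block.
Variables (k : nat) (L : state -> 'M[R]_(k, 4)) (r : 'I_k -> 'I_(1 + (4 + 1))).
Hypothesis LE : forall y i j, L y i j = y (r i) j.

Lemma differentiable_block : differentiable L Y.
Proof.
apply/differentiable_mxP => i j; rewrite (_ : (fun y => _) = fun y : state => y (r i) j).
  exact: differentiable_coord.
by apply/funext => y; rewrite LE.
Qed.

Lemma derive_block : 'D_W L Y = L W.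
Proof.
apply/matrixP => i j; apply: etrans (derive_mx_coord W i j differentiable_block) _.
rewrite (derive_ext (g := fun y : state => y (r i) j)) => [|y]; last by rewrite LE.
by rewrite -(@derive_mx_coord _ _ _ _ id) // derive_id LE.
Qed.

End Block.

Let posE (y : state) i j : pos y i j = y (lshift _ i) j. Proof. by rewrite mxE. Qed.
Let frameE (y : state) i j : frame y i j = y (rshift 1 (lshift 1 i)) j.
Proof. by rewrite !mxE. Qed.
Let scalE (y : state) i j : scal y i j = y (rshift 1 (rshift 4 i)) j.
Proof. by rewrite !mxE. Qed.

Lemma differentiable_pos : differentiable pos Y. Proof. exact: differentiable_block posE. Qed.
Lemma differentiable_frame : differentiable frame Y. Proof. exact: differentiable_block frameE. Qed.
Lemma differentiable_scal : differentiable scal Y. Proof. exact: differentiable_block scalE. Qed.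
Lemma derive_pos : 'D_W pos Y = pos W. Proof. exact: derive_block posE. Qed.
Lemma derive_frame : 'D_W frame Y = frame W. Proof. exact: derive_block frameE. Qed.
Lemma derive_scal : 'D_W scal Y = scal W. Proof. exact: derive_block scalE. Qed.

Lemma differentiable_phi : differentiable phi Y.
Proof. exact: (proj1 (differentiable_mxP _ _) differentiable_scal 0 0). Qed.

Lemma differentiable_mu : differentiable mu Y.
Proof. exact: (proj1 (differentiable_mxP _ _) differentiable_scal 0 1). Qed.

Lemma derive_phi : 'D_W phi Y = phi W.
Proof. by rewrite /phi -derive_scal; apply: esym; apply: derive_mx_coord; exact: differentiable_scal. Qed.

Lemma derive_mu : 'D_W mu Y = mu W.
Proof. by rewrite /mu -derive_scal; apply: esym; apply: derive_mx_coord; exact: differentiable_scal. Qed.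

End StateDerivatives.

Lemma differentiable_chrM (V : normedModType R) (f v : V -> 'rV[R]_4) (E : V -> 'M[R]_4) x :
  U (f x) -> differentiable f x -> differentiable v x -> differentiable E x ->
  differentiable (fun y => chrM (f y) (v y) (E y)) x.
Proof.
move=> Ux df dv dE; apply/differentiable_mxP => a b.
have dr := differentiable_chr_along oU spdG smoothG Ux df dv (differentiable_row a dE).
have /differentiable_mxP/(_ 0 b) := dr.
by apply: near_eq_differentiable; near=> y; rewrite [RHS]mxE.
Unshelve. all: by end_near. Qed.

Lemma derive_chrM (V : normedModType R) (f v : V -> 'rV[R]_4) (E : V -> 'M[R]_4) x w a :
  U (f x) -> differentiable f x -> differentiable v x -> differentiable E x ->
  row a ('D_w (fun y => chrM (f y) (v y) (E y)) x) =
  dchr G (f x) ('D_w f x) (v x) (row a (E x)) + chr G (f x) ('D_w v x) (row a (E x))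
  + chr G (f x) (v x) (row a ('D_w E x)).
Proof.
move=> Ux df dv dE; have dM := differentiable_chrM Ux df dv dE.
rewrite -(derive_row w a dM) -(derive_row w a dE).
rewrite -(derive_chr oU spdG smoothG Ux df dv (differentiable_row a dE)).
by apply: derive_ext => y; rewrite rowK.
Qed.

(** The position blocks agree because the connection is torsion free and the
    tangent part of [conn] is the connection of [phi ^ 2 (du ^ 2 + dv ^ 2)]. The
    frame blocks differ by the curvature of the ambient metric on the first two
    frame vectors and by the derivative of [mu] in [v], which cancel. *)
Lemma frame_field_comm Y : U (pos Y) -> orthonormal_state Y ->
  'D_(frame_u Y) frame_v Y = 'D_(frame_v Y) frame_u Y.
Proof.
move=> UY oY; have sG := spdG UY.
have dp := differentiable_pos Y; have dF := differentiable_frame Y.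
have dphi := differentiable_phi Y; have dmu := differentiable_mu Y.
have dr i : differentiable (fun Y => row i (frame Y)) Y by exact: differentiable_row.
have Dr W i : 'D_W (fun Y => row i (frame Y)) Y = row i (frame W).
  by rewrite derive_row // derive_frame.
have dpr i : differentiable (fun Y => phi Y *: row i (frame Y)) Y by exact: differentiable_scalev.
have Dpr W i : 'D_W (fun Y => phi Y *: row i (frame Y)) Y =
    phi W *: row i (frame Y) + phi Y *: row i (frame W).
  by apply: etrans (derive_scale W dphi (dr i)) _; rewrite Dr derive_phi.
have dM i : differentiable (fun Y => chrM (pos Y) (row i (frame Y)) (frame Y)) Y.
  by apply: differentiable_chrM.
have DM W i a : row a ('D_W (fun Y => chrM (pos Y) (row i (frame Y)) (frame Y)) Y) =
    dchr G (pos Y) (pos W) (row i (frame Y)) (row a (frame Y))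
    + chr G (pos Y) (row i (frame W)) (row a (frame Y))
    + chr G (pos Y) (row i (frame Y)) (row a (frame W)).
  apply: etrans (derive_chrM W a UY dp (dr i) dF) _.
  by rewrite Dr derive_pos derive_frame.
have dpM i := differentiable_scalev dphi (dM i).
have DpM W i : 'D_W (fun Y => phi Y *: chrM (pos Y) (row i (frame Y)) (frame Y)) Y =
    phi W *: chrM (pos Y) (row i (frame Y)) (frame Y) +
    phi Y *: 'D_W (fun Y => chrM (pos Y) (row i (frame Y)) (frame Y)) Y.
  by apply: etrans (derive_scale W dphi (dM i)) _; rewrite derive_phi.
have dcst m n (c : 'M[R]_(m, n)) : differentiable (fun=> c) Y by exact: differentiable_cst.
have dmb := differentiable_scalev dmu (dcst _ _ bend).
have dconn : differentiable (fun Y => conn (mu Y)) Y by exact: differentiableD.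
have Dconn W : 'D_W (fun Y => conn (mu Y)) Y = mu W *: bend.
  apply: etrans (derive_addf W (dcst _ _ twist) dmb) _.
  rewrite derive_cst add0r; apply: etrans (derive_scale W dmu (dcst _ _ bend)) _.
  by rewrite derive_cst scaler0 addr0 derive_mu.
have dconnF := differentiable_mulmx dconn dF.
have DconnF W : 'D_W (fun Y => conn (mu Y) *m frame Y) Y =
    (mu W *: bend) *m frame Y + conn (mu Y) *m frame W.
  by apply: etrans (derive_mulmx W dconn dF) _; rewrite Dconn derive_frame.
have dnM i : differentiable (fun Y => - (phi Y *: chrM (pos Y) (row i (frame Y)) (frame Y))) Y.
  exact: differentiableN.
have du2 : differentiable (fun Y => conn (mu Y) *m frame Y -
    phi Y *: chrM (pos Y) (row 0 (frame Y)) (frame Y)) Y by exact: differentiableD.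
have dpm : differentiable (fun Y => phi Y * mu Y) Y by exact: differentiableM.
have dpp : differentiable (fun Y => L0 * (phi Y * phi Y)) Y.
  by apply: differentiableM => //; exact: differentiableM.
pose s3 (Y : state) : 'rV[R]_4 :=
  (phi Y * mu Y) *: delta_mx 0 0 - (L0 * (phi Y * phi Y)) *: delta_mx 0 1.
have ds1 := differentiable_scalev dpm (dcst 1%N 4%N (delta_mx 0 0)).
have ds2 := differentiable_scalev dpp (dcst 1%N 4%N (delta_mx 0 1)).
have ds3 : differentiable s3 Y by exact: differentiableB.
have posU : pos (frame_u Y) = phi Y *: row 0 (frame Y) by rewrite /pos col_mxKu.
have posV : pos (frame_v Y) = phi Y *: row 1 (frame Y) by rewrite /pos col_mxKu.
have frU : frame (frame_u Y) = conn (mu Y) *m frame Y -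
    phi Y *: chrM (pos Y) (row 0 (frame Y)) (frame Y).
  by rewrite /frame col_mxKd col_mxKu.
have frV : frame (frame_v Y) = - (phi Y *: chrM (pos Y) (row 1 (frame Y)) (frame Y)).
  by rewrite /frame col_mxKd col_mxKu.
have scU : scal (frame_u Y) = 0 by rewrite /scal !col_mxKd.
have scV : scal (frame_v Y) = s3 Y by rewrite /scal !col_mxKd.
have phiU : phi (frame_u Y) = 0 by rewrite /phi scU mxE.
have muU : mu (frame_u Y) = 0 by rewrite /mu scU mxE.
have phiV : phi (frame_v Y) = phi Y * mu Y.
  have -> : phi (frame_v Y) = s3 Y 0 0 by rewrite -scV.
  by rewrite /s3 !mxE /= mulr1 mulr0 subr0.
have muV : mu (frame_v Y) = - (L0 * (phi Y * phi Y)).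
  have -> : mu (frame_v Y) = s3 Y 0 1 by rewrite -scV.
  by rewrite /s3 !mxE /= mulr1 mulr0 sub0r.
have Du : 'D_(frame_v Y) frame_u Y = col_mx
  ('D_(frame_v Y) (fun Y => phi Y *: row 0 (frame Y)) Y)
  (col_mx ('D_(frame_v Y) (fun Y => conn (mu Y) *m frame Y) Y
     - 'D_(frame_v Y) (fun Y => phi Y *: chrM (pos Y) (row 0 (frame Y)) (frame Y)) Y) 0).
  apply: etrans (derive_col_mx _ (dpr 0) (differentiable_col_mx du2 (dcst _ _ _))) _.
  congr col_mx; apply: etrans (derive_col_mx _ du2 (dcst _ _ _)) _.
  rewrite derive_cst; congr col_mx; apply: etrans (derive_addf _ dconnF (dnM 0)) _.
  by congr (_ + _); exact: derive_oppf.
have Dv : 'D_(frame_u Y) frame_v Y = col_mx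
  ('D_(frame_u Y) (fun Y => phi Y *: row 1 (frame Y)) Y)
  (col_mx (- 'D_(frame_u Y) (fun Y => phi Y *: chrM (pos Y) (row 1 (frame Y)) (frame Y)) Y)
     ('D_(frame_u Y) s3 Y)).
  apply: etrans (derive_col_mx _ (dpr 1) (differentiable_col_mx (dnM 1) ds3)) _.
  congr col_mx; apply: etrans (derive_col_mx _ (dnM 1) ds3) _.
  by congr col_mx; exact: derive_oppf.
have Ds3 : 'D_(frame_u Y) s3 Y = 0.
  have dp1 : differentiable (fun Y => phi Y * phi Y) Y by exact: differentiableM.
  have dL : differentiable (fun=> L0 : R) Y by exact: differentiable_cst.
  apply: etrans (derive_addf _ ds1 (differentiableN ds2)) _.
  have -> : 'D_(frame_u Y) (fun Y => (phi Y * mu Y) *: (delta_mx 0 0 : 'rV[R]_4)) Y = 0.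
    apply: etrans (derive_scale _ dpm (dcst _ _ _)) _; rewrite derive_cst scaler0 addr0.
    by rewrite derive_prod // derive_phi derive_mu phiU muU !mulr0 addr0 scale0r.
  rewrite add0r; apply: etrans (derive_oppf _ ds2) _.
  apply/eqP; rewrite oppr_eq0; apply/eqP.
  apply: etrans (derive_scale _ dpp (dcst _ _ _)) _; rewrite derive_cst scaler0 addr0.
  rewrite derive_prod // derive_prod // derive_cst derive_phi phiU.
  by rewrite !(mulr0, addr0) scale0r.
apply: etrans Dv _; apply: etrans _ (esym Du); rewrite Ds3.
have g01 := chrC oU spdG (row 1 (frame Y)) (row 0 (frame Y)) UY.
set F := frame Y in g01 frU frV *.
have rU b : row b (frame (frame_u Y)) =
    row b (conn (mu Y) *m F) - phi Y *: chr G (pos Y) (row 0 F) (row b F).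
  by rewrite frU linearB /= [row b (phi Y *: _)]linearZ /= row_chrM.
have rV b : row b (frame (frame_v Y)) = - (phi Y *: chr G (pos Y) (row 1 F) (row b F)).
  by rewrite frV linearN /= [row b (phi Y *: _)]linearZ /= row_chrM.
apply: (congr2 col_mx).
  rewrite !Dpr phiU phiV scale0r add0r rU rV conn_row1 g01 -/F.
  by move: (chr _ _ _ _) => c; apply/rowP => j; rewrite !mxE; ring.
apply: (congr2 col_mx) => //; apply/row_matrixP => a.
have lhs : row a (- 'D_(frame_u Y) (fun Y => phi Y *: chrM (pos Y) (row 1 (frame Y)) (frame Y)) Y)
  = - (phi Y *: (dchr G (pos Y) (phi Y *: row 0 F) (row 1 F) (row a F)
     + chr G (pos Y) (row 1 (frame (frame_u Y))) (row a F)
     + chr G (pos Y) (row 1 F) (row a (frame (frame_u Y))))).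
  by rewrite DpM phiU scale0r add0r linearN /= [row a (phi Y *: _)]linearZ /= DM posU.
have rhs : row a ('D_(frame_v Y) (fun Y => conn (mu Y) *m frame Y) Y
     - 'D_(frame_v Y) (fun Y => phi Y *: chrM (pos Y) (row 0 (frame Y)) (frame Y)) Y) =
  - (L0 * (phi Y * phi Y)) *: row a (bend *m F) + row a (conn (mu Y) *m frame (frame_v Y))
  - ((phi Y * mu Y) *: chr G (pos Y) (row 0 F) (row a F) +
     phi Y *: (dchr G (pos Y) (phi Y *: row 1 F) (row 0 F) (row a F)
     + chr G (pos Y) (row 0 (frame (frame_v Y))) (row a F)
     + chr G (pos Y) (row 0 F) (row a (frame (frame_v Y))))).
  rewrite linearB /= DconnF muV DpM phiV [row a (_ *m _ + _)]linearD /=.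
  rewrite -scalemxAl [row a (- _ *: _)]linearZ /= [row a (_ *: _ + _)]linearD /=.
  by rewrite [row a (_ *: chrM _ _ _)]linearZ [row a (phi Y *: _)]linearZ /= DM posV row_chrM.
apply: etrans lhs _; apply: etrans _ (esym rhs).
have cv : row a (conn (mu Y) *m frame (frame_v Y)) =
    - (phi Y *: chr G (pos Y) (row 1 F) (row a (conn (mu Y) *m F))).
  by rewrite frV mulmxN -scalemxAr linearN /= [row a (phi Y *: _)]linearZ /= row_mul_chrM.
rewrite cv !rU !rV conn_row1 row_bend.
have rm := curvG (row 0 F) (row 1 F) (row a F) UY.
rewrite !orthonormal_ip // ![_ == a]eq_sym in rm.
move: rm; rewrite /Rm.
set e0 := row 0 F; set e1 := row 1 F; set ea := row a F; set t := row a (conn (mu Y) *m F).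
set x := pos Y; set p := phi Y; set m := mu Y => rm.
have chrN1 u w : chr G x (- u) w = - chr G x u w by rewrite -scaleN1r chrZl scaleN1r.
have chrN2 u w : chr G x u (- w) = - chr G x u w by rewrite -scaleN1r chrZr scaleN1r.
rewrite !(chrDl, chrDr, chrN1, chrN2, chrZl, chrZr) !(dchrZz oU spdG smoothG) // g01.
move: rm.
move: (chr G x e0 ea) (chr G x e1 t) (dchr G x e0 e1 ea) (dchr G x e1 e0 ea)
  (chr G x e0 (chr G x e1 ea)) (chr G x e1 (chr G x e0 ea)) (chr G x (chr G x e0 e1) ea)
  => g4 g5 d1 d2 g1 g2 g3 rm.
clearbody e0 e1 p m.
apply/rowP => j; have := congr1 (fun u : 'rV[R]_4 => u 0 j) rm.
rewrite !mxE; move: (_ == 1) (_ == 0) => b1 b0 E.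
have -> : d2 0 j = d1 0 j + (g1 0 j - g2 0 j) - L0 * (b1%:R * e0 0 j - b0%:R * e1 0 j).
  by rewrite -E; ring.
by ring.
Qed.

End FrameSystem.

(** * Solutions of the moving frame equations *)

(** The moving frame equations, in terms that make sense in any chart of the
    ambient manifold. *)
Record adapted {R : realType} (V : set 'rV[R]_2) (G : 'rV[R]_4 -> 'M[R]_4)
    (f : 'rV[R]_2 -> 'rV[R]_4) (E : 'I_4 -> 'rV[R]_2 -> 'rV[R]_4)
    (p m : 'rV[R]_2 -> R) : Prop := Adapted {
  adapted_map : smooth_on V f;
  adapted_frame : forall a, smooth_on V (E a);
  adapted_ip : forall q a b, V q -> ip (G (f q)) (E a q) (E b q) = (a == b)%:R;
  adapted_u : forall q, V q -> pd 0 f q = p q *: E 0 q;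
  adapted_v : forall q, V q -> pd 1 f q = p q *: E 1 q;
  adapted_cov_u : forall a q, V q ->
    cov G f 0 (E a) q = \sum_b conn (m q) a b *: E b q;
  adapted_cov_v : forall a q, V q -> cov G f 1 (E a) q = 0 }.

(** The equations for the conformal factor [p] and [m], the derivative of [ln p]
    in [v]; the curvature of the metric with this factor is then [L0]. *)
Record warping {R : realType} (L0 : R) (V : set 'rV[R]_2) (p m : 'rV[R]_2 -> R) : Prop :=
  Warping {
  warping_pos : forall q, V q -> 0 < p q;
  warping_smooth : smooth_on V p;
  warping_u : forall q, V q -> pd 0 p q = 0;
  warping_v : forall q, V q -> pd 1 p q = p q * m q;
  bending_v : forall q, V q -> pd 1 m q = - (L0 * (p q * p q)) }.

Section FrameSolution.
Context {R : realType}.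
Variable L0 : R.
Local Notation state := 'M[R]_(1 + (4 + 1), 4).
Variables (U : set 'rV[R]_4) (G : 'rV[R]_4 -> 'M[R]_4).
Hypothesis oU : open U.
Hypothesis spdG : forall x, U x -> spd (G x).
Hypothesis smoothG : forall i j, smooth_on U (fun x => G x i j : R).
Hypothesis curvG : forall x X Y Z, U x ->
  Rm G x X Y Z = L0 *: (ip (G x) Y Z *: X - ip (G x) X Z *: Y).
Local Notation ff := (frame_field L0 G).

Lemma field_frame_field q Y :
  ray_field ff q Y = q 0 0 *: frame_u G Y + q 0 1 *: frame_v L0 G Y.
Proof.
have l1 : lift ord0 ord0 = 1 :> 'I_2 by apply: val_inj.
by rewrite /ray_field /lincomb !big_ord_recl big_ord0 addr0 l1.
Qed.

Lemma chrM_compat x v (E : 'M[R]_4) : U x ->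
  E *m 'D_v G x *m E^T = chrM G x v E *m G x *m E^T + E *m G x *m (chrM G x v E)^T.
Proof.
move=> Ux; apply/matrixP => a b; rewrite [RHS]mxE !mul_ip !row_chrM.
exact: (metric_compat oU spdG smoothG v (row a E) (row b E) Ux).
Qed.

Lemma frame_field_frame q Y : frame (ray_field ff q Y) =
  q 0 0 *: (conn (mu Y) *m frame Y) - chrM G (pos Y) (pos (ray_field ff q Y)) (frame Y).
Proof.
have fD (A B : state) a b : frame (a *: A + b *: B) = a *: frame A + b *: frame B.
  by apply/matrixP => i j; rewrite !mxE.
have pD (A B : state) a b : pos (a *: A + b *: B) = a *: pos A + b *: pos B.
  by apply/matrixP => i j; rewrite !mxE.
rewrite field_frame_field fD pD.
rewrite /frame_u /frame_v /frame /pos !col_mxKd !col_mxKu.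
rewrite -/(frame Y) -/(pos Y).
apply/row_matrixP => a.
have rD (A B : 'M[R]_4) : row a (A + B) = row a A + row a B by rewrite linearD.
have rZ c (A : 'M[R]_4) : row a (c *: A) = c *: row a A by rewrite linearZ.
have rN (A : 'M[R]_4) : row a (- A) = - row a A by rewrite linearN.
rewrite !(rD, rZ, rN) !row_chrM chrDl !chrZl.
move: (row a (_ *m _)) (chr _ _ _ _) (chr _ _ _ _) => A B C.
by apply/rowP => j; rewrite !mxE; ring.
Qed.

Lemma mxtrace_skew n (M : 'M[R]_n) : M^T = - M -> \tr M = 0.
Proof.
move=> sM; have := mxtrace_tr M; rewrite sM linearN /= => /eqP.
by rewrite eq_sym -addr_eq0 -mulr2n mulrn_eq0 => /eqP.
Qed.

Lemma mxtrace_mul_tr_eq0 n (M : 'M[R]_n) : \tr (M *m M^T) = 0 -> M = 0.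
Proof.
move=> H; apply/matrixP => i j; rewrite mxE; apply/eqP.
have sq0 k l : 0 <= M k l * M^T l k by rewrite mxE -expr2 sqr_ge0.
have d0 k : 0 <= (M *m M^T) k k by rewrite mxE sumr_ge0.
have /eqP := H; rewrite /mxtrace psumr_eq0 // => /allP/(_ i (mem_index_enum _))/=.
rewrite mxE psumr_eq0 // => /allP/(_ j (mem_index_enum _))/=.
by rewrite mxE mulf_eq0 orbb.
Qed.

Lemma differentiable_trmx (V : normedModType R) m n (f : V -> 'M[R]_(m, n)) x :
  differentiable f x -> differentiable (fun y => (f y)^T) x.
Proof.
move=> /differentiable_mxP df; apply/differentiable_mxP => a b.
by apply: near_eq_differentiable (df b a); near=> y; rewrite mxE.
Unshelve. all: by end_near. Qed.

Lemma derive_trmx (V : normedModType R) m n (f : V -> 'M[R]_(m, n)) x v :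
  differentiable f x -> 'D_v (fun y => (f y)^T) x = ('D_v f x)^T.
Proof.
move=> df; have dr := differentiable_trmx df; apply/matrixP => a b.
apply: etrans (derive_mx_coord v a b dr) _; rewrite mxE; apply: esym.
apply: etrans (derive_mx_coord v b a df) _.
by apply: derive_ext => y; rewrite mxE.
Qed.

Lemma differentiable_mxtrace (V : normedModType R) n (f : V -> 'M[R]_n) x :
  differentiable f x -> differentiable (fun y => \tr (f y)) x.
Proof. by move=> /differentiable_mxP df; exact: differentiable_bigsum. Qed.

Lemma derive_mxtrace (V : normedModType R) n (f : V -> 'M[R]_n) x v :
  differentiable f x -> 'D_v (fun y => \tr (f y)) x = \tr ('D_v f x).
Proof.
move=> df; have /differentiable_mxP cf := df.
rewrite derive_bigsum //; apply: eq_bigr => i _.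
by rewrite -(derive_mx_coord v i i df).
Qed.

(** [C] is the connection term in the derivative of the frame [E], and
    [C g E^T + E g C^T] the derivative of the metric along the curve. *)
Lemma gram_ode n (c : R) (W E g C : 'M[R]_n) : W^T = - W ->
  (c *: (W *m E) - C) *m g *m E^T + (C *m g *m E^T + E *m g *m C^T)
    + E *m g *m ((c *: (W *m E))^T - C^T) =
  c *: (W *m (E *m g *m E^T - 1%:M) - (E *m g *m E^T - 1%:M) *m W).
Proof.
move=> sW.
have -> : (c *: (W *m E))^T = - (c *: (E^T *m W)).
  by rewrite linearZ /= trmx_mul sW mulmxN scalerN.
rewrite [in RHS]mulmxBr [in RHS]mulmxBl mulmx1 mul1mx !mulmxBl mulmxBr.
rewrite mulmxN -!scalemxAl -scalemxAr !mulmxA.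
move: (W *m E *m g *m E^T) (E *m g *m E^T *m W) => A B.
move: (C *m g *m E^T) (E *m g *m C^T) => X Y.
by apply/matrixP => i j; rewrite !mxE; ring.
Qed.

(** The Gram matrix [H] of the frame along a solution satisfies the linear
    equation [H' = c (W H - H W)] with [W] skew, so that the squared distance
    from [H] to the identity is constant. *)
Lemma orthonormal_invariant q (X : R -> state) : orthonormal_state G (X 0) ->
  (forall t : R, 0 <= t <= 1 -> U (pos (X t)) /\ is_derive t 1 X (ray_field ff q (X t))) ->
  forall t : R, 0 <= t <= 1 -> orthonormal_state G (X t).
Proof.
move=> o0 HX t t01.
pose E s := frame (X s); pose g s := G (pos (X s)).
pose d s := E s *m g s *m (E s)^T - 1%:M.
pose e s := \tr (d s *m (d s)^T).
have De (s : R) : 0 <= s <= 1 -> differentiable e s /\ 'D_1 e s = 0.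
  move=> s01; have [Us [dX XE]] := HX s s01.
  have dXs : differentiable X s by apply/derivable1_diffP.
  have dpos := @differentiable_pos R (X s); have dfr := @differentiable_frame R (X s).
  have dE : differentiable E s by exact: (@differentiable_comp _ _ _ _ X frame).
  have DE : 'D_1 E s = frame (ray_field ff q (X s)).
    by rewrite -XE -(derive_frame (X s)); exact: (@derive_comp _ _ _ _ X frame).
  have dp : differentiable (fun s => pos (X s)) s by exact: (@differentiable_comp _ _ _ _ X pos).
  have Dp : 'D_1 (fun s => pos (X s)) s = pos (ray_field ff q (X s)).
    by rewrite -XE -(derive_pos (X s)); exact: (@derive_comp _ _ _ _ X pos).
  have dG := metric_differentiable smoothG Us.
  have dg : differentiable g s by exact: (@differentiable_comp _ _ _ _ (fun s => pos (X s)) G).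
  have Dg : 'D_1 g s = 'D_(pos (ray_field ff q (X s))) G (pos (X s)).
    by rewrite -Dp; exact: (@derive_comp _ _ _ _ (fun s => pos (X s)) G).
  have dEg := differentiable_mulmx dE dg; have dEt := differentiable_trmx dE.
  have dH := differentiable_mulmx dEg dEt.
  have d1 : differentiable (fun=> - 1%:M : 'M[R]_4) s by exact: differentiable_cst.
  have dd : differentiable d s by exact: differentiableD.
  have Dd : 'D_1 d s = q 0 0 *: (conn (mu (X s)) *m d s - d s *m conn (mu (X s))).
    have a1 : 'D_1 d s = _ := derive_addf (1 : R) dH d1.
    have a2 := derive_mulmx (1 : R) dEg dEt.
    rewrite a1 derive_cst addr0; apply: etrans a2 _.
    rewrite (derive_mulmx (1 : R) dE dg) (derive_trmx (1 : R) dE) DE Dg mulmxDl chrM_compat //.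
    rewrite frame_field_frame -/(E s) -/(g s) /d.
    move: (chrM _ _ _ _) => C; move: (mu _) => m.
    have tB (A B : 'M[R]_4) : (A - B)^T = A^T - B^T by rewrite linearB.
    rewrite tB; exact: gram_ode (conn_skew m).
  have ddt := differentiable_trmx dd; have dddt := differentiable_mulmx dd ddt.
  split; first exact: differentiable_mxtrace.
  apply: etrans (derive_mxtrace (1 : R) dddt) _.
  rewrite (derive_mulmx (1 : R) dd ddt) (derive_trmx (1 : R) dd) linearD /=.
  have -> : \tr (d s *m ('D_1 d s)^T) = \tr ('D_1 d s *m (d s)^T).
    by rewrite -mxtrace_tr trmx_mul trmxK.
  suff -> : \tr ('D_1 d s *m (d s)^T) = 0 by rewrite addr0.
  rewrite Dd -scalemxAl linearZ /= mulmxBl linearB /= -mulmxA mxtrace_mulC.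
  have sk (M N : 'M[R]_4) : N^T = - N -> \tr (M *m N *m M^T) = 0.
    move=> sN; apply: mxtrace_skew.
    by rewrite !trmx_mul trmxK sN mulNmx mulmxN mulmxA.
  have e1 : \tr (d s *m (d s)^T *m conn (mu (X s))) = 0.
    rewrite -mulmxA mxtrace_mulC; have := sk (d s)^T (conn (mu (X s))) (conn_skew _).
    by rewrite trmxK.
  by rewrite e1 sk ?conn_skew // subrr mulr0.
have e0 : e 0 = 0.
  have -> : e 0 = \tr (d 0 *m (d 0)^T) by [].
  have -> : d 0 = 0 by rewrite /d /E /g o0 subrr.
  by rewrite mul0mx mxtrace0.
have [c c01] : exists2 c : R, 0 <= c <= 1 & e (0 + t) - e 0 = 'D_t e (0 + c *: t).
  apply: MVT_line => s /andP[s0 s1]; apply: (proj1 (De _ _)).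
  case/andP: t01 => t0 t1; rewrite add0r mulr_ge0 //=.
  by apply: (le_trans _ t1); rewrite ler_piMl.
rewrite add0r e0 subr0 add0r => et.
have ct : 0 <= c *: t <= 1.
  case/andP: t01 => t0 t1; case/andP: c01 => c0 c1; rewrite mulr_ge0 //=.
  by apply: (le_trans _ t1); rewrite ler_piMl.
have [dec Dec] := De _ ct.
have : e t = 0.
  rewrite et -[t in 'D_t _ _]mulr1.
  by apply: etrans (derive_scalev t (1 : R) dec) _; rewrite Dec scaler0.
move=> /mxtrace_mul_tr_eq0 /eqP; rewrite subr_eq0 => /eqP; exact.
Qed.

Lemma christoffel_radius x0 : U x0 -> exists2 r : R, 0 < r &
  ball x0 r `<=` U /\ forall k i j, quad_approx (ball x0 r) (christoffel G k i j).
Proof.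
move=> Ux0.
have H (k i j : 'I_4) := quad_approx_C2 oU Ux0 (smooth_christoffel oU spdG smoothG k i j 2%N).
pose P k i j (r : R) := ball x0 r `<=` U /\ quad_approx (ball x0 r) (christoffel G k i j).
have mono k i j (r r' : R) : 0 < r' -> r' <= r -> P k i j r -> P k i j r'.
  move=> _ rr [h1 h2]; have s := ball_sub (x0 := x0) rr.
  by split; [apply: subset_trans h1|exact: quad_approx_sub h2].
have [[[k i] j] r r'|[[k i] j]|r r0 Hr] :=
  @common_radius R ('I_4 * 'I_4 * 'I_4)%type (fun k r => P k.1.1 k.1.2 k.2 r).
- exact: mono.
- exact: H.
exists r => //; split; first by have [h _] := Hr (0, 0, 0).
by move=> k i j; have [_ h] := Hr (k, i, j).
Qed.

Lemma pos_norm (Y : state) : `|pos Y| <= `|Y|.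
Proof. by apply: mx_norm_le => // i j; rewrite mxE; exact: mx_norm_coord. Qed.

Lemma frame_solution_exists x0 : U x0 -> exists2 rho : R, 0 < rho &
  exists Y : 'rV[R]_2 -> state, forall q, `|q| < rho ->
    [/\ U (pos (Y q)), orthonormal_state G (Y q), 0 < phi (Y q),
       differentiable Y q & forall i, pd i Y q = ff i (Y q)].
Proof.
move=> Ux0; have [r1 r10 [rU rq]] := christoffel_radius Ux0.
have [E0 HE0] := spd_orthonormal (spdG Ux0) (leqnn 4).
pose Y0 : state := col_mx x0 (col_mx E0 (delta_mx 0 0)).
(* [phi] starts at 1 and stays positive within distance 1/2. *)
pose r := Num.min r1 2^-1.
have r0 : 0 < r by rewrite lt_min r10 invr_gt0 ltr0n.
have pY0 : pos Y0 = x0 by rewrite /pos col_mxKu.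
have DU Y : ball Y0 r Y -> ball x0 r1 (pos Y).
  rewrite -!ball_normE /= => h; rewrite -pY0.
  have -> : pos Y0 - pos Y = pos (Y0 - Y) by apply/matrixP => i j; rewrite !mxE.
  by apply: (le_lt_trans (pos_norm _)); apply: (lt_le_trans h); rewrite ge_min lexx.
have bD : exists B, forall Y, ball Y0 r Y -> `|Y| <= B.
  exists (`|Y0| + r) => Y; rewrite -ball_normE /= => h.
  by have := ler_normB Y0 (Y0 - Y); rewrite subKr; lra.
have qA : forall i a b, quad_approx (ball Y0 r) (fun Y => ff i Y a b).
  move=> i; apply: (@frame_field_entrywise R L0 G state (quad_approx (ball Y0 r))).
  - exact: quad_approx_cst.
  - exact: quad_approxD.
  - by move=> f g; exact: quad_approxM.
  - by move=> a b; exact: quad_approx_coord.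
  move=> k i' j.
  have cu : continuous (usubmx : state -> 'rV[R]_4).
    apply: (@lipschitz_continuous _ _ _ _ 1) => A B; rewrite mul1r -linearB.
    exact: pos_norm.
  apply: (@quad_approx_comp _ _ _ _ (ball x0 r1)
    (GRing.Linear.clone _ _ _ _ (usubmx : state -> 'rV[R]_4) _)) => //.
  exact: pos_norm.
have comm i j X : ball Y0 r X -> orthonormal_state G X ->
    'D_(ff i X) (ff j) X = 'D_(ff j X) (ff i) X.
  move=> /DU/rU UX oX; rewrite /frame_field.
  have c := frame_field_comm oU spdG smoothG curvG UX oX.
  case: (i == 0); case: (j == 0).
  - reflexivity.
  - exact c.
  - exact (esym c).
  reflexivity.
have inv (q : 'rV[R]_2) (X : R -> state) : X 0 = Y0 ->
    (forall t : R, 0 <= t <= 1 -> ball Y0 r (X t) /\ is_derive t 1 X (ray_field ff q (X t))) ->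
    forall t : R, 0 <= t <= 1 -> orthonormal_state G (X t).
  move=> X0 H; apply: (@orthonormal_invariant q).
    by rewrite X0 /orthonormal_state /frame pY0 col_mxKd col_mxKu.
  by move=> t t01; have [h1 h2] := H t t01; split=> //; apply/rU/DU.
have [rho rho0 [Y [_ HY]]] := frobenius r0 qA comm inv.
exists rho => //; exists Y => q qr; have [DY oY dY YE] := HY q qr.
split=> //; first exact/rU/DU.
have phi0 : phi Y0 = 1 by rewrite /phi /scal !col_mxKd mxE.
have : `|phi Y0 - phi (Y q)| < 2^-1.
  have -> : phi Y0 - phi (Y q) = (Y0 - Y q) (rshift 1 (rshift 4 0)) 0.
    by rewrite /phi /scal !mxE.
  apply: (le_lt_trans (mx_norm_coord _ _ _)); move: DY; rewrite -ball_normE /=.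
  by move=> h; apply: (lt_le_trans h); rewrite ge_min lexx orbT.
by rewrite phi0 ltr_norml => /andP[_]; lra.
Qed.

Section Regularity.
Variables (V : set 'rV[R]_2) (Y : 'rV[R]_2 -> state).
Hypothesis oV : open V.
Hypothesis YU : forall q, V q -> U (pos (Y q)).
Hypothesis dY : forall q, V q -> differentiable Y q.
Hypothesis YE : forall q i, V q -> pd i Y q = ff i (Y q).

(** Bootstrapping: the right-hand sides are as regular as the solution. *)
Lemma frame_solution_smooth a b : smooth_on V (fun q => Y q a b : R).
Proof.
move=> k; elim: k a b => [|k IH] a b.
  move=> q Vq; apply: differentiable_continuous.
  by have /differentiable_mxP := dY Vq.
split=> [q Vq|i]; first by have /differentiable_mxP := dY Vq.
have Cf : Ck k V (fun q => ff i (Y q) a b : R).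
  apply: (@frame_field_entrywise R L0 G _ (Ck k V)) => //.
  - by move=> c; exact: Ck_cst.
  - by move=> f g; exact: Ck_add.
  - by move=> f g; exact: Ck_mul.
  move=> c i' j.
  have Cp : Ck k V (fun q => pos (Y q)).
    apply/Ck_mxP => // i1 j1; apply: Ck_eq (IH (lshift _ i1) j1) => // q _.
    by rewrite mxE.
  exact: (@Ck_comp _ _ _ k V U (fun q => pos (Y q)) (christoffel G c i' j) oV YU Cp
    (smooth_christoffel oU spdG smoothG _ _ _ k)).
apply: Ck_eq Cf => // q Vq; rewrite -(YE i Vq).
exact: (derive_mx_coord (delta_mx 0 i) a b (dY Vq)).
Qed.

Hypothesis YO : forall q, V q -> orthonormal_state G (Y q).
Hypothesis Yphi : forall q, V q -> 0 < phi (Y q).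

Lemma pd_block m (L : state -> 'rV[R]_m) (i : 'I_2) q : V q ->
  (forall Z, differentiable L Z) -> (forall Z W, 'D_W L Z = L W) ->
  pd i (fun q => L (Y q)) q = L (ff i (Y q)).
Proof.
move=> Vq dL DL; rewrite -(YE i Vq) -(DL (Y q)).
exact: (@derive_comp _ _ _ _ Y L _ _ (dY Vq) (dL _)).
Qed.

Lemma warping_frame_solution : warping L0 V (fun q => phi (Y q)) (fun q => mu (Y q)).
Proof.
have Ephi : (fun q => phi (Y q)) = fun q => Y q (rshift 1 (rshift 4 0)) 0.
  by apply/funext => q; rewrite /phi /scal !mxE.
have Dphi i q : V q -> pd i (fun q => phi (Y q)) q = phi (ff i (Y q)).
  move=> Vq; rewrite -(YE i Vq) -(derive_phi (Y q)).
  exact: (@derive_comp _ _ _ _ Y phi _ _ (dY Vq) (differentiable_phi _)).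
have Dmu i q : V q -> pd i (fun q => mu (Y q)) q = mu (ff i (Y q)).
  move=> Vq; rewrite -(YE i Vq) -(derive_mu (Y q)).
  exact: (@derive_comp _ _ _ _ Y mu _ _ (dY Vq) (differentiable_mu _)).
split.
- exact: Yphi.
- by rewrite Ephi; exact: frame_solution_smooth.
- by move=> q Vq; rewrite Dphi // /frame_field /frame_u /phi /scal !col_mxKd mxE.
- move=> q Vq; rewrite Dphi // /frame_field /frame_v {1}/phi /scal !col_mxKd -/(scal _).
  by rewrite !mxE /= mulr1 mulr0 subr0.
move=> q Vq; rewrite Dmu // /frame_field /frame_v {1}/mu /scal !col_mxKd -/(scal _).
by rewrite !mxE /= mulr1 mulr0 sub0r.
Qed.

Lemma adapted_frame_solution : adapted V G (fun q => pos (Y q))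
  (fun a q => row a (frame (Y q))) (fun q => phi (Y q)) (fun q => mu (Y q)).
Proof.
have Dp i q : V q -> pd i (fun q => pos (Y q)) q = pos (ff i (Y q)).
  move=> Vq; apply: (@pd_block 4 pos) => //; [exact: differentiable_pos|].
  by move=> Z W; exact: derive_pos.
have Dr a i q : V q -> pd i (fun q => row a (frame (Y q))) q = row a (frame (ff i (Y q))).
  move=> Vq; apply: (@pd_block 4 (fun Z => row a (frame Z))) => //.
    by move=> Z; apply: differentiable_row; exact: differentiable_frame.
  by move=> Z W; rewrite derive_row ?derive_frame //; exact: differentiable_frame.
have rE (A B : 'M[R]_4) a : row a (A - B) = row a A - row a B by rewrite linearB.
have rZ c (A : 'M[R]_4) a : row a (c *: A) = c *: row a A by rewrite linearZ.
have rN (A : 'M[R]_4) a : row a (- A) = - row a A by rewrite linearN.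
have covE i a q : cov G (fun q => pos (Y q)) i (fun q => row a (frame (Y q))) q =
    pd i (fun q => row a (frame (Y q))) q +
    chr G (pos (Y q)) (pd i (fun q => pos (Y q)) q) (row a (frame (Y q))) by [].
have pu Z : pos (ff 0 Z) = phi Z *: row 0 (frame Z) by rewrite /frame_field /pos col_mxKu.
have pv Z : pos (ff 1 Z) = phi Z *: row 1 (frame Z) by rewrite /frame_field /pos col_mxKu.
split.
- move=> k; apply/Ck_mxP => // i j.
  apply: Ck_eq (@frame_solution_smooth (lshift _ i) j k) => // q _.
  by rewrite mxE.
- move=> a k; apply/Ck_mxP => // i j.
  apply: Ck_eq (@frame_solution_smooth (rshift 1 (lshift 1 a)) j k) => // q _.
  by rewrite !mxE.
- by move=> q a b Vq; exact: orthonormal_ip (YO Vq).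
- by move=> q Vq; rewrite Dp // pu.
- by move=> q Vq; rewrite Dp // pv.
- move=> a q Vq; rewrite covE Dr // Dp // pu chrZl /frame_field /=.
  rewrite {1}/frame_u {1}/frame col_mxKd col_mxKu rE rZ row_chrM subrK.
  by rewrite row_mul mulmx_sum_row; apply: eq_bigr => b _; rewrite mxE.
move=> a q Vq; rewrite covE Dr // Dp // pv chrZl /frame_field /=.
by rewrite {1}/frame_v {1}/frame col_mxKd col_mxKu rN rZ row_chrM addNr.
Qed.

End Regularity.

End FrameSolution.

(** * Geometry of a surface with an adapted frame *)

Section Sums.
Context {R : realType}.

Lemma big_ord2 (W : zmodType) (F : 'I_2 -> W) : \sum_i F i = F 0 + F 1.
Proof.
have l1 : lift ord0 ord0 = 1 :> 'I_2 by apply: val_inj.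
by rewrite !big_ord_recl big_ord0 addr0 l1.
Qed.

Lemma big_ord4 (W : zmodType) (F : 'I_4 -> W) :
  \sum_i F i = F 0 + F 1 + F 2%:R + F 3%:R.
Proof.
rewrite !big_ord_recl big_ord0 addr0 !addrA; congr (_ + F _ + F _ + F _);
by apply: val_inj.
Qed.

Lemma scalar_mx_sum n (W : lmodType R) (c : R) (x : 'I_n -> R) (T : 'I_n -> W) :
  \sum_i \sum_j ((c%:M : 'M[R]_n) i j * x j) *: T i = \sum_i (c * x i) *: T i.
Proof.
apply: eq_bigr => i _; rewrite (bigD1 i) //= big1 => [|j ji].
  by rewrite mxE eqxx addr0.
by rewrite mxE eq_sym (negbTE ji) mul0r scale0r.
Qed.

End Sums.

Section AdaptedGeometry.
Context {R : realType}.
Variables (L0 : R) (U : set 'rV[R]_4) (G : 'rV[R]_4 -> 'M[R]_4).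
Hypothesis oU : open U.
Hypothesis spdG : forall x, U x -> spd (G x).
Hypothesis smoothG : forall i j, smooth_on U (fun x => G x i j : R).
Variables (V : set 'rV[R]_2) (f : 'rV[R]_2 -> 'rV[R]_4).
Hypothesis oV : open V.
Hypothesis fU : forall q, V q -> U (f q).
Variables (E : 'I_4 -> 'rV[R]_2 -> 'rV[R]_4) (p m : 'rV[R]_2 -> R).
Hypothesis adE : adapted V G f E p m.
Hypothesis wpm : warping L0 V p m.
Local Notation g q := (G (f q)).

Lemma smooth_differentiable k (W : normedModType R) (A : set 'rV[R]_k) (h : 'rV[R]_k -> W) x :
  smooth_on A h -> A x -> differentiable h x.
Proof. by move=> s Ax; have [d _] := s 1%N; exact: d. Qed.

Lemma near_V (W : set 'rV[R]_2) q (P : 'rV[R]_2 -> Prop) : open W -> W q ->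
  (forall y, W y -> P y) -> \forall y \near q, P y.
Proof. by move=> oW Wq H; apply: filterS H _; exact: open_nbhs_nbhs. Qed.

Let dfq q : V q -> differentiable f q.
Proof. exact: smooth_differentiable (adapted_map adE). Qed.

Let dEq a q : V q -> differentiable (E a) q.
Proof. exact: smooth_differentiable (adapted_frame adE a). Qed.

Let symg q v w : V q -> ip (g q) v w = ip (g q) w v.
Proof. move=> Vq; exact (spd_sym (spdG (fU Vq)) v w). Qed.

Lemma cov_metric (i : 'I_2) (xi eta : 'rV[R]_2 -> 'rV[R]_4) q : V q ->
  differentiable xi q -> differentiable eta q ->
  pd i (fun q => ip (g q) (xi q) (eta q)) q =
  ip (g q) (cov G f i xi q) (eta q) + ip (g q) (xi q) (cov G f i eta q).
Proof.
move=> Vq dxi deta; have Uq := fU Vq; have dq := dfq Vq.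
have dG := metric_differentiable smoothG Uq.
have dGf : differentiable (fun q => g q) q by exact: (@differentiable_comp _ _ _ _ f G).
have e1 := derive_ip (delta_mx 0 i) dGf dxi deta.
have e2 : 'D_(delta_mx 0 i) (fun q => g q) q = 'D_(pd i f q) G (f q).
  exact: (@derive_comp _ _ _ _ f G).
have e3 := metric_compat oU spdG smoothG (pd i f q) (xi q) (eta q) Uq.
have c1 : ip (g q) (cov G f i xi q) (eta q) = ip (g q) (pd i xi q) (eta q)
    + ip (g q) (chr G (f q) (pd i f q) (xi q)) (eta q) := ipDl _ _ _ _.
have c2 : ip (g q) (xi q) (cov G f i eta q) = ip (g q) (xi q) (pd i eta q)
    + ip (g q) (xi q) (chr G (f q) (pd i f q) (eta q)) := ipDr _ _ _ _.
apply: etrans e1 _; rewrite -> c1; rewrite -> c2; rewrite -> e2; rewrite -> e3.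
by rewrite /pd; gen_ip => *; ring.
Qed.

Lemma frame_expand q w : V q -> w = \sum_a ip (g q) w (E a q) *: E a q.
Proof.
move=> Vq; pose F : 'M[R]_4 := \matrix_a E a q.
have FF : F *m g q *m F^T = 1%:M.
  apply/matrixP => a b; rewrite mul_ip !rowK (adapted_ip adE) //.
  by rewrite [RHS]mxE.
have GF : g q *m F^T *m F = 1%:M by apply: mulmx1C; rewrite mulmxA.
rewrite -[LHS]mulmx1 -GF !mulmxA mulmx_sum_row; apply: eq_bigr => a _; rewrite rowK.
congr (_ *: _); rewrite [LHS]mxE ip_mulmx [RHS]mxE; apply: eq_bigr => k _.
by rewrite !mxE.
Qed.

Let idx (i : 'I_2) : 'I_4 := if i == 0 then 0 else 1.

Lemma tangent i q : V q -> tvec f i q = p q *: E (idx i) q.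
Proof.
move=> Vq; rewrite /idx /tvec; case: (eqVneq i 0) => [->|i0].
  exact: (adapted_u adE).
have -> : i = 1 by apply: val_inj; case: i i0 => [[|[|]]].
exact: (adapted_v adE).
Qed.

Lemma idx_eq i j : (idx i == idx j) = (i == j).
Proof. by case: i => [[|[|//]] hi]; case: j => [[|[|//]] hj]. Qed.

Lemma induced_conformal q : V q -> induced G f q = (p q ^+ 2)%:M.
Proof.
move=> Vq; apply/matrixP => i j; rewrite !mxE /fprod !tangent // ipZl ipZr.
rewrite (adapted_ip adE) // idx_eq mulrA -expr2.
by rewrite mulr_natr.
Qed.

Lemma nor_frame q w : V q -> nor G f q w =
  ip (g q) w (E 2%:R q) *: E 2%:R q + ip (g q) w (E 3%:R q) *: E 3%:R q.
Proof.
move=> Vq; have p0 : p q != 0 by apply: lt0r_neq0; exact: (warping_pos wpm).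
rewrite /nor induced_conformal // invmx_scalar.
have -> : \sum_(i < 2) \sum_(j < 2) (((p q ^+ 2)^-1)%:M i j * fprod G f q (tvec f j q) w) *: tvec f i q
   = ip (g q) w (E 0 q) *: E 0 q + ip (g q) w (E 1 q) *: E 1 q.
  apply: etrans (scalar_mx_sum _ (fun j => fprod G f q (tvec f j q) w) (fun i => tvec f i q)) _.
  have tt i : ((p q ^+ 2)^-1 * fprod G f q (tvec f i q) w) *: tvec f i q =
      ip (g q) w (E (idx i) q) *: E (idx i) q.
    rewrite tangent // /fprod ipZl scalerA (symg _ _ Vq); congr (_ *: _).
    by move: (ip _ _ _) => c; field.
  by apply: etrans (big_ord2 _) (congr2 +%R (tt 0) (tt 1)).
rewrite {1}(frame_expand w Vq) big_ord4.
move: (ip _ _ _ *: _) (ip _ _ _ *: _) (ip _ _ _ *: _) (ip _ _ _ *: _) => A B C D.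
by apply/rowP => i; rewrite !mxE; ring.
Qed.

Lemma normal_frameP q w : V q -> normal G f q w <->
  ip (g q) w (E 0 q) = 0 /\ ip (g q) w (E 1 q) = 0.
Proof.
move=> Vq; have p0 : p q != 0 by apply: lt0r_neq0; exact: (warping_pos wpm).
split=> [H|[h0 h1] i].
  have := H 0; have := H 1; rewrite /fprod !tangent // !ipZl => /eqP.
  rewrite mulf_eq0 (negbTE p0) /= => /eqP h1 /eqP.
  rewrite mulf_eq0 (negbTE p0) /= => /eqP h0.
  by rewrite !(symg w _ Vq).
rewrite /fprod tangent // ipZl (symg _ _ Vq) /idx.
by case: ifP => _; rewrite ?h0 ?h1 mulr0.
Qed.

Lemma conn_rows q : let s := fun a => \sum_b conn (m q) a b *: E b q in
  [/\ s 0 = E 2%:R q - m q *: E 1 q, s 2%:R = E 3%:R q - E 0 q & s 3%:R = - E 2%:R q].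
Proof.
rewrite /= !big_ord4 /conn /twist /bend; split; rewrite !mxE /=;
move: (E 0 q) (E 1 q) (E 2%:R q) (E 3%:R q) => e0 e1 e2 e3;
by apply/rowP => j; rewrite !mxE; ring.
Qed.

Local Notation comp xi a := (fun q => ip (g q) (xi q) (E a q)).

Lemma ip_cov i (xi : 'rV[R]_2 -> 'rV[R]_4) q a : V q -> differentiable xi q ->
  ip (g q) (cov G f i xi q) (E a q) = pd i (comp xi a) q - ip (g q) (xi q) (cov G f i (E a) q).
Proof.
move=> Vq dxi; have e := cov_metric i Vq dxi (dEq a Vq).
by rewrite -> e; gen_ip => *; ring.
Qed.

Lemma comp_cov_u (xi : 'rV[R]_2 -> 'rV[R]_4) q : V q ->
  [/\ ip (g q) (xi q) (cov G f 0 (E 0) q) = comp xi 2%:R q - m q * comp xi 1 q,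
      ip (g q) (xi q) (cov G f 0 (E 2%:R) q) = comp xi 3%:R q - comp xi 0 q
    & ip (g q) (xi q) (cov G f 0 (E 3%:R) q) = - comp xi 2%:R q].
Proof.
move=> Vq; have [e0 e2 e3] := conn_rows q.
split.
- by rewrite (adapted_cov_u adE 0 Vq) e0 ipDr ipNr ipZr.
- by rewrite (adapted_cov_u adE 2%:R Vq) e2 ipDr ipNr.
by rewrite (adapted_cov_u adE 3%:R Vq) e3 ipNr.
Qed.

Lemma ncov_u (xi : 'rV[R]_2 -> 'rV[R]_4) q : V q -> differentiable xi q ->
  normal G f q (xi q) -> ncov G f 0 xi q =
  (pd 0 (comp xi 2%:R) q - comp xi 3%:R q) *: E 2%:R q
  + (pd 0 (comp xi 3%:R) q + comp xi 2%:R q) *: E 3%:R q.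
Proof.
move=> Vq dxi /(normal_frameP _ Vq)[n0 n1]; have [_ e2 e3] := comp_cov_u xi Vq.
rewrite /ncov nor_frame //; apply: (congr2 +%R).
  congr (_ *: _); apply: etrans (ip_cov 0 2%:R Vq dxi) _.
  by rewrite -> e2; rewrite -> n0; rewrite subr0.
congr (_ *: _); apply: etrans (ip_cov 0 3%:R Vq dxi) _.
by rewrite -> e3; rewrite opprK.
Qed.

Lemma ncov_v (xi : 'rV[R]_2 -> 'rV[R]_4) q : V q -> differentiable xi q ->
  ncov G f 1 xi q =
  pd 1 (comp xi 2%:R) q *: E 2%:R q + pd 1 (comp xi 3%:R) q *: E 3%:R q.
Proof.
move=> Vq dxi; rewrite /ncov nor_frame //; apply: (congr2 +%R); congr (_ *: _).
  apply: etrans (ip_cov 1 2%:R Vq dxi) _.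
  by rewrite (adapted_cov_v adE 2%:R Vq) ip0r subr0.
apply: etrans (ip_cov 1 3%:R Vq dxi) _.
by rewrite (adapted_cov_v adE 3%:R Vq) ip0r subr0.
Qed.

Lemma smooth_comp_frame (W : set 'rV[R]_2) (xi : 'rV[R]_2 -> 'rV[R]_4) a :
  open W -> W `<=` V -> smooth_on W xi -> smooth_on W (comp xi a : 'rV[R]_2 -> R).
Proof.
move=> oW WV sxi k; apply: Ck_ip => //; last exact: Ck_sub WV (adapted_frame adE a k).
move=> i j; apply: (@Ck_comp _ _ _ k W U f (fun x => G x i j)) => //.
- by move=> q /WV; exact: fU.
- exact: Ck_sub WV (adapted_map adE k).
exact: smoothG.
Qed.

(** The components of the field in the parallel normal frame obtained by
    rotating [E 2], [E 3] would differentiate like scalars; in the frame itself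
    an extra rotation term appears, which commutes with both derivatives. *)
Lemma adapted_ncurv (W : set 'rV[R]_2) (xi : 'rV[R]_2 -> 'rV[R]_4) q :
  open W -> W `<=` V -> normal_field G f W xi -> W q -> ncurv G f xi q = 0.
Proof.
move=> oW WV [sxi nxi] Wq; have Vq := WV _ Wq.
pose a := comp xi 2%:R : 'rV[R]_2 -> R; pose b := comp xi 3%:R : 'rV[R]_2 -> R.
have sa : smooth_on W a by exact: smooth_comp_frame.
have sb : smooth_on W b by exact: smooth_comp_frame.
have spd1 (h : 'rV[R]_2 -> R) i : smooth_on W h -> smooth_on W (pd i h).
  by move=> sh k; have [_ H] := sh k.+1; exact: H.
have dW (h : 'rV[R]_2 -> R) y : smooth_on W h -> W y -> differentiable h y.
  exact: smooth_differentiable.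
have dxi y : W y -> differentiable xi y by exact: smooth_differentiable.
pose a0 y := pd 0 a y - b y; pose b0 y := pd 0 b y + a y.
have E0 y : W y -> ncov G f 0 xi y = a0 y *: E 2%:R y + b0 y *: E 3%:R y.
  by move=> Wy; exact: ncov_u (WV _ Wy) (dxi _ Wy) (nxi _ Wy).
have E1 y : W y -> ncov G f 1 xi y = pd 1 a y *: E 2%:R y + pd 1 b y *: E 3%:R y.
  by move=> Wy; exact: ncov_v (WV _ Wy) (dxi _ Wy).
have comps (c d : 'rV[R]_2 -> R) y : V y -> let eta := c y *: E 2%:R y + d y *: E 3%:R y in
   [/\ ip (g y) eta (E 0 y) = 0, ip (g y) eta (E 1 y) = 0,
     ip (g y) eta (E 2%:R y) = c y & ip (g y) eta (E 3%:R y) = d y].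
  by move=> Vy /=; split; rewrite ipDl !ipZl !(adapted_ip adE) //= ?mulr0 ?mulr1 ?addr0 ?add0r.
have dfr (c d : 'rV[R]_2 -> R) : differentiable c q -> differentiable d q ->
    differentiable (fun y => c y *: E 2%:R y + d y *: E 3%:R y) q.
  by move=> dc dd; apply: differentiableD; apply: differentiable_scalev => //; exact: dEq.
have dpa i : differentiable (pd i a) q by apply: dW => //; exact: spd1.
have dpb i : differentiable (pd i b) q by apply: dW => //; exact: spd1.
have da : differentiable a q by exact: dW.
have db : differentiable b q by exact: dW.
have da0 : differentiable a0 q by exact: differentiableB.
have db0 : differentiable b0 q by exact: differentiableD.
have key (eta : 'rV[R]_2 -> 'rV[R]_4) (c d : 'rV[R]_2 -> R) :
    differentiable c q -> differentiable d q ->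
    (forall y, W y -> eta y = c y *: E 2%:R y + d y *: E 3%:R y) ->
    [/\ differentiable eta q, normal G f q (eta q),
      (\near q, comp eta 2%:R q = c q) & (\near q, comp eta 3%:R q = d q)].
  move=> dc dd H; split.
  - apply: near_eq_differentiable (dfr c d dc dd).
    by apply: near_V Wq _ => // y Wy; rewrite H.
  - apply/(normal_frameP _ Vq); rewrite (H q Wq).
    by have [h0 h1 _ _] := comps c d q Vq.
  - apply: near_V Wq _ => // y Wy; rewrite (H y Wy).
    by have [_ _ h _] := comps c d y (WV _ Wy).
  - apply: near_V Wq _ => // y Wy; rewrite (H y Wy).
    by have [_ _ _ h] := comps c d y (WV _ Wy).
have [d1 n1 c1 c1'] := key _ _ _ (dpa 1) (dpb 1) E1.
have [d0 n0 c0 c0'] := key _ _ _ da0 db0 E0.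
have f1 := ncov_u Vq d1 n1.
have f0 := ncov_v Vq d0.
have swap (h : 'rV[R]_2 -> R) : smooth_on W h -> pd 0 (pd 1 h) q = pd 1 (pd 0 h) q.
  move=> sh; apply: derive_swap.
  - by apply: near_V Wq _ => // y Wy; exact: dW.
  - by apply: dW => //; exact: (spd1 h 1).
  - by apply: dW => //; exact: (spd1 h 0).
rewrite (pd_near 0 c1) (pd_near 0 c1') (nbhs_singleton c1) (nbhs_singleton c1') in f1.
rewrite (pd_near 1 c0) (pd_near 1 c0') in f0.
have pa0 : pd 1 a0 q = pd 1 (pd 0 a) q - pd 1 b q.
  by apply: deriveB; exact: diff_derivable.
have pb0 : pd 1 b0 q = pd 1 (pd 0 b) q + pd 1 a q.
  by apply: deriveD; exact: diff_derivable.
rewrite /ncurv f1 f0 pa0 pb0 (swap a sa) (swap b sb); exact: subrr.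
Qed.

Lemma adapted_isothermal : isothermal G f V (fun q => ln (p q)).
Proof.
move=> q Vq; rewrite induced_conformal //; congr scalar_mx.
by rewrite mulrC expRM_natr lnK // posrE; exact: (warping_pos wpm).
Qed.

(** The normal part of the derivative of a tangent vector is dual to that of the
    normal vectors [E 2] and [E 3], of which only [E 2] has a derivative with a
    tangent component, along [E 0] and in the direction of [u]. *)
Lemma adapted_linearly_dependent : linearly_dependent_on G f V.
Proof.
have eE q : V q -> expR (2 * ln (p q)) = p q ^+ 2.
  by move=> Vq; rewrite mulrC expRM_natr lnK // posrE; exact: (warping_pos wpm).
have nf a : (a == 2%:R) || (a == 3%:R) -> normal_field G f V (fun q => p q *: E a q).
  move=> ha; split.
    move=> k; apply/Ck_mxP => // i j.
    have C : Ck k V (fun q => p q * E a q i j).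
      apply: Ck_mul => //; first exact: warping_smooth wpm k.
      exact: (proj1 (Ck_mxP _ _ oV) (adapted_frame adE a k)).
    by apply: Ck_eq C => // q _; rewrite mxE.
  move=> q Vq; apply/(normal_frameP _ Vq); rewrite !ipZl !(adapted_ip adE) //.
  by case/orP: ha => /eqP -> /=; rewrite mulr0.
exists (fun q => ln (p q)), (fun q => p q *: E 2%:R q), (fun q => p q *: E 3%:R q).
exists (fun=> delta_mx 0 0), (fun=> 0), (fun=> pi / 2); split.
- exact: adapted_isothermal.
- split; [exact: nf|exact: nf|] => q Vq; rewrite eE // /fprod.
  by split; rewrite ipZl ipZr (adapted_ip adE) //= ?mulr1 ?mulr0 // -expr2.
- move=> q Vq.
  have sT i : smooth_on V (tvec f i).
    by move=> k; have [_ H] := adapted_map adE k.+1; exact: H.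
  have dT i : differentiable (tvec f i) q by exact: smooth_differentiable (sT i) Vq.
  have zero i a : (a == 2%:R) || (a == 3%:R) -> \near q, comp (tvec f i) a q = 0.
    move=> ha; apply: near_V Vq _ => // y Vy; rewrite tangent // ipZl (adapted_ip adE) //.
    by rewrite /idx; case: ifP => _; case/orP: ha => /eqP -> /=; rewrite mulr0.
  have ipT i j a : (a == 2%:R) || (a == 3%:R) ->
      ip (g q) (cov G f i (tvec f j) q) (E a q) = - ip (g q) (tvec f j q) (cov G f i (E a) q).
    move=> ha; apply: etrans (ip_cov i a Vq (dT j)) _.
    by rewrite (pd_near i (zero j a ha)) /pd derive_cst sub0r.
  have dd a b : ip (g q) (E a q) (E b q) = (a == b)%:R by exact: adapted_ip adE _ _ _ Vq.
  have T0 : tvec f 0 q = p q *: E 0 q by rewrite tangent.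
  have T1 : tvec f 1 q = p q *: E 1 q by rewrite tangent.
  have [_ u20 u30] := comp_cov_u (tvec f 0) Vq.
  have [_ u21 u31] := comp_cov_u (tvec f 1) Vq.
  rewrite !T0 !ipZl !dd /= in u20 u30; rewrite !T1 !ipZl !dd /= in u21 u31.
  have w2 a : cov G f 1 (E a) q = 0 by exact: (adapted_cov_v adE a Vq).
  have h00 := ipT 0 0 2%:R isT; have h00' := ipT 0 0 3%:R isT.
  have h01 := ipT 0 1 2%:R isT; have h01' := ipT 0 1 3%:R isT.
  have h11 := ipT 1 1 2%:R isT; have h11' := ipT 1 1 3%:R isT.
  rewrite T0 ipZl u20 mulr0 sub0r opprK mulr1 in h00.
  rewrite T0 ipZl u30 !mulr0 oppr0 ?mulr0 oppr0 in h00'.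
  rewrite T1 ipZl u21 !mulr0 subr0 oppr0 in h01.
  rewrite T1 ipZl u31 !mulr0 oppr0 ?mulr0 oppr0 in h01'.
  rewrite w2 ip0r oppr0 in h11; rewrite w2 ip0r oppr0 in h11'.
  split.
  + apply: etrans (nor_frame _ Vq) _; rewrite -> h00; rewrite -> h00'.
    by rewrite !mxE /= !scale0r scale1r.
  + apply: etrans (nor_frame _ Vq) _; rewrite -> h01; rewrite -> h01'.
    by rewrite !mxE /= !scale0r.
  + apply: etrans (nor_frame _ Vq) _; rewrite -> h11; rewrite -> h11'.
    by rewrite !mxE /= !scale0r.
- by move=> k; exact: Ck_cst.
by move=> q _; rewrite cos_pihalf scale0r scaler0 addr0.
Qed.

(** A parallel normal field is orthogonal to [E 2], because [E 0] turns towards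
    [E 2], and then to [E 3], because [E 2] turns towards [E 3]. *)
Lemma adapted_no_parallel (W : set 'rV[R]_2) (xi : 'rV[R]_2 -> 'rV[R]_4) q :
  open W -> W `<=` V -> normal_field G f W xi ->
  (forall y, W y -> cov G f 0 xi y = 0) -> W q -> xi q = 0.
Proof.
move=> oW WV [sxi nxi] cxi Wq.
have dxi y : W y -> differentiable xi y by exact: smooth_differentiable.
have par a y : W y -> (forall z, W z -> comp xi a z = 0) ->
    ip (g y) (xi y) (cov G f 0 (E a) y) = 0.
  move=> Wy za; have e := ip_cov 0 a (WV _ Wy) (dxi _ Wy).
  have z : \near y, comp xi a y = (fun=> 0 : R) y by apply: near_V Wy _.
  rewrite (cxi y Wy) ip0l (pd_near 0 z) /pd derive_cst sub0r in e.
  by apply/eqP; rewrite -oppr_eq0 -e.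
have z0 y : W y -> comp xi 0 y = 0.
  by move=> Wy; have /(normal_frameP _ (WV _ Wy))[] := nxi y Wy.
have z1 y : W y -> comp xi 1 y = 0.
  by move=> Wy; have /(normal_frameP _ (WV _ Wy))[] := nxi y Wy.
have z2 y : W y -> comp xi 2%:R y = 0.
  move=> Wy; have [e _ _] := comp_cov_u xi (WV _ Wy).
  have p0 := par 0 y Wy z0; have h1 := z1 y Wy.
  by move: e; rewrite -> p0; rewrite -> h1; rewrite mulr0 subr0.
have z3 y : W y -> comp xi 3%:R y = 0.
  move=> Wy; have [_ e _] := comp_cov_u xi (WV _ Wy).
  have p0 := par 2%:R y Wy z2; have h1 := z0 y Wy.
  by move: e; rewrite -> p0; rewrite -> h1; rewrite subr0.
have e := frame_expand (xi q) (WV _ Wq); rewrite big_ord4 in e.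
have h0 := z0 q Wq; have h1 := z1 q Wq; have h2 := z2 q Wq; have h3 := z3 q Wq.
rewrite -> h0 in e; rewrite -> h1 in e; rewrite -> h2 in e; rewrite -> h3 in e.
by rewrite e !scale0r !addr0.
Qed.

(* The gradient of [ln p]. *)
Let lam (i : 'I_2) q : R := if i == 0 then 0 else m q.

Lemma christoffel_conformal q k i j : V q -> christoffel (induced G f) k i j q =
  (j == k)%:R * lam i q + (i == k)%:R * lam j q - (i == j)%:R * lam k q.
Proof.
move=> Vq; have p0 : p q != 0 by apply: lt0r_neq0; exact: (warping_pos wpm).
have dp : differentiable p q by exact: smooth_differentiable (warping_smooth wpm) Vq.
have pdp c : pd c p q = p q * lam c q.
  rewrite /lam; case: (eqVneq c 0) => [->|c0].
    by rewrite mulr0; exact: (warping_u wpm).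
  have -> : c = 1 by apply: val_inj; case: c c0 => [[|[|]]].
  exact: (warping_v wpm).
have D c a b : pd c (fun y => induced G f y a b : R) q = (a == b)%:R * (2 * p q ^+ 2 * lam c q).
  have -> : pd c (fun y => induced G f y a b : R) q = pd c (fun y => (a == b)%:R * (p y * p y)) q.
    apply: pd_near; apply: near_V Vq _ => // y Vy.
    by rewrite induced_conformal // mxE expr2; case: (a == b); rewrite ?mul1r ?mul0r.
  have dpp : differentiable (fun y => p y * p y) q by exact: differentiableM.
  have dc : differentiable (fun=> (a == b)%:R : R) q by exact: differentiable_cst.
  apply: etrans (derive_prod (delta_mx 0 c) dc dpp) _.
  rewrite derive_cst mulr0 addr0; congr (_ * _).
  apply: etrans (derive_prod (delta_mx 0 c) dp dp) _.
  by rewrite -/(pd c p q) pdp; ring.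
rewrite /christoffel induced_conformal // invmx_scalar.
under eq_bigr => l _ do rewrite !D.
have S (c : R) (x : 'I_2 -> R) : \sum_l (c%:M : 'M[R]_2) k l * x l = c * x k.
  rewrite (bigD1 k) //= big1 => [|l lk]; first by rewrite mxE eqxx addr0.
  by rewrite mxE eq_sym (negbTE lk) mul0r.
by rewrite S; field.
Qed.

(** The Gauss curvature of [p ^ 2 (du ^ 2 + dv ^ 2)], with [p] a function of [v]
    alone, is [- (pd 1 m) / p ^ 2]. *)
Lemma adapted_sectional q : V q ->
  sectional (induced G f) q (delta_mx 0 0) (delta_mx 0 1) = L0.
Proof.
move=> Vq; have p0 : p q != 0 by apply: lt0r_neq0; exact: (warping_pos wpm).
have r0 : riem (induced G f) 0 1 0 1 q = L0 * p q ^+ 2.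
  have d1 : pd 0 (christoffel (induced G f) 0 1 1) q = 0.
    have z : \near q, christoffel (induced G f) 0 1 1 q = (fun=> 0 : R) q.
      apply: near_V Vq _ => // y Vy; rewrite christoffel_conformal //.
      by rewrite /lam /= !mul0r mulr0 subr0 addr0.
    by rewrite (pd_near 0 z) /pd derive_cst.
  have d2 : pd 1 (christoffel (induced G f) 0 0 1) q = - (L0 * (p q * p q)).
    rewrite -(bending_v wpm Vq); apply: pd_near; apply: near_V Vq _ => // y Vy.
    by rewrite christoffel_conformal // /lam /= !mul0r mul1r add0r subr0.
  rewrite /riem d1 d2 big_ord2 !christoffel_conformal // /lam /=.
  by rewrite !(mul0r, mulr0, mul1r, add0r, addr0, subr0, sub0r); ring.
have c0 (v : 'rV[R]_2) (c : R) i : ip (c%:M) v (delta_mx 0 i) = c * v 0 i.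
  by rewrite ip_mulmx mul_mx_scalar -scalemxAl mxE trmx_delta -colE mxE.
rewrite /sectional induced_conformal // !c0.
have -> : curv (induced G f) q (delta_mx 0 0) (delta_mx 0 1) (delta_mx 0 1) 0 0 = L0 * p q ^+ 2.
  rewrite -r0 mxE; move: (riem (induced G f) 0) => r; rewrite !big_ord2 !mxE /=.
  by rewrite !(mul0r, mulr0, mul1r, mulr1, add0r, addr0).
rewrite !mxE /=.
by rewrite !(mul0r, mulr0, mulr1) expr0n /= subr0; field.
Qed.

End AdaptedGeometry.

(** * Isometries and adapted frames *)

Section Transport.
Context {R : realType}.
Variables (U U' : set 'rV[R]_4) (G G' : 'rV[R]_4 -> 'M[R]_4) (tau : 'rV[R]_4 -> 'rV[R]_4).
Hypotheses (oU : open U) (oU' : open U').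
Hypotheses (spdG : forall x, U x -> spd (G x)) (spdG' : forall x, U' x -> spd (G' x)).
Hypothesis smoothG : forall i j, smooth_on U (fun x => G x i j : R).
Hypothesis smoothG' : forall i j, smooth_on U' (fun x => G' x i j : R).
Hypothesis smooth_tau : smooth_on U tau.
Hypothesis tauU : forall x, U x -> U' (tau x).
Hypothesis isom : forall x v w, U x ->
  ip (G x) v w = ip (G' (tau x)) ('D_v tau x) ('D_w tau x).
Hypothesis onto : forall x y, U x -> exists v, 'D_v tau x = y.

Lemma pd_pushforward (f xi : 'rV[R]_2 -> 'rV[R]_4) i q : U (f q) ->
  differentiable f q -> differentiable xi q ->
  pd i (fun q => 'D_(xi q) tau (f q)) q =
  'D_(pd i xi q) tau (f q) + 'D_(pd i f q) (fun y => 'D_(xi q) tau y) (f q).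
Proof.
move=> Uq df dxi.
have dt y : U y -> differentiable tau y by exact: smooth_differentiable.
have nf : \forall y \near q, U (f y).
  by apply: (differentiable_continuous df); exact: open_nbhs_nbhs.
have dpt k : differentiable (pd k tau) (f q).
  apply: smooth_differentiable Uq => N; have [_ h] := smooth_tau N.+1; exact: h.
have dptf k : differentiable (fun y => pd k tau (f y)) q.
  exact: (@differentiable_comp _ _ _ _ f (pd k tau)).
have dx k : differentiable (fun y => xi y 0 k : R) q.
  by have /differentiable_mxP := dxi.
have E : \near q, 'D_(xi q) tau (f q) = \sum_k xi q 0 k *: pd k tau (f q).
  by apply: filterS nf => y Uy; rewrite derive_pd //; exact: dt.
rewrite (pd_near i E).
have dterm k : differentiable (fun y => xi y 0 k *: pd k tau (f y)) q.
  exact: differentiable_scalev.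
apply: etrans (derive_bigsum _ dterm) _.
have -> : 'D_(pd i xi q) tau (f q) = \sum_k pd i xi q 0 k *: pd k tau (f q).
  by rewrite derive_pd //; exact: dt.
have -> : 'D_(pd i f q) (fun y => 'D_(xi q) tau y) (f q) =
    \sum_k xi q 0 k *: 'D_(pd i f q) (pd k tau) (f q).
  have -> : 'D_(pd i f q) (fun y => 'D_(xi q) tau y) (f q) =
     'D_(pd i f q) (fun y => \sum_k xi q 0 k *: pd k tau y) (f q).
    apply: near_eq_derive.
    by near=> y; rewrite derive_pd //; apply: dt; near: y; exact: open_nbhs_nbhs.
  have dc k : differentiable (fun=> xi q 0 k : R) (f q) by exact: differentiable_cst.
  have dk k : differentiable (fun y => xi q 0 k *: pd k tau y) (f q).
    exact: differentiable_scalev (dc k) (dpt k).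
  apply: etrans (derive_bigsum _ dk) _; apply: eq_bigr => k _.
  apply: etrans (derive_scale _ (dc k) (dpt k)) _.
  by rewrite derive_cst scale0r add0r.
rewrite -big_split; apply: eq_bigr => k _ /=.
apply: etrans (derive_scale _ (dx k) (dptf k)) _.
have h1 := esym (derive_mx_coord (delta_mx 0 i) 0 k dxi).
have h2 : pd i (fun y => pd k tau (f y)) q = 'D_(pd i f q) (pd k tau) (f q).
  exact: (@derive_comp _ _ _ _ f (pd k tau)).
exact: (congr2 (fun a b => a *: pd k tau (f q) + xi q 0 k *: b) h1 h2).
Unshelve. all: by end_near. Qed.

Lemma cov_pushforward (f xi : 'rV[R]_2 -> 'rV[R]_4) i q : U (f q) ->
  differentiable f q -> differentiable xi q ->
  cov G' (tau \o f) i (fun q => 'D_(xi q) tau (f q)) q = 'D_(cov G f i xi q) tau (f q).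
Proof.
move=> Uq df dxi.
have dt : differentiable tau (f q) by exact: smooth_differentiable smooth_tau Uq.
have c1 : cov G' (tau \o f) i (fun q => 'D_(xi q) tau (f q)) q =
    pd i (fun q => 'D_(xi q) tau (f q)) q +
    chr G' (tau (f q)) (pd i (tau \o f) q) ('D_(xi q) tau (f q)) by [].
have c2 : cov G f i xi q = pd i xi q + chr G (f q) (pd i f q) (xi q) by [].
have e1 := pd_pushforward i Uq df dxi.
have e2 : pd i (tau \o f) q = 'D_(pd i f q) tau (f q) by exact: derive_comp.
have e3 := chr_transform oU oU' spdG spdG' smoothG smoothG' smooth_tau tauU isom onto
  (pd i f q) (xi q) Uq.
rewrite c1 c2 (derive_addv _ _ dt) -e3 e1 e2.
by rewrite -!addrA; congr (_ + _); rewrite addrC.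
Qed.

(** The differential of an isometry carries inner products and, by
    [cov_pushforward], covariant derivatives. *)
Lemma adapted_pushforward (V : set 'rV[R]_2) (f : 'rV[R]_2 -> 'rV[R]_4)
    (E : 'I_4 -> 'rV[R]_2 -> 'rV[R]_4) (p m : 'rV[R]_2 -> R) : open V ->
  (forall q, V q -> U (f q)) -> adapted V G f E p m ->
  adapted V G' (tau \o f) (fun a q => 'D_(E a q) tau (f q)) p m.
Proof.
move=> oV fU adE.
have dfq q : V q -> differentiable f q by exact: smooth_differentiable (adapted_map adE).
have dEq a q : V q -> differentiable (E a) q by exact: smooth_differentiable (adapted_frame adE a).
have dt q : V q -> differentiable tau (f q).
  by move=> Vq; exact: smooth_differentiable smooth_tau (fU _ Vq).
have pdE i q : V q -> pd i (tau \o f) q = 'D_(pd i f q) tau (f q).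
  by move=> Vq; apply: derive_comp; [exact: dfq|exact: dt].
split.
- exact: smooth_comp oV oU fU (adapted_map adE) smooth_tau.
- move=> a k; apply/Ck_mxP => // i j.
  have C : Ck k V (fun q => \sum_l E a q 0 l * pd l tau (f q) i j).
    apply: Ck_sum => // l; apply: Ck_mul => //.
      exact: (proj1 (Ck_mxP _ _ oV) (adapted_frame adE a k)).
    apply: (@Ck_comp _ _ _ k V U f (fun x => pd l tau x i j)) => //.
      exact: (adapted_map adE k).
    have [_ h] := smooth_tau k.+1; exact: (proj1 (Ck_mxP _ _ oU) (h l)).
  apply: Ck_eq C => // q Vq; rewrite derive_pd; last exact: dt.
  by rewrite summxE; apply: eq_bigr => l _; rewrite mxE.
- move=> q a b Vq; rewrite -(adapted_ip adE a b Vq); apply: esym; exact: isom (fU _ Vq).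
- by move=> q Vq; rewrite pdE // (adapted_u adE) // derive_scalev //; exact: dt.
- by move=> q Vq; rewrite pdE // (adapted_v adE) // derive_scalev //; exact: dt.
- move=> a q Vq; apply: etrans (cov_pushforward 0 (fU _ Vq) (dfq _ Vq) (dEq a q Vq)) _.
  have dtq := dt q Vq; rewrite (adapted_cov_u adE) // deriveE // linear_sum.
  by apply: eq_bigr => b _; rewrite linearZ deriveE.
move=> a q Vq; apply: etrans (cov_pushforward 1 (fU _ Vq) (dfq _ Vq) (dEq a q Vq)) _.
by rewrite (adapted_cov_v adE) // derive0.
Qed.

End Transport.

(** * The disc as a Riemann surface *)

Section Disc.
Context {R : realType}.

(** Balls with rational centre and radius [1 / (k + 1)] form a basis. *)
Lemma second_countable_rV n : @second_countable 'rV[R]_n.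
Proof.
pose b (c : 'rV[rat]_n * nat) : set 'rV[R]_n := ball (map_mx ratr c.1 : 'rV[R]_n) c.2.+1%:R^-1.
exists (b @` setT).
  exact: sub_countable (card_image_le _ _) (countableP _).
split=> [_ [c _ <-]|x V /nbhs_ballP[e /= e0 xV]].
  by apply: ball_open; rewrite invr_gt0 ltr0n.
have e2 : 0 < e / 2 by rewrite divr_gt0.
have [k] := @ltr_add_invr R 0 (e / 2) e2; rewrite add0r => ke.
have k0 : 0 < (k.+1%:R : R)^-1 by rewrite invr_gt0 ltr0n.
have [d dE] : exists d : R, d = k.+1%:R^-1 by exists k.+1%:R^-1.
rewrite -dE in ke k0.
have /choice[c Hc] (j : 'I_n) : exists q : rat, `|ratr q - x 0 j| <= d / 2.
  have /rat_in_itvoo[q] : x 0 j - d / 2 < x 0 j + d / 2 by lra.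
  by rewrite in_itv /= => /andP[h1 h2]; exists q; rewrite ler_norml; apply/andP; split; lra.
have cx : ball (map_mx ratr (\row_j c j) : 'rV[R]_n) d x.
  rewrite -ball_normE /=; apply: (@le_lt_trans _ _ (d / 2)); last by lra.
  apply: mx_norm_le => [|i j]; first by lra.
  by rewrite !mxE (ord1 i).
exists (b (\row_j c j, k)).
  by split; [exists (\row_j c j, k)|rewrite /b /= -dE].
apply: subset_trans xV => z; rewrite /b /= -dE => cz.
rewrite (splitr e); apply: (@ball_triangle _ _ (map_mx ratr (\row_j c j) : 'rV[R]_n)).
  by apply: (le_ball (ltW ke)); exact: ball_sym.
exact: (le_ball (ltW ke)).
Qed.

(** Every point is joined to [0] by a segment. *)
Lemma connected_normed (V : normedModType R) : connected [set: V].
Proof.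
have -> : [set: V] = \bigcup_(x in [set: V]) ((fun t : R => t *: x) @` `[0, 1]).
  apply/seteqP; split=> x // _; exists x => //; exists 1; last by rewrite scale1r.
  by rewrite /= in_itv /= ler01 lexx.
apply: bigcup_connected => [|x _].
  exists 0 => x _; exists 0; last by rewrite scale0r.
  by rewrite /= in_itv /= ler01 lexx.
apply: connected_continuous_connected; first exact: segment_connected.
by apply: continuous_subspaceT => t; exact: scalel_continuous.
Qed.

Variable rho : R.
Hypothesis rho0 : 0 < rho.

(** The carrier of the disc is the whole plane, which the single chart contracts
    radially: connectedness and separation are then those of a vector space. *)
Definition disc_chart : chart R 2 'rV[R]_2 :=
  Chart setT (fun x => (rho / (1 + `|x|)) *: x) (fun y => (rho - `|y|)^-1 *: y).

Lemma disc_cmapK x : cinv disc_chart (cmap disc_chart x) = x.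
Proof.
have x1 : 0 < 1 + `|x| by have := normr_ge0 x; lra.
have nx : `|cmap disc_chart x| = rho / (1 + `|x|) * `|x|.
  by rewrite /= normrZ ger0_norm // divr_ge0 // ltW.
rewrite [LHS]/= -[(rho / _) *: x]/(cmap disc_chart x) nx scalerA.
rewrite (_ : _ * _ = 1) ?scale1r //.
have -> : rho - rho / (1 + `|x|) * `|x| = rho / (1 + `|x|).
  by field; rewrite lt0r_neq0.
by rewrite mulVf // lt0r_neq0 // divr_gt0.
Qed.

Lemma disc_cinvK y : `|y| < rho -> cmap disc_chart (cinv disc_chart y) = y.
Proof.
move=> yr; have d0 : 0 < rho - `|y| by rewrite subr_gt0.
have nx : `|cinv disc_chart y| = (rho - `|y|)^-1 * `|y|.
  by rewrite /= normrZ ger0_norm // invr_ge0 ltW.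
rewrite [LHS]/= -[(rho - `|y|)^-1 *: y]/(cinv disc_chart y) nx /= scalerA.
rewrite (_ : _ * _ = 1) ?scale1r //.
have -> : 1 + (rho - `|y|)^-1 * `|y| = rho / (rho - `|y|).
  by field; rewrite lt0r_neq0.
rewrite invfM invrK mulrA divff ?lt0r_neq0 // mul1r mulfV //.
by rewrite lt0r_neq0.
Qed.

Lemma disc_cimg y : cimg disc_chart y <-> `|y| < rho.
Proof.
split=> [[x _ <-]|yr]; last by exists (cinv disc_chart y) => //; exact: disc_cinvK.
have x0 := normr_ge0 x; have x1 : 0 < 1 + `|x| by lra.
rewrite /= normrZ ger0_norm; last by rewrite divr_ge0 // ltW.
by rewrite mulrAC ltr_pdivrMr // ltr_pM2l //; lra.
Qed.

Lemma disc_open : open [set y : 'rV[R]_2 | `|y| < rho].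
Proof.
have -> : [set y : 'rV[R]_2 | `|y| < rho] = ball 0 rho.
  by apply/seteqP; split => y; rewrite -ball_normE /= sub0r normrN.
exact: ball_open.
Qed.

Lemma disc_is_chart : is_chart disc_chart.
Proof.
have cimgE : cimg disc_chart = [set y : 'rV[R]_2 | `|y| < rho].
  by apply/seteqP; split => y /disc_cimg.
split.
- exact: openT.
- by rewrite cimgE; exact: disc_open.
- by move=> x _; exact: disc_cmapK.
- move=> x _; apply: continuousZ; last exact: cvg_id.
  apply: continuousM; first exact: cst_continuous.
  apply: continuousV; first by rewrite lt0r_neq0 // ltr_pwDl.
  by apply: continuousD; [exact: cst_continuous|exact: norm_continuous].
move=> y /disc_cimg yr; apply: continuousZ; last exact: cvg_id.
apply: continuousV; first by rewrite lt0r_neq0 // subr_gt0.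
by apply: continuousB; [exact: cst_continuous|exact: norm_continuous].
Qed.

Lemma disc_trans y : `|y| < rho -> trans disc_chart disc_chart y = y.
Proof. exact: disc_cinvK. Qed.

Lemma disc_overlap : overlap disc_chart disc_chart = [set y | `|y| < rho].
Proof.
rewrite /overlap setIid; apply/seteqP; split => y; first by move/disc_cimg.
by move=> yr; apply/disc_cimg.
Qed.

Lemma Ck_id n k (U : set 'rV[R]_n) : open U -> Ck k U (fun x : 'rV[R]_n => x).
Proof. by move=> oU; apply/Ck_mxP => // i j; rewrite (ord1 i); exact: Ck_coord. Qed.

Lemma disc_smooth c d : [set disc_chart] c -> [set disc_chart] d ->
  smooth_on (overlap c d) (trans c d).
Proof.
move=> -> -> k; rewrite disc_overlap.
apply: Ck_eq (Ck_id k disc_open); first exact: disc_open.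
by move=> y yr; rewrite disc_trans.
Qed.

Definition disc : manifold R 2.
Proof.
apply: (@Manifold R 2 'rV[R]_2 [set disc_chart]).
- exact: norm_hausdorff.
- exact: second_countable_rV.
- by move=> c ->; exact: disc_is_chart.
- by move=> x; exists disc_chart.
- exact: disc_smooth.
Defined.

Lemma disc_riemann_surface : riemann_surface disc.
Proof.
split; first by exists 0.
  exact: connected_normed.
move=> c d y -> ->; rewrite disc_overlap => yr.
have E i : pd i (trans disc_chart disc_chart) y = delta_mx 0 i.
  rewrite (@pd_near _ _ _ _ (fun x => x)); first by rewrite /pd; exact: derive_id.
  apply: filterS (@disc_trans) _; apply: (open_nbhs_nbhs (p := y)); split => //.
  exact: disc_open.
by rewrite !E !mxE /= oppr0.
Qed.

End Disc.

(** * The surface in the charts of the ambient manifold *)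

Lemma smooth_sub {R : realType} n (X : normedModType R) (A B : set 'rV[R]_n) (k : 'rV[R]_n -> X) :
  B `<=` A -> smooth_on A k -> smooth_on B k.
Proof. by move=> BA s j; exact: Ck_sub BA (s j). Qed.

Section Restriction.
Context {R : realType}.
Variables (V W : set 'rV[R]_2) (G : 'rV[R]_4 -> 'M[R]_4).
Variables (f f' : 'rV[R]_2 -> 'rV[R]_4) (E : 'I_4 -> 'rV[R]_2 -> 'rV[R]_4) (p m : 'rV[R]_2 -> R).
Hypotheses (oW : open W) (WV : W `<=` V).

Lemma warping_sub L0 : warping L0 V p m -> warping L0 W p m.
Proof.
by move=> [h1 h2 h3 h4 h5]; split=> [q /WV||q /WV|q /WV|q /WV]; auto; exact: smooth_sub WV _.
Qed.

Lemma adapted_sub : (forall q, W q -> f q = f' q) -> adapted V G f E p m -> adapted W G f' E p m.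
Proof.
move=> ff' [h1 h2 h3 h4 h5 h6 h7].
have pdE i q : W q -> pd i f' q = pd i f q.
  move=> Wq; apply: pd_near; have : nbhs q W by exact: open_nbhs_nbhs.
  by apply: filterS => y /ff' ->.
have covE i a q : W q -> cov G f' i (E a) q = cov G f i (E a) q.
  move=> Wq; have e1 := pdE i q Wq; have e2 := ff' q Wq.
  by rewrite /cov /tvec; rewrite -> e1; rewrite <- e2.
split.
- by move=> k; apply: Ck_eq (Ck_sub WV (h1 k)).
- by move=> a; exact: smooth_sub WV (h2 a).
- by move=> q a b Wq; rewrite -ff' //; apply: h3; exact: WV.
- by move=> q Wq; rewrite pdE //; apply: h4; exact: WV.
- by move=> q Wq; rewrite pdE //; apply: h5; exact: WV.
- by move=> a q Wq; rewrite covE //; apply: h6; exact: WV.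
by move=> a q Wq; rewrite covE //; apply: h7; exact: WV.
Qed.

End Restriction.

Section Charts.
Context {R : realType} {n : nat} {N : manifold R n}.
Implicit Types c d : chart R n N.

Lemma chart_cimg_open c : atlas c -> open (cimg c).
Proof. by move=> /atlas_chart[]. Qed.

Lemma chart_cinvK c x : atlas c -> cimg c x -> cdom c (cinv c x) /\ cmap c (cinv c x) = x.
Proof. by move=> /atlas_chart[_ _ K _ _] [y cy <-]; rewrite K. Qed.

Lemma overlapP c d x : atlas c ->
  overlap c d x <-> cimg c x /\ cdom d (cinv c x).
Proof.
move=> Ac; have [_ _ K _ _] := atlas_chart Ac.
split=> [[y [cy dy] <-]|[cx dx]]; first by split; [exists y|rewrite K].
have [h1 h2] := chart_cinvK Ac cx; exists (cinv c x) => //.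
Qed.

Lemma overlap_open c d : atlas c -> atlas d -> open (overlap c d).
Proof.
move=> Ac Ad; have [_ oc _ _ cc] := atlas_chart Ac; have [od _ _ _ _] := atlas_chart Ad.
rewrite openE => x /(overlapP _ _ Ac)[cx dx]; rewrite /interior.
have n1 : nbhs x (cimg c) by exact: open_nbhs_nbhs.
have n2 : nbhs x (cinv c @^-1` cdom d) by apply: (cc x cx); exact: open_nbhs_nbhs.
by apply: filterS2 n1 n2 => y h1 h2; apply/(overlapP _ _ Ac).
Qed.

Lemma trans_cimg c d x : atlas c -> overlap c d x -> cimg d (trans c d x).
Proof. by move=> Ac /(overlapP _ _ Ac)[cx dx]; exists (cinv c x). Qed.

Lemma trans_overlap c d x : atlas c -> atlas d -> overlap c d x ->
  overlap d c (trans c d x) /\ trans d c (trans c d x) = x.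
Proof.
move=> Ac Ad oc; have [cx dx] := proj1 (overlapP d x Ac) oc.
have [_ _ Kd _ _] := atlas_chart Ad; have [h1 h2] := chart_cinvK Ac cx.
rewrite /trans /=; split; last by rewrite /= Kd.
by apply/(overlapP _ _ Ad); split; [exists (cinv c x)|rewrite Kd].
Qed.

(** The differential of the inverse transition map is a right inverse. *)
Lemma trans_onto c d x y : atlas c -> atlas d -> overlap c d x ->
  exists v, 'D_v (trans c d) x = y.
Proof.
move=> Ac Ad oc; have [odc K] := trans_overlap Ac Ad oc.
have d1 : differentiable (trans c d) x.
  exact: smooth_differentiable (atlas_smooth Ac Ad) oc.
have d2 : differentiable (trans d c) (trans c d x).
  exact: smooth_differentiable (atlas_smooth Ad Ac) odc.
exists ('D_y (trans d c) (trans c d x)).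
have d1' : differentiable (trans c d) (trans d c (trans c d x)) by rewrite K.
have e := derive_comp y d2 d1'; rewrite K in e; rewrite -e.
have I : \forall z \near trans c d x, (trans c d \o trans d c) z = (fun z => z) z.
  have := open_nbhs_nbhs (conj (overlap_open Ad Ac) odc); apply: filterS => z oz.
  by have [] := trans_overlap Ad Ac oz.
by rewrite (near_eq_derive y I); exact: derive_id.
Qed.

End Charts.

Section ChartMetric.
Context {R : realType} {N : manifold R 4} (h : riem_metric N).
Implicit Types c d : chart R 4 N.

Lemma chart_spd c x : atlas c -> cimg c x -> spd (h c x).
Proof. by move=> Ac cx; split; [exact: coef_sym|move=> v; exact: coef_pos]. Qed.

Lemma adapted_change_chart c d (V : set 'rV[R]_2) (f : 'rV[R]_2 -> 'rV[R]_4)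
    (E : 'I_4 -> 'rV[R]_2 -> 'rV[R]_4) (p m : 'rV[R]_2 -> R) : atlas c -> atlas d ->
  open V -> (forall q, V q -> overlap c d (f q)) -> adapted V (h c) f E p m ->
  adapted V (h d) (trans c d \o f) (fun a q => 'D_(E a q) (trans c d) (f q)) p m.
Proof.
move=> Ac Ad oV fO adE.
apply: (@adapted_pushforward R (overlap c d) (cimg d) (h c) (h d) (trans c d)) => //.
- exact: overlap_open.
- exact: chart_cimg_open.
- by move=> x /(overlapP _ _ Ac)[cx _]; exact: chart_spd.
- by move=> x; exact: chart_spd.
- move=> i j; apply: smooth_sub (coef_smooth h Ac i j) => x.
  by move=> /(overlapP _ _ Ac)[].
- exact: coef_smooth.
- exact: atlas_smooth.
- by move=> x; exact: trans_cimg.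
- by move=> x v w; exact: coef_compat.
by move=> x y; exact: trans_onto.
Qed.

End ChartMetric.

Theorem theorem2p2 (R : realType) (L0 : R) (N : manifold R 4)
    (h : riem_metric N) (hN0 : [set: N] !=set0)
    (hN : constant_curvature h L0) :
  exists (M : manifold R 2) (F : M -> N),
    [/\ riemann_surface M,
        conformal_immersion h F,
        induced_curvature_is h F L0
      & normal_flat h F] /\
    [/\ linearly_dependent h F
      & ~ exists xi : chart R 4 N -> M -> 'rV[R]_4,
            parallel_normal_field h F xi].
Proof.
(* The frame is integrated in a chart [c0] around some point. *)
have [P _] := hN0; have [c0 Ac0 c0P] := atlas_cover P.
have oU := chart_cimg_open Ac0.
have spd0 x : cimg c0 x -> spd (h c0 x) by exact: chart_spd.
have sm0 := coef_smooth h Ac0.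
have Ux0 : cimg c0 (cmap c0 P) by exists P.
have curv0 x X Y Z : cimg c0 x ->
    Rm (h c0) x X Y Z = L0 *: (ip (h c0 x) Y Z *: X - ip (h c0 x) X Z *: Y).
  move=> cx; apply: (constant_curvature_tensor oU spd0 sm0 X Y Z cx) => X' Y' rf.
  exact: hN.
have [rho rho0 [Y HY]] := frame_solution_exists oU spd0 sm0 curv0 Ux0.
pose V0 : set 'rV[R]_2 := [set q | `|q| < rho].
have oV0 : open V0 by exact: disc_open.
pose f0 q := pos (Y q).
have f0U q : V0 q -> cimg c0 (f0 q) by move=> /HY[].
have dY q : V0 q -> differentiable Y q by move=> /HY[].
have YE q i : V0 q -> pd i Y q = frame_field L0 (h c0) i (Y q) by move=> /HY[].
have YO q : V0 q -> orthonormal_state (h c0) (Y q) by move=> /HY[].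
have Yp q : V0 q -> 0 < phi (Y q) by move=> /HY[].
have ad0 := adapted_frame_solution oU spd0 sm0 oV0 f0U dY YE YO.
have wp0 := warping_frame_solution oU spd0 sm0 oV0 f0U dY YE Yp.
pose phi0 : chart R 2 'rV[R]_2 := disc_chart rho.
pose M := disc rho0; pose F : M -> N := fun x => cinv c0 (f0 (cmap phi0 x)).
have V0cmap x : V0 (cmap phi0 x) by apply/(disc_cimg rho0); exists x.
have [_ _ _ cont0 contV0] := disc_is_chart rho0.
have [_ _ _ _ cc0] := atlas_chart Ac0.
have df0 q : V0 q -> differentiable f0 q.
  by move=> Vq; exact: smooth_differentiable (adapted_map ad0) Vq.
have cF0 q : V0 q -> {for q, continuous (cinv c0 \o f0)}.
  move=> Vq; apply: continuous_comp; first exact/differentiable_continuous/df0.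
  exact/cc0/f0U.
have cF : continuous F.
  move=> x; apply: (@continuous_comp _ _ _ (cmap phi0) (cinv c0 \o f0)).
    exact: cont0.
  exact: cF0.
have locdomP c q : locdom F phi0 c q <-> V0 q /\ cdom c (cinv c0 (f0 q)).
  split=> [[x [_ cx] <-]|[Vq cq]]; first by split; [exact: V0cmap|].
  exists (cinv phi0 q); last exact: disc_cinvK.
  by split => //=; rewrite /F disc_cinvK.
have locE c q : V0 q -> loc F phi0 c q = trans c0 c (f0 q).
  by move=> Vq; rewrite /loc /= /F disc_cinvK.
have locdom_open c : atlas c -> open (locdom F phi0 c).
  move=> Ac; have [oc _ _ _ _] := atlas_chart Ac.
  rewrite openE => q /locdomP[Vq cq]; rewrite /interior.
  have n1 : nbhs q V0 by exact: open_nbhs_nbhs.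
  have n2 : nbhs q ((cinv c0 \o f0) @^-1` cdom c).
    by apply: (cF0 q Vq); exact: open_nbhs_nbhs.
  by apply: filterS2 n1 n2 => y h1 h2; apply/locdomP.
have locdom_sub c : locdom F phi0 c `<=` V0 by move=> q /locdomP[].
have loc_overlap c q : locdom F phi0 c q -> overlap c0 c (f0 q).
  by move=> /locdomP[Vq cq]; apply/(overlapP _ _ Ac0); split => //; exact: f0U.
have loc_img c : atlas c -> forall q, locdom F phi0 c q -> cimg c (loc F phi0 c q).
  move=> Ac q lq; rewrite locE; last exact: locdom_sub lq.
  exact: trans_cimg Ac0 (loc_overlap c q lq).
(* In every chart [c] the image of the frame under the transition map from [c0]
   satisfies the same equations, with the same [phi] and [mu]. *)
pose E c a q := 'D_(row a (frame (Y q))) (trans c0 c) (f0 q).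
have adE c : atlas c -> adapted (locdom F phi0 c) (h c) (loc F phi0 c) (E c)
    (fun q => phi (Y q)) (fun q => mu (Y q)).
  move=> Ac; have oL := locdom_open c Ac.
  have ad1 := adapted_sub oL (@locdom_sub c) (fun q _ => erefl (f0 q)) ad0.
  have ad2 := adapted_change_chart Ac0 Ac oL (loc_overlap c) ad1.
  apply: (adapted_sub oL (@subset_refl _ _) _ ad2) => q lq.
  by rewrite locE //; exact: locdom_sub lq.
have wpE c : atlas c -> warping L0 (locdom F phi0 c) (fun q => phi (Y q)) (fun q => mu (Y q)).
  by move=> Ac; exact: (warping_sub (@locdom_sub c) wp0).
exists M, F; split; split.
- exact: disc_riemann_surface.
- split=> // _ c -> Ac; split; first exact: adapted_map (adE c Ac).
  exists (fun q => ln (phi (Y q))).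
  exact: adapted_isothermal (adE c Ac) (wpE c Ac).
- move=> _ c q -> Ac lq.
  exact: (adapted_sectional (locdom_open c Ac) (adE c Ac) (wpE c Ac) lq).
- move=> _ c V xi -> Ac oV VL nxi q Vq.
  exact: (adapted_ncurv (chart_cimg_open Ac) (fun x => @chart_spd _ _ h c x Ac)
    (coef_smooth h Ac) (loc_img c Ac) (adE c Ac) (wpE c Ac) oV VL nxi Vq).
- move=> _ c q -> Ac lq; exists (locdom F phi0 c); split => //; first exact: locdom_open.
  exact: (adapted_linearly_dependent (chart_cimg_open Ac) (fun x => @chart_spd _ _ h c x Ac)
    (coef_smooth h Ac) (locdom_open c Ac) (loc_img c Ac) (adE c Ac) (wpE c Ac)).
move=> [xi [_ Hxi]].
have [nxi Hq] := Hxi phi0 c0 erefl Ac0.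
have V00 : V0 0 by rewrite /V0 /= normr0.
have l0 : locdom F phi0 c0 0.
  by apply/locdomP; split=> //; have [] := chart_cinvK Ac0 (f0U 0 V00).
have [/eqP nz _] := Hq 0 l0; apply: nz.
apply: (adapted_no_parallel (chart_cimg_open Ac0) (fun x => @chart_spd _ _ h c0 x Ac0)
  (coef_smooth h Ac0) (loc_img c0 Ac0) (adE c0 Ac0) (wpE c0 Ac0)
  (locdom_open c0 Ac0) (@subset_refl _ _) nxi _ l0).
by move=> y ly; have [_ cy] := Hq y ly; exact: cy.
Qed.
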